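(* Let $$q(z)=\prod_{j=1}^s(1+z^{k_j}),\qquad k_j\in\mathbb{Z}_{\ge 0},$$ where at least one $k_j$ equals $1$. For every integer $m\ge 1$ there is $n_0=n_0(q,m)$ such that, for every integer $n\ge n_0$, the symmetric polynomial $$\prod_{i=1}^m q(x_i)^n$$ has nonnegative integer coefficients in the Schur basis in $m$ variables $x_1,\ldots,x_m$. Thus it is the character of a finite-dimensional polynomial representation of $\mathrm{U}(m)$.
   Context: The Schur basis in $m$ variables consists of the Schur polynomials $s_\lambda(x_1,\ldots,x_m)$, where $\lambda$ ranges over partitions with at most $m$ parts; it is a basis of the symmetric polynomials in $x_1,\ldots,x_m$. $\mathrm{U}(m)$ is the group of $m\times m$ unitary matrices. Schur polynomials are the characters of the irreducible polynomial representations of $\mathrm{U}(m)$, expressed in the eigenvalues $x_1,\ldots,x_m$ of a unitary matrix; a symmetric polynomial $p(x_1,\ldots,x_m)$ is said to be the character of a representation of $\mathrm{U}(m)$ if the character value at every $u\in\mathrm{U}(m)$ with eigenvalues $x_1,\ldots,x_m$ (with multiplicity) is $p(x_1,\ldots,x_m)$. *)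

(* Defs.v *)
From HB Require Import structures.
From mathcomp Require Import all_boot all_order all_algebra.
From mathcomp Require Import perm.
From mathcomp Require Import reals complex.
From mathcomp Require Import mpoly.

Set Implicit Arguments.
Unset Strict Implicit.
Unset Printing Implicit Defensive.

Import Order.TTheory GRing.Theory Num.Theory.
Local Open Scope ring_scope.

(* Partitions with at most m parts, padded with zeros to length m. *)
Definition bounded_partition (m : nat) := {l : m.-tuple nat | sorted geq l}.

Definition alternant (m : nat) (a : 'I_m -> nat) : {mpoly int[m]} :=
  \det (\matrix_(i < m, j < m) ('X_i ^+ a j : {mpoly int[m]})).

(* The partition delta = (m - 1, m - 2, ..., 0) *)
Definition staircase (m : nat) (j : 'I_m) : nat := (m - j.+1)%N.

Definition shifted (m : nat) (l : bounded_partition m) (j : 'I_m) : nat :=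
  (tnth (val l) j + staircase j)%N.

Lemma dvd_det_Vandermonde (R : comNzRingType) (n : nat) (f : 'I_n -> {poly R})
    (x : 'rV[R]_n) :
  exists c : R, \det (\matrix_(i, j) (f j).[x 0 i]) = c * \det (Vandermonde n x).
Proof.
elim: n f x => [|n IHn] f x; first by exists 1; rewrite !det_mx00 mulr1.
have /fin_all_exists [g fE] (j : 'I_n.+1) : exists g : {poly R},
    f j - (f j).[x 0 0]%:P = g * ('X - (x 0 0)%:P).
  by apply/factor_theorem; rewrite /root !hornerE subrr.
have fg j y : (f j).[y] = (f j).[x 0 0] + (g j).[y] * (y - x 0 0).
  have /(congr1 (horner^~ y)) := fE j.
  by rewrite !hornerE => /eqP; rewrite subr_eq addrC => /eqP.
set M := \matrix_(i, j) _.
pose xs : 'rV[R]_n := \row_i x 0 (lift ord0 i).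
pose D := \prod_(i < n) (xs 0 i - x 0 0).
pose L : 'M[R]_n.+1 := \matrix_(i, j)
  ((i == j)%:R - ((i != 0) && (j == 0))%:R).
have detL : \det L = 1.
  rewrite det_trig; last first.
    apply/is_trig_mxP => i j ltij; rewrite !mxE.
    have -> : (j == 0) = false by apply/eqP => j0; rewrite j0 in ltij.
    by rewrite andbF subr0; case: eqP => // ij; rewrite ij ltnn in ltij.
  by rewrite big1 // => i _; rewrite !mxE eqxx andNb subr0.
have LM0 j : (L *m M) 0 j = (f j).[x 0 0].
  rewrite !mxE (bigD1 ord0) //= big1 ?addr0 => [|k k0]; rewrite !mxE.
    by rewrite eqxx subr0 mul1r.
  by rewrite eq_sym (negPf k0) eqxx subr0 mul0r.
have LMl i j : (L *m M) (lift ord0 i) j = (xs 0 i - x 0 0) * (g j).[xs 0 i].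
  rewrite !mxE (bigD1 ord0) // (bigD1 (lift ord0 i)) //= big1; last first.
    move=> k /andP[k0 kl]; rewrite !mxE eq_sym (negPf kl) /= (negPf k0).
    by rewrite subr0 mul0r.
  rewrite !mxE eqxx /= !subr0 sub0r mulN1r mul1r addr0.
  by rewrite [(f j).[x 0 (lift _ _)]]fg addKr mulrC.
have /fin_all_exists [c cE] (j : 'I_n.+1) : exists c : R,
    cofactor (L *m M) 0 j = c * (D * \det (Vandermonde n xs)).
  have [c cE] := IHn (fun k => g (lift j k)) xs.
  exists ((-1) ^+ (0 + j) * c); rewrite /cofactor -mulrA; congr (_ * _).
  rewrite mulrCA -cE.
  have -> : row' 0 (col' j (L *m M)) =
      diag_mx (\row_i (xs 0 i - x 0 0)) *m \matrix_(i, k) (g (lift j k)).[xs 0 i].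
    by apply/matrixP => i k; rewrite mul_diag_mx [LHS]mxE [LHS]mxE LMl !mxE.
  by rewrite det_mulmx det_diag; congr (_ * _); apply: eq_bigr => i _; rewrite mxE.
exists (\sum_j (L *m M) 0 j * c j).
rewrite -[LHS]mul1r -detL -det_mulmx (expand_det_row _ 0) mulr_suml.
apply: eq_bigr => j _; rewrite cE [LHS]mulrA; congr (_ * _).
rewrite !det_Vandermonde big_ord_recl; congr (_ * _).
  rewrite big_mkcond big_ord_recl /= mul1r.
  by apply: eq_bigr => i _; rewrite mxE.
apply: eq_bigr => i _; rewrite [RHS]big_mkcond big_ord_recl /= mul1r big_mkcond.
by apply: eq_bigr => k _; rewrite !mxE.
Qed.

Lemma alternant_rev (m : nat) (a : 'I_m -> nat) :
  alternant a =
  \det (\matrix_(i < m, j < m) ('X^(a (rev_ord j)) : {poly {mpoly int[m]}}).[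
          (\row_k 'X_(rev_ord k) : 'rV_m) 0 i]).
Proof.
pose s := perm (@rev_ord_inj m).
have detE (A : 'M[{mpoly int[m]}]_m) : \det A = \det (row_perm s (col_perm s A)).
  rewrite row_permE col_permE !det_mulmx !det_perm ?odd_permV mulrCA.
  by rewrite -expr2 sqrr_sign mulr1.
rewrite /alternant detE.
by congr (\det _); apply/matrixP => i j; rewrite !mxE !permE hornerXn.
Qed.

Lemma alternant_staircaseE (m : nat) :
  alternant (@staircase m) =
  \det (Vandermonde m (\row_k 'X_(rev_ord k) : 'rV[{mpoly int[m]}]_m)).
Proof.
rewrite alternant_rev -det_tr; congr (\det _); apply/matrixP => i j.
by rewrite !mxE hornerXn /staircase /= subnSK // subKn // ltnW.
Qed.

Lemma alternant_staircase_neq0 (m : nat) : alternant (@staircase m) != 0.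
Proof.
rewrite alternant_staircaseE det_Vandermonde; apply/prodf_neq0 => i _.
apply/prodf_neq0 => j ltij; rewrite !mxE subr_eq0; apply/eqP.
move/(congr1 (fun p : {mpoly int[m]} => p@_U_(rev_ord j)))/eqP.
rewrite !mcoeffXU eqxx (inj_eq rev_ord_inj).
by rewrite -val_eqE (ltn_eqF ltij).
Qed.

Lemma dvd_alternant_staircase (m : nat) (a : 'I_m -> nat) :
  exists s : {mpoly int[m]}, alternant a == s * alternant (@staircase m).
Proof.
have [s sE] := dvd_det_Vandermonde
  (fun j => 'X^(a (rev_ord j)) : {poly {mpoly int[m]}})
  (\row_k 'X_(rev_ord k)).
by exists s; rewrite alternant_rev sE alternant_staircaseE.
Qed.

(* s_l = a_(l + delta) / a_delta; the quotient is exact and unique by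
   dvd_alternant_staircase and alternant_staircase_neq0. *)
Definition schur (m : nat) (l : bounded_partition m) : {mpoly int[m]} :=
  xchoose (dvd_alternant_staircase (shifted l)).

Lemma schurE (m : nat) (l : bounded_partition m) (s : {mpoly int[m]}) :
  (schur l == s) = (alternant (shifted l) == s * alternant (@staircase m)).
Proof.
have /eqP -> := xchooseP (dvd_alternant_staircase (shifted l)).
by rewrite (inj_eq (mulIf (alternant_staircase_neq0 m))).
Qed.

(* c is the (finitely supported) family of coordinates of p in the Schur
   basis. *)
Definition schur_expansion (m : nat) (p : {mpoly int[m]})
    (c : bounded_partition m -> int) : Prop :=
  exists2 r : seq (bounded_partition m),
    uniq r /\ (forall l, l \notin r -> c l = 0)
    & p = \sum_(l <- r) c l *: schur l.

Definition schur_nonneg (m : nat) (p : {mpoly int[m]}) : Prop :=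
  exists2 c : bounded_partition m -> int,
    schur_expansion p c & forall l, 0 <= c l.

(* A representation of U(m) on C^d; only the values of rho on unitary matrices
   are constrained. *)
Definition is_unitary_rep (R : realType) (m d : nat)
    (rho : 'M[R[i]]_m -> 'M[R[i]]_d) : Prop :=
  rho 1%:M = 1%:M /\
  (forall u v, u \is unitarymx -> v \is unitarymx ->
    rho (u *m v) = rho u *m rho v).

Definition is_polynomial_map (R : realType) (m d : nat)
    (rho : 'M[R[i]]_m -> 'M[R[i]]_d) : Prop :=
  exists P : 'I_d -> 'I_d -> {mpoly R[i][m * m]},
    forall u, u \is unitarymx ->
    forall a b, rho u a b = (P a b).@[fun k => mxvec u 0 k].

(* The hypothesis on char_poly says that x lists the eigenvalues of u with
   multiplicity. *)
Definition has_character (R : realType) (m d : nat)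
    (rho : 'M[R[i]]_m -> 'M[R[i]]_d) (p : {mpoly int[m]}) : Prop :=
  forall (u : 'M[R[i]]_m) (x : 'I_m -> R[i]), u \is unitarymx ->
    char_poly u = \prod_(i < m) ('X - (x i)%:P) ->
    \tr (rho u) = (map_mpoly intr p).@[x].

Definition is_polynomial_character (R : realType) (m : nat)
    (p : {mpoly int[m]}) : Prop :=
  exists (d : nat) (rho : 'M[R[i]]_m -> 'M[R[i]]_d),
    [/\ is_unitary_rep rho, is_polynomial_map rho & has_character rho p].

Definition prod1DXn (s : nat) (k : 'I_s -> nat) : {poly int} :=
  \prod_(j < s) (1 + 'X^(k j)).

Definition prod_at_vars_pow (m : nat) (q : {poly int}) (n : nat) :
    {mpoly int[m]} :=
  \prod_(i < m) (map_poly (@mpolyC m int) q).['X_i] ^+ n.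

(* Main.v *)
(* By the bialternant formula, the coefficient of s_l in prod_i q(x_i)^n is the minor
   det [z^(l_i + m - i)] z^j q(z)^n.  After multiplying column j by (1 + z)^(m - 1 - j), Fekete's
   criterion reduces the positivity of all these minors to that of the consecutive Toeplitz
   minors of (1 + z)^e q(z)^n with e <= m.

   Away from the two ends of the coefficient range, choose the saddle point rho with mean
   equal to the position of the minor.  As q has a factor 1 + z, |q(rho e^(i t))| has its unique
   maximum at t = 0, and writing coefficients as averages over roots of unity shows that the
   rescaled Toeplitz matrix has a positive definite symmetric part, hence a positive
   determinant.  At a bounded distance from the low end, the coefficient of z^l in q^n
   is, up to a common factor, a polynomial in n of degree l, and the leading coefficient of the
   minor is a determinant of falling factorials.  The high end follows as q is
   palindromic.

   For the representations, Frobenius' formula expresses s_l through power sums with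
   coefficients f(s), s in S_d; f has norm 1, is an integral combination of permutation
   characters and has a positive inner product with a character, so it is an irreducible
   character.  A representation M of S_d affording it cuts out of M (x) V^(x)d, V = C^m, the
   representation of U(m) with character s_l. *)
Require Import Defs.
From HB Require Import structures.
From mathcomp Require Import all_boot all_order all_algebra.
From mathcomp Require Import fingroup perm all_field all_character.
From mathcomp Require Import polyrcf reals Rstruct complex.
From mathcomp Require Import mpoly.
From mathcomp Require Import ring lra zify.
From Stdlib Require Rtrigo1 Rtrigo_alt Ratan.

Set Implicit Arguments.
Unset Strict Implicit.
Unset Printing Implicit Defensive.

Import Order.TTheory GRing.Theory Num.Theory.
Local Open Scope ring_scope.

Local Notation RR := Rdefinitions.R.
Local Notation cos := Rtrigo_def.cos.
Local Notation sin := Rtrigo_def.sin.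
Local Notation pi := Rtrigo1.PI.
Local Notation Re := complex.Re.
Local Notation Im := complex.Im.

(** * Determinants and Fekete's criterion *)

(** Multiplying by powers of [1 + z] repairs a degree mismatch. Fekete's criterion needs strict
    positivity of all consecutive minors in the leading columns, but [z^j q^n] vanishes above its
    own degree, so such minors vanish near the top. After the multiplication all columns have the
    same top degree, and the minors of order [r] are Toeplitz minors of [(1 + z)^(m - r) q^n] at
    positions that fill exactly its degree range.

    The main obstacle is uniformity, since the number of positions grows with [n]. The number
    [n rho / (1 + rho)^2], the variance of [n] tilted factors [1 + z], separates the regimes: above
    a fixed threshold the bulk estimate applies; below it the position is within a fixed distance of
    an end, which leaves finitely many positions.

    In the bulk no sharp local limit theorem is needed. Let [M^3] be of the order of that variance.
    It suffices that the phase has nonnegative real part for angles up to [1/M], real part at least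
    [1/4] on a window of size [M^-2], and modulus exponentially small in [M] elsewhere, because the
    window already controls the quadratic form up to a power of [M]. *)

Lemma det_gt0_of_posdef (R : realFieldType) (n : nat) (A : 'M[R]_n) :
  (forall x : 'rV_n, x != 0 -> 0 < (x *m A *m x^T) 0 0) -> 0 < \det A.
Proof.
elim: n A => [|n IHn] A posA; first by rewrite det_mx00 ltr01.
have {posA} posA (u : 'rV_1) (y : 'rV_n) : row_mx u y != 0 ->
    0 < (row_mx u y *m (A : 'M_(1 + n)) *m (row_mx u y)^T) 0 0 by exact: posA.
pose A' : 'M_(1 + n) := A.
pose a := ulsubmx A' 0 0; pose b := ursubmx A'; pose c := dlsubmx A'.
pose D := drsubmx A'.
have A'E : A' = block_mx a%:M b c D by rewrite -mx11_scalar submxK.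
rewrite -[\det A]/(\det A') A'E.
have {}posA u y := posA u y; rewrite -/A' A'E in posA.
have a_gt0 : 0 < a.
  have /posA : row_mx 1%:M 0 != 0 :> 'rV[R]_(1 + n).
    by apply/eqP => /matrixP/(_ 0 (lshift n 0))/eqP; rewrite row_mxEl !mxE oner_eq0.
  rewrite mul_row_block tr_row_mx mul_row_col !mul1mx !mul0mx !addr0 trmx0 trmx1.
  by rewrite mulmx1 [b *m _]mulmx0 addr0 mxE mulr1n.
(* The Schur complement of [a]. Its form at [y] is the form of [A] at [y] extended by [- a^-1 y c],
   which works for a non-symmetric [A] too. *)
pose S := D - a^-1 *: (c *m b).
have -> : block_mx a%:M b c D =
    block_mx 1%:M 0 (a^-1 *: c) 1%:M *m block_mx (a%:M) b 0 S.
  rewrite mulmx_block !mul1mx !mul0mx !addr0 -scalemxAl mul_mx_scalar.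
  by rewrite scalerA mulVf ?gt_eqF // scale1r /S -scalemxAl addrC subrK.
rewrite det_mulmx det_lblock det_ublock !det1 !mul1r det_scalar1.
apply: mulr_gt0 => //; apply: IHn => y y_neq0.
have /posA : row_mx (- a^-1 *: (y *m c)) y != 0.
  by apply: contra_neq y_neq0 => x0; rewrite -[y](row_mxKr (- a^-1 *: (y *m c))) x0 linear0.
rewrite mul_row_block tr_row_mx mul_row_col mul_mx_scalar scalerA mulrN mulfV ?gt_eqF //.
rewrite scaleN1r addNr mul0mx add0r.
suff -> : - a^-1 *: (y *m c) *m b + y *m D = y *m S by [].
by rewrite /S mulmxBr -scalemxAr -scalemxAl mulmxA scaleNr addrC.
Qed.

(** Subtracting from each row the one above it is a unitriangular operation that leaves a single
    nonzero entry in the first column. *)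
Lemma det_sub_rows (R : comRingType) (n : nat) (A : 'M[R]_n.+1) :
  (forall i, A i ord0 = 1) ->
  \det A = \det (\matrix_(i < n, j < n)
     (A (lift ord0 i) (lift ord0 j) - A (widen_ord (leqnSn n) i) (lift ord0 j))).
Proof.
move=> A1.
pose L : 'M[R]_n.+1 := \matrix_(i, j) ((i == j)%:R - (i == j.+1 :> nat)%:R).
have detL : \det L = 1.
  rewrite det_trig; last first.
    apply/is_trig_mxP => i j ltij; rewrite !mxE -val_eqE ltn_eqF //.
    by rewrite ltn_eqF ?subr0 // ltnS ltnW.
  by rewrite big1 // => i _; rewrite !mxE eqxx ltn_eqF ?subr0 // .
have LA0 j : (L *m A) ord0 j = A ord0 j.
  rewrite mxE (bigD1 ord0) //= !mxE eqxx subr0 mul1r big1 ?addr0 // => i i0.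
  by rewrite !mxE eq_sym (negPf i0) subr0 mul0r.
have LAS i j : (L *m A) (lift ord0 i) j = A (lift ord0 i) j - A (widen_ord (leqnSn n) i) j.
  have ne : widen_ord (leqnSn n) i != lift ord0 i.
    by rewrite -val_eqE /= /bump leq0n ltn_eqF.
  rewrite mxE (bigD1 (lift ord0 i)) // (bigD1 (widen_ord (leqnSn n) i)) //=.
  rewrite !mxE eqxx /= ltn_eqF // subr0 mul1r [lift _ _ == _]eq_sym (negPf ne).
  rewrite /bump leq0n add1n eqxx sub0r mulN1r big1 ?addr0 // => k /andP[k1 k2].
  rewrite !mxE eq_sym (negPf k1) eqSS.
  suff -> : (i == k :> nat) = false by rewrite subr0 mul0r.
  by apply: contraNF k2 => /eqP ik; apply/eqP/val_inj.
rewrite -[LHS]mul1r -detL -det_mulmx (expand_det_col _ ord0).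
rewrite big_ord_recl big1 ?addr0 => [|i _]; last first.
  by rewrite LAS !A1 subrr mul0r.
rewrite LA0 A1 mul1r /cofactor expr0 mul1r.
by congr (\det _); apply/matrixP => i j; rewrite [LHS]mxE [LHS]mxE LAS !mxE.
Qed.

Lemma det_mulr_rows (R : comRingType) (n : nat) (d : 'I_n -> R) (A : 'I_n -> 'I_n -> R) :
  \det (\matrix_(i, j) (d i * A i j)) = (\prod_i d i) * \det (\matrix_(i, j) A i j).
Proof.
have -> : \matrix_(i, j) (d i * A i j) = diag_mx (\row_i d i) *m \matrix_(i, j) A i j.
  by apply/matrixP => i j; rewrite mul_diag_mx !mxE.
by rewrite det_mulmx det_diag; congr (_ * _); apply: eq_bigr => i _; rewrite mxE.
Qed.

Lemma det_scale (R : comRingType) (n : nat) (a b : 'I_n -> R) (A : 'I_n -> 'I_n -> R) :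
  \det (\matrix_(i, j) (a i * A i j * b j)) =
  (\prod_i a i) * (\prod_i b i) * \det (\matrix_(i, j) A i j).
Proof.
have -> : \matrix_(i, j) (a i * A i j * b j) = \matrix_(i, j) (a i * (A i j * b j)).
  by apply/matrixP => i j; rewrite !mxE mulrA.
rewrite (det_mulr_rows a (fun i j => A i j * b j)) -mulrA; congr (_ * _).
rewrite -det_tr -[in RHS]det_tr.
have -> : (\matrix_(i, j) A i j)^T = \matrix_(i, j) A j i by apply/matrixP => i j; rewrite !mxE.
rewrite -(det_mulr_rows b (fun i j => A j i)).
by congr (\det _); apply/matrixP => i j; rewrite !mxE mulrC.
Qed.

(** Multilinearity in the rows: the sum runs over all choice functions, increasing or not. *)
Lemma det_sum_rows (R : comRingType) (n : nat) (I : finType) (c : 'I_n -> I -> R)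
    (B : I -> 'I_n -> R) :
  \det (\matrix_(i, j) \sum_t c i t * B t j) =
  \sum_(t : {ffun 'I_n -> I}) (\prod_i c i (t i)) * \det (\matrix_(i, j) B (t i) j).
Proof.
rewrite /determinant.
under eq_bigr => s _.
  under eq_bigr do rewrite mxE.
  rewrite bigA_distr_bigA mulr_sumr.
  over.
rewrite exchange_big; apply: eq_bigr => t _; rewrite mulr_sumr.
apply: eq_bigr => s _; rewrite big_split /= mulrCA; congr (_ * (_ * _)).
by apply: eq_bigr => i _; rewrite mxE.
Qed.

(** Fekete's criterion, by induction on the order. Dividing each row by its first entry and
    subtracting consecutive rows removes one column. The difference of the rows [l i] and [l i.+1]
    telescopes into unit steps [b], so the minor becomes a sum of minors of [b] of order one less.
    The consecutive minors of [b] are those of [a] up to a positive factor, hence [b] inherits the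
    hypothesis. *)
Lemma minors_gt0 (R : realFieldType) (r n : nat) (a : nat -> nat -> R) :
  (forall q l, (q <= r)%N -> (l + q <= n)%N ->
     0 < \det (\matrix_(i < q, j < q) a j (l + i)%N)) ->
  forall l : nat -> nat, (forall i j, (i < j < r)%N -> (l i < l j)%N) ->
    (forall i, (i < r)%N -> (l i < n)%N) ->
  0 < \det (\matrix_(i < r, j < r) a j (l i)).
Proof.
elim: r n a => [|r IHr] n a posa l l_incr l_lt; first by rewrite det_mx00.
have a0 x : (x < n)%N -> 0 < a 0%N x.
  move=> ltxn; have := posa 1%N x isT; rewrite addn1 => /(_ ltxn).
  by rewrite det_mx11 mxE addn0.
have normalize q (x : nat -> nat) : (forall i, (i <= q)%N -> (x i < n)%N) ->
    \det (\matrix_(i < q.+1, j < q.+1) a j (x i)) = (\prod_(i < q.+1) a 0%N (x i)) *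
    \det (\matrix_(i < q, j < q) (a j.+1 (x i.+1) / a 0%N (x i.+1) - a j.+1 (x i) / a 0%N (x i))).
  move=> ltx.
  have -> : \matrix_(i < q.+1, j < q.+1) a j (x i) =
      \matrix_(i < q.+1, j < q.+1) (a 0%N (x i) * (a j (x i) / a 0%N (x i))).
    by apply/matrixP => i j; rewrite !mxE mulrC divfK // gt_eqF // a0 // ltx // -ltnS.
  rewrite (det_mulr_rows (fun i : 'I_q.+1 => a 0%N (x i))
     (fun i j : 'I_q.+1 => a j (x i) / a 0%N (x i))); congr (_ * _).
  rewrite det_sub_rows => [|i]; last by rewrite mxE divff // gt_eqF // a0 // ltx // -ltnS.
  by congr (\det _); apply/matrixP => i j; rewrite !mxE.
have prod_gt0 q (x : nat -> nat) : (forall i, (i <= q)%N -> (x i < n)%N) ->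
    0 < \prod_(i < q.+1) a 0%N (x i).
  by move=> ltx; apply: prodr_gt0 => i _; rewrite a0 // ltx // -ltnS.
rewrite normalize // mulr_gt0 ?prod_gt0 //.
pose b j x := a j.+1 x.+1 / a 0%N x.+1 - a j.+1 x / a 0%N x.
have posb q x : (q <= r)%N -> (x + q <= n.-1)%N ->
    0 < \det (\matrix_(i < q, j < q) b j (x + i)%N).
  move=> leqr ltxq; have n_gt0 : (0 < n)%N by rewrite (leq_ltn_trans _ (l_lt 0%N _)).
  have lexq : (x + q.+1 <= n)%N by rewrite addnS -(prednK n_gt0) ltnS.
  have ltx i : (i <= q)%N -> (x + i < n)%N.
    by move=> leiq; rewrite (leq_trans _ lexq) // addnS ltnS leq_add2l.
  have := posa q.+1 x leqr lexq; rewrite normalize // pmulr_rgt0 ?prod_gt0 //.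
  set A := \matrix_(_, _) _; set B := \matrix_(_, _) _; suff -> : A = B by [].
  by apply/matrixP => i j; rewrite !mxE /b !addnS.
(* Row [i] collects the steps from [l i] to [l i.+1]. These ranges are disjoint and ordered, so
   every choice of nonzero weight is strictly increasing. *)
pose c (i : 'I_r) (t : 'I_n) : R := (l i <= t < l i.+1)%N%:R.
have -> : \matrix_(i < r, j < r) (a j.+1 (l i.+1) / a 0%N (l i.+1) - a j.+1 (l i) / a 0%N (l i)) =
    \matrix_(i < r, j < r) \sum_t c i t * b j t.
  apply/matrixP => i j; rewrite !mxE.
  have lei : (l i <= l i.+1)%N by rewrite ltnW // l_incr // ltnSn ltnS /=.
  rewrite -(telescope_sumr (fun x => a j.+1 x / a 0%N x) lei).
  have len : (l i.+1 <= n)%N by apply: ltnW; apply: l_lt; rewrite ltnS.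
  rewrite (big_nat_widen (l i) (l i.+1) n _ _ len).
  rewrite (big_nat_widenl (l i) 0 n) // big_mkord big_mkcond /=.
  apply: eq_bigr => t _; rewrite /c andbC.
  by case: ifP => _; rewrite ?mul1r ?mul0r.
rewrite (det_sum_rows c (fun (t : 'I_n) (j : 'I_r) => b j t)).
have c_ge0 t : 0 <= \prod_(i < r) c i (t i) by apply: prodr_ge0 => i _; apply: ler0n.
have term_gt0 (t : {ffun 'I_r -> 'I_n}) : (forall i, c i (t i) = 1) ->
    0 < \det (\matrix_(i, j) b j (t i)).
  move=> ct; have {}ct (i : 'I_r) : (l i <= t i < l i.+1)%N.
    by have := ct i; rewrite /c; case: (_ <= _ < _)%N => // /esym/eqP; rewrite oner_eq0.
  (* The induction hypothesis takes rows indexed by [nat]; the default value 0 is never read. *)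
  pose u x := if insub x is Some i then val (t i) else 0%N.
  have uE (i : 'I_r) : u i = t i by rewrite /u valK.
  have l_mono i j : (i <= j <= r)%N -> (l i <= l j)%N.
    case/andP; rewrite leq_eqVlt => /predU1P[->//|ltij] lejr.
    by rewrite ltnW // l_incr // ltij ltnS.
  have := IHr n.-1 b posb u; rewrite /=.
  set A := \matrix_(_, _) _; set B := \matrix_(_, _) _.
  have -> : A = B by apply/matrixP => i j; rewrite !mxE uE.
  apply=> [i j /andP[ltij ltjr]|i ltir].
    rewrite (uE (Ordinal (ltn_trans ltij ltjr))) (uE (Ordinal ltjr)).
    have /andP[_ ti] := ct (Ordinal (ltn_trans ltij ltjr)).
    have /andP[tj _] := ct (Ordinal ltjr).
    by apply: (leq_trans ti); apply: leq_trans tj; apply: l_mono; rewrite ltij ltnW.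
  rewrite (uE (Ordinal ltir)); have /andP[_ ti] := ct (Ordinal ltir).
  have lt1 : (l i.+1 < n)%N by apply: l_lt.
  by rewrite -ltnS prednK ?(leq_trans _ lt1) // (leq_trans _ lt1).
have t0P (i : 'I_r) : (l i < n)%N by apply: l_lt; rewrite ltnW // ltnS.
(* The choice of the first step in every range has weight 1 and gives strictness; the other terms
   are nonnegative. *)
pose t0 := [ffun i : 'I_r => Ordinal (t0P i)].
have ct0 i : c i (t0 i) = 1.
  by rewrite /c ffunE /= leqnn l_incr //= ltnSn ltnS ltn_ord.
rewrite (bigD1 t0) //= ltr_wpDr //; last first.
  by rewrite big1 ?mul1r ?term_gt0.
apply: sumr_ge0 => t _.
have [/forallP ct|] := boolP [forall i, c i (t i) == 1].
  by rewrite mulr_ge0 // ltW // term_gt0 // => i; apply/eqP.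
rewrite negb_forall => /existsP[i cti].
suff -> : c i (t i) = 0 -> \prod_i c i (t i) = 0; rewrite ?mul0r //.
  by move: cti; rewrite /c; case: (_ <= _ < _)%N; rewrite ?eqxx.
by move=> c0; rewrite (bigD1 i) //= c0 mul0r.
Qed.

(** * Trigonometric estimates *)

Lemma pi_gt0 : 0 < pi. Proof. by apply/RltP; exact: Rtrigo1.PI_RGT_0. Qed.

Lemma pi_le4 : pi <= 4.
Proof. by apply/RleP; have := Rtrigo1.PI_4; rewrite IZRposE INRE. Qed.

Lemma cos2D_sin2 (x : RR) : cos x ^+ 2 + sin x ^+ 2 = 1.
Proof.
have := Rtrigo1.sin2_cos2 x; rewrite /RIneq.Rsqr RplusE !RmultE R1E addrC.
by rewrite !expr2.
Qed.

Lemma sinN (x : RR) : sin (- x) = - sin x. Proof. exact: Rtrigo1.sin_neg. Qed.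
Lemma cosN (x : RR) : cos (- x) = cos x. Proof. exact: Rtrigo1.cos_neg. Qed.

Lemma cos_half (x : RR) : cos x = 1 - 2 * sin (x / 2) ^+ 2.
Proof.
have := cos2D_sin2 (x / 2); have := cosD (x / 2) (x / 2).
rewrite RplusE -splitr -!expr2; lra.
Qed.

Lemma sin_le (x : RR) : 0 <= x -> sin x <= x.
Proof.
rewrite le_eqVlt => /predU1P[<-|x_gt0].
  by have := Rtrigo_def.sin_0; rewrite R0E => ->.
by apply/ltW/RltP; apply: Ratan.sin_lt_x; apply/RltP.
Qed.

Lemma sin_ge (x : RR) : 0 <= x <= 4 -> x - x ^+ 3 / 6 <= sin x.
Proof.
case/andP=> /RleP x_ge0 x_le4.
have {}x_le4 : Rdefinitions.Rle x (Rdefinitions.IZR (BinNums.Zpos (BinNums.xO (BinNums.xO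
  BinNums.xH)))).
  by rewrite IZRposE INRE; apply/RleP.
have [+ _] := Rtrigo_alt.pre_sin_bound x 0%N x_ge0 x_le4.
move/RleP; rewrite /Rtrigo_alt.sin_approx /= /Rtrigo_alt.sin_term /=.
rewrite ?(RplusE, RmultE, RdivE, RoppE, R1E, INRE) /=.
have -> : Rdefinitions.IZR (BinNums.Zneg BinNums.xH) = -1 :> RR by [].
by apply: le_trans; rewrite le_eqVlt; apply/orP; left; apply/eqP; field.
Qed.

Lemma normr_sin_le (x : RR) : `|sin x| <= `|x|.
Proof.
wlog x_ge0 : x / 0 <= x => [hw|].
  have [/hw //|x_lt0] := leP 0 x.
  by rewrite -[`|sin x|]normrN -sinN -[`|x|]normrN hw // oppr_ge0 ltW.
rewrite (ger0_norm x_ge0) ler_norml sin_le // andbT.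
have [x_le4|x_gt4] := leP x 1.
  have := @sin_ge x; rewrite x_ge0 /=; move/(_ ltac:(lra)).
  have : x ^+ 3 <= x by rewrite exprS ler_piMr // expr_le1.
  lra.
have := cos2D_sin2 x; have := sqr_ge0 (cos x); nra.
Qed.

Lemma sin_dist (x : RR) : `|x| <= 1 -> `|sin x - x| <= `|x| ^+ 3 / 6.
Proof.
wlog x_ge0 : x / 0 <= x => [hw|].
  have [/hw //|x_lt0] := leP 0 x.
  by have := hw (- x); rewrite sinN normrN -opprD normrN; apply; rewrite oppr_ge0 ltW.
rewrite (ger0_norm x_ge0) => x_le1; rewrite ler0_norm ?subr_le0 ?sin_le // opprB.
have := @sin_ge x; rewrite x_ge0 /=; move/(_ ltac:(lra)); lra.
Qed.

Lemma cos_ge (x : RR) : 1 - x ^+ 2 / 2 <= cos x.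
Proof.
rewrite cos_half.
have : sin (x / 2) ^+ 2 <= (x / 2) ^+ 2.
  by rewrite -[leLHS]real_normK ?num_real // -[leRHS]real_normK ?num_real // lerXn2r ?nnegrE
    ?normr_ge0 ?normr_sin_le.
rewrite exprMn; lra.
Qed.

Lemma cos_le (x : RR) : `|x| <= pi -> cos x <= 1 - x ^+ 2 / 18.
Proof.
wlog x_ge0 : x / 0 <= x => [hw|].
  have [/hw //|x_lt0] := leP 0 x.
  by rewrite -normrN => /(hw _ _); rewrite cosN sqrrN; apply; rewrite oppr_ge0 ltW.
rewrite (ger0_norm x_ge0) => lexpi; rewrite cos_half.
have lex4 : x <= 4 by apply: le_trans lexpi pi_le4.
have := @sin_ge (x / 2); move/(_ ltac:(lra)) => sin_gex.
(* The inequality [x / 2 - x^3 / 48 >= x / 6] amounts to [x^2 <= 16], true because [pi <= 4];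
   squaring produces the constant 18. *)
have : x / 6 <= sin (x / 2).
  apply: le_trans sin_gex; have : 0 <= x * (4 - x) * (4 + x) by nra.
  have -> : (x / 2) ^+ 3 = x ^+ 3 / 8 by field.
  lra.
nra.
Qed.

Definition cis (x : RR) : RR[i] := Complex (cos x) (sin x).

Lemma cis0 : cis 0 = 1.
Proof. by rewrite /cis; have := Rtrigo_def.cos_0; have := Rtrigo_def.sin_0;
  rewrite R0E => -> ->. Qed.

Lemma cisD (x y : RR) : cis (x + y) = cis x * cis y.
Proof.
rewrite /cis; have := cosD x y; have := sinD x y; rewrite RplusE => -> ->.
by apply/eqP; rewrite eq_complex /= eqxx /= addrC.
Qed.

Lemma cisN (x : RR) : cis (- x) = (cis x)^*%C.
Proof. by rewrite /cis sinN cosN. Qed.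

Lemma cisMn (x : RR) (n : nat) : cis (x *+ n) = cis x ^+ n.
Proof. by elim: n => [|n IHn]; rewrite ?mulr0n ?cis0 // mulrS cisD IHn exprS. Qed.

Lemma cis_sum (I : Type) (r : seq I) (F : I -> RR) :
  cis (\sum_(i <- r) F i) = \prod_(i <- r) cis (F i).
Proof. exact: (big_morph cis cisD cis0). Qed.

Lemma cis2pi : cis (pi *+ 2) = 1.
Proof.
have := Rtrigo1.cos_2PI; have := Rtrigo1.sin_2PI.
have -> : Rdefinitions.IZR (BinNums.Zpos (BinNums.xO BinNums.xH)) = 2 :> RR by rewrite IZRposE INRE.
by rewrite RmultE R0E mulr_natl /cis => -> ->.
Qed.

Lemma cis_eq1 (x : RR) : 0 < x < pi *+ 2 -> cis x != 1.
Proof.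
case/andP=> x_gt0 x_lt2pi; rewrite eq_complex /=; apply/negP => /andP[/eqP cos1 _].
have [lexpi|ltpix] := leP x pi.
  have := @cos_le x; rewrite gtr0_norm // cos1 => /(_ lexpi).
  have := exprn_gt0 2 x_gt0; lra.
have : cos (pi *+ 2 - x) = 1.
  by have := cisD (pi *+ 2) (- x); rewrite cis2pi mul1r cisN => -[-> _].
have y_gt0 : 0 < pi *+ 2 - x by rewrite subr_gt0.
have : `|pi *+ 2 - x| <= pi by rewrite gtr0_norm // mulr2n; lra.
by move/cos_le => + cosy1; rewrite cosy1; have := exprn_gt0 2 y_gt0; lra.
Qed.

(** * Toeplitz minors in the bulk *)

Lemma sqr_sum_le (R : numFieldType) (n : nat) (a : 'I_n -> R) :
  (forall i, a i \is Num.real) -> (\sum_i a i) ^+ 2 <= n%:R * \sum_i a i ^+ 2.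
Proof.
move=> a_real; rewrite -subr_ge0 -(pmulr_rge0 _ (ltr0n R 2)).
have -> : 2 * (n%:R * \sum_i a i ^+ 2 - (\sum_i a i) ^+ 2) =
    \sum_i \sum_j (a i - a j) ^+ 2.
  have sumE i : \sum_j (a i - a j) ^+ 2 =
      n%:R * a i ^+ 2 - 2 * (a i * \sum_j a j) + \sum_j a j ^+ 2.
    under eq_bigr do rewrite sqrrB -mulr_natl.
    by rewrite big_split sumrB /= sumr_const card_ord mulr_natl -!mulr_sumr.
  under [RHS]eq_bigr do rewrite sumE.
  rewrite big_split sumrB /= sumr_const card_ord -!mulr_sumr -mulr_suml -mulr_natl.
  ring.
apply: sumr_ge0 => i _; apply: sumr_ge0 => j _.
by rewrite real_exprn_even_ge0 // rpredB.
Qed.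

(** The powers of [z] sum to 0 over a period, so [Q] is the sum of the [1 - z ^+ i], each of modulus
    at most [i |1 - z|]. The bound is crude, but only a power of [Q] matters later. *)
Lemma unity_root_dist (C : numFieldType) (Q : nat) (z : C) :
  (0 < Q)%N -> `|z| = 1 -> z ^+ Q = 1 -> z != 1 -> 1 <= Q%:R * `|1 - z|.
Proof.
move=> Q_gt0 z1 zQ z_neq1.
have dist i : `|1 - z ^+ i| <= i%:R * `|1 - z|.
  elim: i => [|i IHi]; first by rewrite subrr normr0 mul0r.
  have -> : 1 - z ^+ i.+1 = (1 - z) + z * (1 - z ^+ i) by rewrite exprS; ring.
  by rewrite (le_trans (ler_normD _ _)) // normrM z1 mul1r mulrSr mulrDl mul1r addrC lerD2r.
have sum0 : \sum_(i < Q) z ^+ i = 0.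
  apply: (@mulfI _ (z - 1)); first by rewrite subr_eq0.
  by rewrite mulr0 -subrX1 zQ subrr.
rewrite -(ler_pM2l (_ : 0 < Q%:R :> C)) ?ltr0n // mulr1 mulrA -natrM.
have -> : Q%:R = \sum_(i < Q) (1 - z ^+ i).
  by rewrite sumrB sum0 subr0 sumr_const card_ord.
rewrite -[leLHS]ger0_norm; last by rewrite sumrB sum0 subr0 sumr_const card_ord ler0n.
rewrite (le_trans (ler_norm_sum _ _ _)) //.
apply: (@le_trans _ _ (\sum_(i < Q) i%:R * `|1 - z|)).
  by apply: ler_sum => i _; exact: dist.
rewrite -mulr_suml ler_wpM2r //.
rewrite -natr_sum ler_nat (leq_trans (leq_sum _ (fun i _ => ltnW (ltn_ord i)))) //.
by rewrite sum_nat_const card_ord.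
Qed.

Lemma coef_prod_XsubC_le (C : numFieldType) (s : seq C) (l : nat) :
  {in s, forall a, `|a| = 1} ->
  `|(\prod_(a <- s) ('X - a%:P))`_l| <= 2 ^+ size s.
Proof.
elim: s l => [|a s IHs] l s1.
  by rewrite big_nil coef1 normr_nat; case: (l == _); rewrite ?ler01.
have {}IHs l' := IHs l' (fun b bs => s1 b (mem_behead (s := a :: s) bs)).
rewrite big_cons mulrBl coefB coefXM coefCM exprS mulr_natl mulr2n.
rewrite (le_trans (ler_normB _ _)) // lerD //; last by rewrite normrM s1 ?mem_head ?mul1r.
by case: ifP => // _; rewrite normr0 exprn_ge0.
Qed.

(** Quantitative inversion of a Vandermonde system: the Lagrange polynomial vanishing at all nodes
    but [w ^+ i] recovers [x i] from the exponential sums. Its coefficients are at most [2^q] and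
    its value at [w ^+ i] is at least [Q^-q]. Cauchy-Schwarz and the sum over [i] contribute one
    factor [q] each. *)
Lemma window_bound (C : numFieldType) (q Q : nat) (w : C) (x : 'I_q -> C) :
  `|w| = 1 -> w ^+ Q = 1 -> (forall d, (0 < d < q)%N -> w ^+ d != 1) -> (0 < Q)%N ->
  \sum_i `|x i| ^+ 2 <= (q ^ 2 * 4 ^ q * Q ^ (2 * q))%:R *
     \sum_(l < q) `|\sum_j x j * w ^+ (l * j)| ^+ 2.
Proof.
move=> w1 wQ w_prim Q_gt0.
pose P l := \sum_j x j * w ^+ (l * j).
have wn1 n : `|w ^+ n| = 1 by rewrite normrX w1 expr1n.
have dist (i j : 'I_q) : j != i -> 1 <= Q%:R * `|w ^+ i - w ^+ j|.
  wlog ltij : i j / (i < j)%N => [hw neij|_].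
    have [/hw->//|ltji|/val_inj eqij] := ltngtP i j; first by rewrite distrC hw // eq_sym.
    by rewrite eqij eqxx in neij.
  have -> : w ^+ i - w ^+ j = w ^+ i * (1 - w ^+ (j - i)).
    by rewrite mulrBr mulr1 -exprD subnKC // ltnW.
  rewrite normrM wn1 mul1r unity_root_dist //; first by rewrite exprAC wQ expr1n.
  by apply: w_prim; rewrite subn_gt0 ltij (leq_ltn_trans (leq_subr _ _)).
have xP i : `|x i| <= 2 ^+ q * Q%:R ^+ q * \sum_(l < q) `|P l|.
  pose L := \prod_(j | j != i) ('X - (w ^+ val j)%:P).
  pose s := [seq w ^+ val j | j <- enum 'I_q & j != i].
  have Ls : L = \prod_(a <- s) ('X - a%:P) by rewrite big_map big_filter big_enum_cond.
  have size_s : size s = q.-1.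
    rewrite size_map -[in RHS](card_ord q) -(cardC1 i) cardE enumT.
    by congr size; apply: eq_filter.
  have q_gt0 : (0 < q)%N by rewrite (leq_ltn_trans _ (ltn_ord i)).
  have sizeL : (size L <= q)%N by rewrite Ls size_prod_XsubC size_s prednK.
  have coefL l : `|L`_l| <= 2 ^+ q.
    rewrite Ls (le_trans (coef_prod_XsubC_le _ _)) //; last first.
      by rewrite size_s ler_eXn2l ?ltr1n // leq_pred.
    by move=> a /mapP[j _ ->].
  have LE (t : C) : L.[t] = \sum_(l < q) L`_l * t ^+ l by apply: horner_coef_wide.
  have Lj j : j != i -> L.[w ^+ val j] = 0.
    by move=> neji; rewrite /L horner_prod (bigD1 j) //= !hornerE subrr mul0r.
  have Li : 1 <= Q%:R ^+ q * `|L.[w ^+ i]|.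
    rewrite /L horner_prod normr_prod.
    apply: (@le_trans _ _ (Q%:R ^+ #|[pred j | j != i]| *
        \prod_(j | j != i) `|('X - (w ^+ val j)%:P).[w ^+ i]|)).
      rewrite -prodr_const -big_split /=.
      by apply: (big_ind (fun y => 1 <= y)) => // [x1 y1|j neji];
        [exact: mulr_ege1 | rewrite !hornerE dist].
    apply: ler_wpM2r; first by apply: prodr_ge0.
    by rewrite ler_weXn2l ?ler1n // -[X in (_ <= X)%N]card_ord max_card.
  have xL : x i * L.[w ^+ i] = \sum_(l < q) L`_l * P l.
    have LP j : x j * L.[w ^+ val j] = \sum_(l < q) L`_l * (x j * w ^+ (l * j)).
      rewrite LE mulr_sumr; apply: eq_bigr => l _.
      by rewrite mulrCA mulnC exprM.
    transitivity (\sum_j x j * L.[w ^+ val j]).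
      rewrite (bigD1 i) //= big1 ?addr0 // => j neji.
      by rewrite Lj // mulr0.
    rewrite (eq_bigr _ (fun j _ => LP j)) exchange_big; apply: eq_bigr => l _.
    by rewrite /P mulr_sumr.
  have : `|x i| * `|L.[w ^+ i]| <= 2 ^+ q * \sum_(l < q) `|P l|.
    rewrite -normrM xL (le_trans (ler_norm_sum _ _ _)) // mulr_sumr ler_sum // => l _.
    by rewrite normrM ler_wpM2r.
  move=> xi; rewrite -[leLHS]mulr1 (le_trans (ler_wpM2l (normr_ge0 _) Li)) //.
  by rewrite mulrCA [2 ^+ q * _]mulrC -mulrA ler_wpM2l ?exprn_ge0.
have -> : (q ^ 2 * 4 ^ q * Q ^ (2 * q))%:R = q%:R * (2 ^+ q * Q%:R ^+ q) ^+ 2 * q%:R :> C.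
  rewrite -!(natrX, natrM); congr _%:R.
  rewrite expnMn -!expnM ![(q * 2)%N]mulnC -[4%N]/(2 ^ 2)%N -expnM.
  ring.
rewrite -[leRHS]mulrA -[_ * _ ^+ 2 * _]mulrA mulr_natl.
rewrite -[in X in _ *+ X](card_ord q) -sumr_const.
apply: ler_sum => i _.
apply: (@le_trans _ _ ((2 ^+ q * Q%:R ^+ q) ^+ 2 * (\sum_(l < q) `|P l|) ^+ 2)).
  by rewrite -exprMn lerXn2r ?nnegrE ?mulr_ge0 ?exprn_ge0 ?sumr_ge0.
apply: ler_wpM2l; first by rewrite exprn_ge0 ?mulr_ge0 ?exprn_ge0.
by apply: sqr_sum_le => l; rewrite normr_real.
Qed.

(** * Characteristic functions of tilted Bernoulli sums *)

Definition sqn (z : RR[i]) : RR := Re z ^+ 2 + Im z ^+ 2.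

Lemma sqn_ge0 z : 0 <= sqn z. Proof. by rewrite addr_ge0 ?sqr_ge0. Qed.

Lemma sqnM : {morph sqn : x y / x * y}.
Proof. by move=> [a b] [c d]; rewrite /sqn /=; ring. Qed.

Lemma sqn1 : sqn 1 = 1. Proof. by rewrite /sqn /=; ring. Qed.

(** The characteristic function at [x] of a centred Bernoulli variable, equal to [1 - p] with
    probability [p] and to [- p] otherwise. *)
Definition omega (p x : RR) : RR[i] :=
  p%:C%C * cis ((1 - p) * x) + (1 - p)%:C%C * cis (- (p * x)).

Lemma Re_omega p x : Re (omega p x) = p * cos ((1 - p) * x) + (1 - p) * cos (p * x).
Proof. by rewrite /omega /cis /= cosN !mul0r !subr0. Qed.

Lemma Im_omega p x : Im (omega p x) = p * sin ((1 - p) * x) - (1 - p) * sin (p * x).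
Proof. by rewrite /omega /cis /= sinN !mul0r !addr0 mulrN. Qed.

Lemma Re_omega_ge p x : 0 <= p <= 1 -> 1 - p * (1 - p) * x ^+ 2 / 2 <= Re (omega p x).
Proof.
case/andP=> p_ge0 p_le1; rewrite Re_omega.
have q_ge0 : 0 <= 1 - p by rewrite subr_ge0.
have h1 := ler_wpM2l p_ge0 (cos_ge ((1 - p) * x)).
have h2 := ler_wpM2l q_ge0 (cos_ge (p * x)).
by apply: le_trans (lerD h1 h2); rewrite le_eqVlt; apply/orP; left; apply/eqP; field.
Qed.

Lemma sqn_omega p x : sqn (omega p x) = 1 - 2 * (p * (1 - p)) * (1 - cos x).
Proof.
rewrite /sqn Re_omega Im_omega.
have -> : cos x = cos ((1 - p) * x) * cos (p * x) - sin ((1 - p) * x) * sin (p * x).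
  by have := cosD ((1 - p) * x) (p * x); rewrite RplusE -mulrDl subrK mul1r.
transitivity (p ^+ 2 * (cos ((1 - p) * x) ^+ 2 + sin ((1 - p) * x) ^+ 2) +
  (1 - p) ^+ 2 * (cos (p * x) ^+ 2 + sin (p * x) ^+ 2) + 2 * (p * (1 - p)) *
  (cos ((1 - p) * x) * cos (p * x) - sin ((1 - p) * x) * sin (p * x))); first by ring.
by rewrite !cos2D_sin2; ring.
Qed.

(** Centring cancels the linear terms of the two sines and leaves a cubic error proportional to the
    variance [p (1 - p)]. *)
Lemma Im_omega_le p x : 0 <= p <= 1 -> `|x| <= 1 ->
  `|Im (omega p x)| <= p * (1 - p) * `|x| ^+ 3 / 6.
Proof.
case/andP=> p_ge0 p_le1 x_le1; rewrite Im_omega.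
have q_ge0 : 0 <= 1 - p by rewrite subr_ge0.
have -> : p * sin ((1 - p) * x) - (1 - p) * sin (p * x) =
  p * (sin ((1 - p) * x) - (1 - p) * x) - (1 - p) * (sin (p * x) - p * x) by ring.
have h1 : `|sin ((1 - p) * x) - (1 - p) * x| <= `|(1 - p) * x| ^+ 3 / 6.
  by apply: sin_dist; rewrite normrM (ger0_norm q_ge0) mulr_ile1 // gerBl.
have h2 : `|sin (p * x) - p * x| <= `|p * x| ^+ 3 / 6.
  by apply: sin_dist; rewrite normrM (ger0_norm p_ge0) mulr_ile1.
rewrite normrM (ger0_norm q_ge0) in h1; rewrite normrM (ger0_norm p_ge0) in h2.
rewrite (le_trans (ler_normB _ _)) // !normrM (ger0_norm p_ge0) (ger0_norm q_ge0).
rewrite (le_trans (lerD (ler_wpM2l p_ge0 h1) (ler_wpM2l q_ge0 h2))) //.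
have -> : p * (((1 - p) * `|x|) ^+ 3 / 6) + (1 - p) * ((p * `|x|) ^+ 3 / 6) =
  p * (1 - p) * `|x| ^+ 3 / 6 * (1 - 2 * (p * (1 - p))) by field.
rewrite ler_piMr //; last by rewrite gerBl !mulr_ge0.
by rewrite !mulr_ge0 ?exprn_ge0 ?invr_ge0.
Qed.

Lemma prod_ge_1subsum (I : Type) (r : seq I) (F : I -> RR) :
  (forall i, 0 <= F i <= 1) -> 1 - \sum_(i <- r) (1 - F i) <= \prod_(i <- r) F i.
Proof.
move=> F01; elim: r => [|i r IHr]; first by rewrite !big_nil subr0.
rewrite !big_cons; have /andP[Fi_ge0 Fi_le1] := F01 i.
have : 0 <= \prod_(i <- r) F i <= 1.
  apply/andP; split; first by apply: prodr_ge0 => j _; have /andP[] := F01 j.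
  by apply: prodr_ile1 => j _; exact: F01.
nra.
Qed.

Lemma Re_prod_ge (I : eqType) (r : seq I) (F : I -> RR[i]) (e : I -> RR) :
  {in r, forall i, 0 < Re (F i) /\ `|Im (F i)| <= e i * Re (F i)} ->
  \sum_(i <- r) e i <= 1 / 2 ->
  (\prod_(i <- r) Re (F i)) * (1 - \sum_(i <- r) e i) <= Re (\prod_(i <- r) F i).
Proof.
move=> Fe sum_e; pose A (s : seq I) := \prod_(i <- s) Re (F i).
(* The induction has to carry a bound on the imaginary part, which feeds back into the real part at
   each step. *)
suff [A_gt0 h1 _] : [/\ 0 < A r,
    `|Re (\prod_(i <- r) F i) - A r| <= A r * \sum_(i <- r) e i &
    `|Im (\prod_(i <- r) F i)| <= A r * (2 * \sum_(i <- r) e i)].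
  by move: h1; rewrite ler_norml -/(A r) mulrBr mulr1 lerNl opprB => /andP[+ _];
    rewrite lerBlDr lerBlDl.
elim: r Fe sum_e => [|i r IHr] Fe sum_e.
  by rewrite /A !big_nil /= subrr normr0 !mulr0; split.
have [Ri_gt0 Ii] := Fe i (mem_head _ _).
have ei_ge0 : 0 <= e i by rewrite -(pmulr_lge0 _ Ri_gt0) (le_trans _ Ii).
move: sum_e; rewrite /A !big_cons -/(A r) => sum_e.
have [||A_gt0 h1 h2] := IHr; [by move=> j rj; apply: Fe; rewrite inE rj orbT | by lra |].
move: (\prod_(_ <- r) _) h1 h2 => [a b] /= h1 h2.
move: (F i) Ri_gt0 Ii => [c d] /= c_gt0 hd.
move: (A r) A_gt0 h1 h2 => Ar A_gt0 h1 h2.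
set S := \sum_(_ <- r) _ in sum_e h1 h2 *.
have S_ge0 : 0 <= S by rewrite -(pmulr_rge0 _ A_gt0) (le_trans _ h1).
have cA_gt0 : 0 < c * Ar by rewrite mulr_gt0.
split=> //.
- have -> : c * a - d * b - c * Ar = c * (a - Ar) - d * b by ring.
  rewrite (le_trans (ler_normB _ _)) // !normrM (gtr0_norm c_gt0).
  have : `|d| * `|b| <= e i * c * Ar.
    rewrite ler_pM // (le_trans h2) // ger_pMr //; lra.
  have := ler_wpM2l (ltW c_gt0) h1; lra.
- rewrite (le_trans (ler_normD _ _)) // !normrM (gtr0_norm c_gt0).
  have : `|a| <= Ar * (1 + S).
    by rewrite -[a](subrK Ar) (le_trans (ler_normD _ _)) // (gtr0_norm A_gt0); lra.
  move=> ha; have : `|d| * `|a| <= e i * c * (Ar * 2).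
    rewrite ler_pM // (le_trans ha) // ler_pM2l //; lra.
  have := ler_wpM2l (ltW c_gt0) h2; lra.
Qed.

Lemma cos_le1 (x : RR) : cos x <= 1.
Proof. by have := cos2D_sin2 x; have := sqr_ge0 (sin x); nra. Qed.

(** The probability of the term [z^k] in [1 + z^k] when the terms are weighted by their values at
    [rho]. *)
Definition bern (rho : RR) (k : nat) : RR := rho ^+ k / (1 + rho ^+ k).

(** The characteristic function of a centred sum of independent variables, each [k] times a
    Bernoulli variable of parameter [bern rho k]. *)
Definition wphase (K : seq nat) (rho x : RR) : RR[i] :=
  \prod_(k <- K) omega (bern rho k) (k%:R * x).

Lemma bern_itv (rho : RR) (k : nat) : 0 < rho -> 0 <= bern rho k <= 1.
Proof.
move=> rho_gt0; have rk : 0 < rho ^+ k by rewrite exprn_gt0.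
rewrite /bern divr_ge0 ?ler_pdivrMr ?mul1r ?ltW ?addr_gt0 //; lra.
Qed.

Lemma bern_var (rho : RR) (k : nat) : 0 < rho -> bern rho k * (1 - bern rho k) =
  rho ^+ k / (1 + rho ^+ k) ^+ 2.
Proof.
move=> rho_gt0; have rk : 0 < rho ^+ k by rewrite exprn_gt0.
by rewrite /bern; field; rewrite gt_eqF // addr_gt0.
Qed.

(** The function [y / (1 + y)^2] decreases as [y] moves away from 1, and [rho^k] lies beyond [rho]
    on the same side of 1. After cross-multiplication this is the sign of
    [(1 - rho^(k-1)) (1 - rho^(k+1))]. Thus the variance of the factor [1 + z] controls all the
    others. *)
Lemma bern_var_le (rho : RR) (k : nat) : 0 < rho -> (0 < k)%N ->
  bern rho k * (1 - bern rho k) <= rho / (1 + rho) ^+ 2.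
Proof.
move=> rho_gt0; case: k => // k _; rewrite bern_var //.
have rk : 0 < rho ^+ k by rewrite exprn_gt0.
have rk1 : 0 < rho ^+ k.+1 by rewrite exprn_gt0.
rewrite ler_pdivrMr ?exprn_gt0 ?addr_gt0 // mulrAC ler_pdivlMr ?exprn_gt0 ?addr_gt0 //.
have : 0 <= (1 - rho ^+ k) * (1 - rho ^+ k.+2).
  have [le1|lt1] := leP rho 1.
    by rewrite mulr_ge0 // subr_ge0 exprn_ile1 // ltW.
  by rewrite mulr_le0 // subr_le0 exprn_ege1 // ltW.
rewrite !exprS; nra.
Qed.

Lemma varQ_le (rho : RR) : 0 < rho -> 0 < rho / (1 + rho) ^+ 2 <= 1 / 4.
Proof.
move=> rho_gt0; rewrite divr_gt0 ?exprn_gt0 ?addr_gt0 //= ler_pdivrMr ?exprn_gt0 ?addr_gt0 //.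
have := sqr_ge0 (1 - rho); nra.
Qed.

(** With [p = bern rho j], the number [t] bounds the sums of [p (1 - p) j^3] and of [p (1 - p) j^2]
    over [K]. The condition [t |x|^3 <= 1] keeps the total argument small, which makes the real part
    nonnegative; [t x^2 <= 1] also keeps the modulus away from 0. *)
Lemma wphase_main (K : seq nat) (rho x : RR) (B n k : nat) :
  0 < rho -> (size K <= B * n)%N -> {in K, forall j, (j <= k)%N} ->
  let t := n%:R * (rho / (1 + rho) ^+ 2) * (B * k ^ 3)%:R in
  k%:R * `|x| <= 1 -> t * `|x| ^+ 3 <= 1 ->
  0 <= Re (wphase K rho x) /\ (t * x ^+ 2 <= 1 -> 1 / 4 <= Re (wphase K rho x)).
Proof.
move=> rho_gt0 sizeK leKk t kx tx3.
pose v : RR := rho / (1 + rho) ^+ 2.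
have /andP[v_gt0 v_le] : 0 < v <= 1 / 4 by exact: varQ_le.
have var_le j i : bern rho j * (1 - bern rho j) * j%:R ^+ i.+1 <= v * j%:R ^+ i.+1.
  case: j => [|j]; first by rewrite exprS !mul0r !mulr0.
  by rewrite ler_wpM2r ?exprn_ge0 ?bern_var_le.
have tE : t = v * k%:R ^+ 3 * (B * n)%:R by rewrite /t -/v [(B * n)%:R]natrM [(B * _)%:R]natrM
  natrX; ring.
clearbody t v; have v_ge0 := ltW v_gt0.
have var_ge0 j : 0 <= bern rho j * (1 - bern rho j).
  by have /andP[? ?] := @bern_itv rho j rho_gt0; rewrite mulr_ge0 ?subr_ge0.
have jx j : j \in K -> `|j%:R * x| <= 1.
  move=> /leKk jk; rewrite normrM ger0_norm ?ler0n // (le_trans _ kx) // ler_wpM2r //.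
  by rewrite ler_nat.
have x2E : x ^+ 2 = `|x| ^+ 2 by rewrite real_normK ?num_real.
(* Every real part will be at least 1/2, so dividing by it at most doubles the constant 1/6 of the
   cubic bound. *)
pose e (j : nat) : RR := v * k%:R ^+ 3 * `|x| ^+ 3 / 3.
have Re_ge j : j \in K -> 1 - v * k%:R ^+ 2 * x ^+ 2 / 2 <= Re (omega (bern rho j) (j%:R * x)).
  move=> jK; apply: le_trans (Re_omega_ge _ (@bern_itv rho j rho_gt0)).
  rewrite lerD2l lerN2 ler_pM2r ?invr_gt0 // exprMn mulrA ler_wpM2r ?sqr_ge0 //.
  rewrite (le_trans (var_le j 1%N)) // ler_wpM2l ?v_ge0 // lerXn2r ?nnegrE // ler_nat.
  exact: leKk.
have kx2 : v * k%:R ^+ 2 * x ^+ 2 <= 1 / 4.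
  have : 0 <= (k%:R * `|x|) ^+ 2 <= 1 by rewrite sqr_ge0 exprn_ile1 // mulr_ge0.
  by rewrite exprMn -x2E; nra.
have ReIm j : j \in K -> 0 < Re (omega (bern rho j) (j%:R * x)) /\
    `|Im (omega (bern rho j) (j%:R * x))| <= e j * Re (omega (bern rho j) (j%:R * x)).
  move=> jK; have Rj := Re_ge j jK; split; first by lra.
  apply: le_trans (Im_omega_le (@bern_itv rho j rho_gt0) (jx j jK)) _.
  apply: (@le_trans _ _ (e j / 2)); last first.
    apply: ler_wpM2l; last by lra.
    by rewrite /e !mulr_ge0 ?exprn_ge0 ?invr_ge0.
  rewrite normrM [`|j%:R|]ger0_norm // exprMn [X in X / 6]mulrA.
  have -> : e j / 2 = v * k%:R ^+ 3 * `|x| ^+ 3 / 6 by rewrite /e; field.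
  rewrite ler_wpM2r ?invr_ge0 // ler_wpM2r ?exprn_ge0 // (le_trans (var_le j 2%N)) // ler_wpM2l
    ?v_ge0 //.
  by rewrite lerXn2r ?nnegrE // ler_nat leKk.
have sum_e : \sum_(j <- K) e j <= 1 / 3.
  rewrite big_const_seq count_predT iter_addr_0 -[leLHS]mulr_natl.
  apply: (@le_trans _ _ ((B * n)%:R * e 0%N)).
    by rewrite /e ler_wpM2r ?ler_nat // !mulr_ge0 ?exprn_ge0 ?invr_ge0.
  have -> : (B * n)%:R * e 0%N = t * `|x| ^+ 3 / 3 by rewrite tE /e; field.
  by rewrite ler_pM2r ?invr_gt0.
have := @Re_prod_ge _ K (fun j => omega (bern rho j) (j%:R * x)) e ReIm.
have sum_e2 : \sum_(j <- K) e j <= 1 / 2 by lra.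
move/(_ sum_e2); rewrite -/(wphase K rho x).
set A := \prod_(_ <- _) _; set S := \sum_(_ <- _) _ in sum_e sum_e2 *.
have A_ge0 : 0 <= A by rewrite /A big_seq prodr_ge0 // => j /ReIm[/ltW].
move=> hA; split; first by apply: le_trans hA; rewrite mulr_ge0 //; lra.
move=> tx2.
suff : 1 / 2 <= A by nra.
pose F j := if j \in K then Re (omega (bern rho j) (j%:R * x)) else 1.
have AF : A = \prod_(j <- K) F j.
  by rewrite /A big_seq [RHS]big_seq; apply: eq_bigr => j jK; rewrite /F jK.
have Re_le1 j : Re (omega (bern rho j) (j%:R * x)) <= 1.
  have /andP[p0 p1] := @bern_itv rho j rho_gt0.
  rewrite Re_omega.
  have := cos_le1 ((1 - bern rho j) * (j%:R * x)); have := cos_le1 (bern rho j * (j%:R * x)).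
  nra.
have F01 j : 0 <= F j <= 1.
  by rewrite /F; case: ifP => [jK|_]; rewrite ?ler01 ?lexx // Re_le1 andbT;
    have [/ltW] := ReIm j jK.
rewrite AF; apply: le_trans (prod_ge_1subsum K F01).
have : \sum_(j <- K) (1 - F j) <= \sum_(j <- K) (v * k%:R ^+ 2 * x ^+ 2 / 2).
  rewrite big_seq [leRHS]big_seq ler_sum // => j jK; rewrite /F jK.
  by have := Re_ge j jK; lra.
rewrite big_const_seq count_predT iter_addr_0 -[X in _ <= X]mulr_natl => hS.
suff : (size K)%:R * (v * k%:R ^+ 2 * x ^+ 2 / 2) <= 1 / 2 by lra.
have : (B * n)%:R * (v * k%:R ^+ 3 * x ^+ 2 / 2) <= 1 / 2.
  have -> : (B * n)%:R * (v * k%:R ^+ 3 * x ^+ 2 / 2) = t * x ^+ 2 / 2 by rewrite tE; field.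
  by rewrite ler_pM2r ?invr_gt0.
apply: le_trans; have := sqr_ge0 x; move: (x ^+ 2) => y y_ge0.
have k23 : k%:R ^+ 2 <= k%:R ^+ 3 :> RR.
  by rewrite -!natrX ler_nat; case: (k) => // k'; rewrite leq_pexp2l.
rewrite ler_pM ?ler_nat ?mulr_ge0 ?invr_ge0 //.
by rewrite ler_pM2r ?invr_gt0 // ler_wpM2r // ler_wpM2l.
Qed.

(** Only the factors [1 + z] are used, the others having modulus at most 1. Without them the modulus
    could return to 1 at another root of unity, as for [1 + z^2] at [z = -1]. *)
Lemma wphase_tail (K : seq nat) (rho x : RR) (n : nat) :
  0 < rho -> (n <= count_mem 1%N K)%N -> `|x| <= pi ->
  sqn (wphase K rho x) <= (1 - rho / (1 + rho) ^+ 2 * x ^+ 2 / 9) ^+ n.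
Proof.
move=> rho_gt0 leK xpi.
pose v : RR := rho / (1 + rho) ^+ 2.
have /andP[v_gt0 v_le] : 0 < v <= 1 / 4 by exact: varQ_le.
pose c := sqn (omega (bern rho 1) (1%:R * x)).
have cE : c = 1 - 2 * v * (1 - cos x).
  by rewrite /c sqn_omega mul1r bern_var ?expr1.
have c_le : c <= 1 - v * x ^+ 2 / 9.
  by rewrite cE; have := cos_le xpi; nra.
have sqn_le1 j : 0 <= sqn (omega (bern rho j) (j%:R * x)) <= 1.
  rewrite sqn_ge0 /= sqn_omega; have /andP[p0 p1] := @bern_itv rho j rho_gt0.
  have := cos_le1 (j%:R * x); have : 0 <= bern rho j * (1 - bern rho j) by rewrite mulr_ge0
    ?subr_ge0.
  nra.
have c_itv : 0 <= c <= 1 by exact: sqn_le1.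
have : sqn (wphase K rho x) <= c ^+ count_mem 1%N K.
  rewrite /wphase; elim: (K) => [|j r IHr]; first by rewrite big_nil sqn1.
  rewrite big_cons sqnM /=; case: eqP => [->|_].
    by rewrite add1n exprS ler_pM ?sqn_ge0.
  by rewrite add0n -[leRHS]mul1r ler_pM ?sqn_ge0 //; have /andP[] := sqn_le1 j.
move=> /le_trans; apply; have /andP[c0 c1] := c_itv.
apply: (@le_trans _ _ (c ^+ n)); first by rewrite ler_wiXn2l.
by rewrite lerXn2r ?nnegrE // (le_trans c0).
Qed.

(** The entry is the coefficient of degree [c + i - j], and 0 if [c + i < j]; the factor ['X^j]
    avoids truncated subtraction. *)
Definition toeplitz (R : nzRingType) (q c : nat) (f : {poly R}) : 'M[R]_q :=
  \matrix_(i, j) ('X^j * f)`_(c + i).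

Lemma sum_unity_root (C : fieldType) (N e a : nat) (z z' : C) :
  z * z' = 1 -> z ^+ N = 1 -> (forall d, (0 < d < N)%N -> z ^+ d != 1) ->
  (e < N)%N -> (a < N)%N ->
  \sum_(t < N) (z ^+ t) ^+ e * (z' ^+ t) ^+ a = (e == a)%:R *+ N.
Proof.
move=> zz' zN z_prim ltN laN.
have z'N : z' ^+ N = 1 by rewrite -[LHS]mul1r -zN -exprMn zz' expr1n.
have termE (t : 'I_N) : (z ^+ t) ^+ e * (z' ^+ t) ^+ a = (z ^+ e * z' ^+ a) ^+ t.
  by rewrite exprMn -!exprM ![(t * _)%N]mulnC.
rewrite (eq_bigr _ (fun t _ => termE t)).
have [->|neq] := eqVneq e a.
  by under eq_bigr do rewrite -exprMn zz' !expr1n; rewrite sumr_const card_ord.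
rewrite mul0rn; set y := z ^+ e * z' ^+ a.
have yN : y ^+ N = 1 by rewrite /y exprMn -!exprM ![(_ * N)%N]mulnC !exprM zN z'N !expr1n mul1r.
have y1 : y != 1.
  have [ltea|ltae] : (e < a)%N \/ (a < e)%N by apply/orP; rewrite -neq_ltn.
    have : (0 < a - e < N)%N by rewrite subn_gt0 ltea /=; exact: leq_ltn_trans (leq_subr _ _) laN.
    move/z_prim; apply: contra => /eqP y1.
    by apply/eqP; rewrite -[LHS]mulr1 -{1}y1 /y mulrA -exprD subnK 1?ltnW // -exprMn zz' expr1n.
  have : (0 < e - a < N)%N by rewrite subn_gt0 ltae /=; exact: leq_ltn_trans (leq_subr _ _) ltN.
  move/z_prim; apply: contra => /eqP y1.
  by apply/eqP; rewrite -[RHS]y1 /y -{2}(subnK (ltnW ltae)) exprD -mulrA -exprMn zz' expr1n mulr1.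
apply: (@mulfI _ (y - 1)); first by rewrite subr_eq0.
by rewrite mulr0 -subrX1 yN subrr.
Qed.

(** Cauchy's formula on the circle of radius [rho], discretized; the bound on [size g] excludes
    aliasing. *)
Lemma coef_unity_root (C : fieldType) (N a : nat) (z z' rho : C) (g : {poly C}) :
  z * z' = 1 -> z ^+ N = 1 -> (forall d, (0 < d < N)%N -> z ^+ d != 1) ->
  (size g <= N)%N -> (a < N)%N ->
  \sum_(t < N) g.[rho * z ^+ t] * (z' ^+ t) ^+ a = (rho ^+ a * g`_a) *+ N.
Proof.
move=> zz' zN z_prim sg laN.
under eq_bigr => t _.
  rewrite (horner_coef_wide _ sg) mulr_suml.
  under eq_bigr do rewrite exprMn mulrA -mulrA.
  over.
rewrite exchange_big /= (bigD1 (Ordinal laN)) //= -mulr_sumr sum_unity_root // eqxx.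
rewrite mulrnAr mulr1 big1 ?addr0 => [|e ne]; first by rewrite mulrC.
rewrite -mulr_sumr sum_unity_root // (_ : (e == a :> nat) = false) ?mul0rn ?mulr0 //.
by apply: contraNF ne => /eqP ea; apply/eqP/val_inj.
Qed.

(** Scaling rows and columns by powers of [rho] and dividing by [F.[rho]] normalizes the matrix.
    With its entries written as averages over roots of unity, the form is a sum of squared moduli
    weighted by the [w t]; the left side is real, so only [Re (w t)] survives. *)
Lemma toeplitz_form (q c N : nat) (F : {poly RR}) (rho : RR) (z : RR[i]) (w : 'I_N -> RR[i])
    (x : 'rV[RR]_q) :
  rho != 0 -> F.[rho] != 0 -> z * z^*%C = 1 -> z ^+ N = 1 ->
  (forall d, (0 < d < N)%N -> z ^+ d != 1) ->
  (size F + q <= N)%N -> (c + q <= N)%N ->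
  (forall t : 'I_N, (map_poly (real_complex RR) F).[rho%:C%C * z ^+ t] * (z^*%C ^+ t) ^+ c =
      F.[rho]%:C%C * w t) ->
  (x *m (\matrix_(i, j) (rho ^+ (c + i) / F.[rho] * toeplitz q c F i j / rho ^+ j)) *m x^T) 0 0 *+
    N =
  \sum_t Re (w t) * sqn (\sum_j (x 0 j)%:C%C * (z ^+ t) ^+ j).
Proof.
move=> rho0 Frho0 zz' zN z_prim sF cqN wP.
set T := \matrix_(i, j) _.
pose TC i j := (T i j)%:C%C : RR[i].
have TE (i j : 'I_q) : (T i j)%:C%C *+ N = \sum_t w t * ((z^*%C ^+ t) ^+ i * (z ^+ t) ^+ j).
  pose g := map_poly (real_complex RR) ('X^j * F).
  have sg : (size g <= N)%N.
    rewrite size_map_poly (leq_trans (size_polyMleq _ _)) // size_polyXn addSn /=.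
    by rewrite (leq_trans _ sF) // addnC leq_add2l ltnW.
  have iN : (c + i < N)%N by rewrite (leq_trans _ cqN) // ltn_add2l.
  have := coef_unity_root rho%:C%C zz' zN z_prim sg iN.
  rewrite /T !mxE coef_map => gE.
  have -> : (rho ^+ (c + i) / F.[rho] * ('X^j * F)`_(c + i) / rho ^+ j)%:C%C *+ N =
     (F.[rho]^-1)%:C%C * (rho ^- j)%:C%C * ((rho%:C%C ^+ (c + i) * (('X^j * F)`_(c + i))%:C%C) *+
       N).
    rewrite mulrnAr; congr (_ *+ N); rewrite -rmorphXn -!rmorphM /=; congr _%:C%C; ring.
  rewrite -gE mulr_sumr; apply: eq_bigr => t _.
  rewrite /g rmorphM /= map_polyXn hornerM hornerXn exprMn /=.
  have := wP t; set FC := _.[_] => wt.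
  have -> : w t = (F.[rho]^-1)%:C%C * (FC * (z^*%C ^+ t) ^+ c).
    by rewrite wt mulrA -rmorphM /= mulVf // rmorph1 mul1r.
  rewrite exprD -rmorphXn.
  have e1 : (rho ^- j)%:C%C * (rho ^+ j)%:C%C = 1 :> RR[i].
    by rewrite -rmorphM /= mulVf ?expf_neq0.
  rewrite -[RHS]mul1r -e1; ring.
apply: complexI.
have sqnE (u : RR[i]) : (sqn u)%:C%C = u^*%C * u.
  by rewrite [LHS]add_Re2_Im2 normCKC.
have conjR (a : RR) (u : RR[i]) : (a%:C * u)^*%C = a%:C%C * u^*%C.
  by rewrite rmorphM; congr (_ * _); exact: conjc_real.
have conjX (u : RR[i]) n : (u ^+ n)^*%C = u^*%C ^+ n by exact: rmorphXn.
have PE t : (sqn (\sum_j (x 0 j)%:C%C * (z ^+ t) ^+ j))%:C%C =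
    \sum_i \sum_j (x 0 i)%:C%C * (x 0 j)%:C%C * ((z^*%C ^+ t) ^+ i * (z ^+ t) ^+ j).
  rewrite sqnE rmorph_sum mulr_suml; apply: eq_bigr => i _.
  rewrite mulr_sumr; apply: eq_bigr => j _.
  rewrite [X in X * _]conjR -[in X in X * _]exprM conjX exprM; ring.
have -> : (x *m T *m x^T) 0 0 = \sum_i \sum_j x 0 i * x 0 j * T i j.
  rewrite mxE exchange_big; apply: eq_bigr => j _.
  by rewrite !mxE mulr_suml; apply: eq_bigr => i _; rewrite mulrAC.
have Re_mul (u : RR[i]) (a : RR) : Re (u * a%:C%C) = Re u * a.
  by case: u => u1 u2 /=; rewrite mulr0 subr0.
have -> : \sum_t Re (w t) * sqn (\sum_j (x 0 j)%:C%C * (z ^+ t) ^+ j) =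
    Re (\sum_t w t * (sqn (\sum_j (x 0 j)%:C%C * (z ^+ t) ^+ j))%:C%C).
  by rewrite raddf_sum; apply: eq_bigr => t _; rewrite /= Re_mul.
have -> : \sum_t w t * (sqn (\sum_j (x 0 j)%:C%C * (z ^+ t) ^+ j))%:C%C =
    ((\sum_i \sum_j x 0 i * x 0 j * T i j) *+ N)%:C%C; last by [].
rewrite rmorphMn rmorph_sum /= -sumrMnl.
under eq_bigr do rewrite PE mulr_sumr.
rewrite exchange_big; apply: eq_bigr => i _.
under eq_bigr do rewrite mulr_sumr.
rewrite exchange_big rmorph_sum /= -sumrMnl; apply: eq_bigr => j _.
rewrite rmorphM rmorphM -mulrnAr TE mulr_sumr; apply: eq_bigr => t _.
by rewrite mulrCA.
Qed.

(** * Choice of scales and positivity in the bulk *)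

Lemma bernoulli (R : realFieldType) (y : R) (n : nat) : 0 <= y -> 1 + n%:R * y <= (1 + y) ^+ n.
Proof.
move=> y_ge0; elim: n => [|n IHn]; first by rewrite mul0r addr0.
rewrite exprS mulrSr; have : 0 <= n%:R * y ^+ 2 by rewrite mulr_ge0 ?sqr_ge0.
have := ler_wpM2l (addr_ge0 ler01 y_ge0) IHn; nra.
Qed.

(** Bernoulli's inequality on each of [j] blocks of [n %/ j] factors, where the floor is at least
    [n / (2 j)]. *)
Lemma expr_growth (R : realFieldType) (y : R) (n j : nat) : 0 <= y -> (0 < j <= n)%N ->
  (n%:R * y / (2 * j)%:R) ^+ j <= (1 + y) ^+ n.
Proof.
move=> y_ge0 /andP[j_gt0 lejn]; pose m := (n %/ j)%N.
have y1 : 1 <= 1 + y by rewrite lerDl.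
apply: (@le_trans _ _ ((1 + y) ^+ (m * j))); last by rewrite ler_weXn2l // leq_trunc_div.
rewrite exprM lerXn2r ?nnegrE ?divr_ge0 ?mulr_ge0 ?exprn_ge0 ?addr_ge0 //.
apply: (@le_trans _ _ (m%:R * y)); last by apply: le_trans (bernoulli m y_ge0); rewrite lerDr.
rewrite mulrAC ler_wpM2r // ler_pdivrMr ?ltr0n ?muln_gt0 // -natrM ler_nat.
have m_gt0 : (0 < m)%N by rewrite divn_gt0.
have := ltn_ceil n j_gt0; rewrite -/m; nia.
Qed.

Lemma omega_factor (p a : RR) (x : RR) : 0 < 1 + a -> p = a / (1 + a) ->
  (1 + a)%:C%C * omega p x = (1 + a%:C%C * cis x) * cis (- (p * x)).
Proof.
move=> a1 pE; have h1 : (1 + a) * p = a by rewrite pE mulrC divfK // gt_eqF.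
have h2 : (1 + a) * (1 - p) = 1 by rewrite mulrBr h1; ring.
rewrite /omega (_ : (1 - p) * x = x + - (p * x)); last by ring.
rewrite cisD mulrDr !mulrA -!rmorphM /= h1 h2 rmorph1; ring.
Qed.

(** This is the use of the saddle equation: the centring phases multiply to [cis (- c x)], which is
    exactly the factor extracting the coefficient of degree [c]. *)
Lemma wphaseE (K : seq nat) (rho x : RR) (c : nat) :
  0 < rho -> \sum_(j <- K) j%:R * bern rho j = c%:R ->
  (map_poly (real_complex RR) (\prod_(j <- K) (1 + 'X^j))).[rho%:C%C * cis x] * ((cis x)^*%C) ^+ c =
  (\prod_(j <- K) (1 + 'X^j)).[rho]%:C%C * wphase K rho x.
Proof.
move=> rho_gt0 sumE.
have -> : (cis x)^*%C ^+ c = \prod_(j <- K) cis (- (bern rho j * (j%:R * x))).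
  rewrite -cisN -cisMn -cis_sum -mulr_natl -sumE mulrN mulr_suml sumrN.
  by congr (cis (- _)); apply: eq_bigr => j _; ring.
rewrite rmorph_prod !horner_prod rmorph_prod /= /wphase -!big_split /=.
apply: eq_bigr => j _.
have rj : 0 < rho ^+ j by rewrite exprn_gt0.
rewrite !hornerE (@omega_factor _ (rho ^+ j)) ?addr_gt0 //; congr (_ * _).
  rewrite rmorphD rmorph1 /= map_polyXn hornerD hornerC hornerXn exprMn -rmorphXn /=.
  by rewrite -cisMn mulr_natl.
by rewrite /= mulrA.
Qed.

(** The least [M] with [a <= M^3] works: [(M - 1)^3 < a], and [M <= 2 (M - 1)] costs a factor 8. *)
Lemma nat_cube (R : archiRealFieldType) (a : R) (M0 : nat) : (1 < M0)%N -> M0%:R ^+ 3 <= a ->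
  exists M : nat, [/\ (M0 <= M)%N, a <= M%:R ^+ 3 & M%:R ^+ 3 <= 8 * a].
Proof.
move=> M0_gt1 leMa.
have exM : exists M : nat, a <= M%:R ^+ 3.
  have a_gt0 : 0 < a by apply: lt_le_trans leMa; rewrite exprn_gt0 // ltr0n ltnW.
  have ltaM := archi_boundP (ltW a_gt0); exists (Num.bound a); apply: ltW.
  apply: lt_le_trans ltaM _; rewrite -natrX ler_nat.
  by case: (Num.bound a) => // M; rewrite -[leqLHS]expn1 leq_pexp2l.
case: (ex_minnP exM) => M aM minM; exists M.
have leM0M : (M0 <= M)%N.
  rewrite -(leq_exp2r _ _ (isT : (0 < 3)%N)) -(ler_nat R) !natrX.
  exact: le_trans leMa aM.
split=> //; have M_gt1 := leq_trans M0_gt1 leM0M.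
have : (M.-1%:R : R) ^+ 3 < a.
  by rewrite ltNge; apply/negP => /minM; rewrite leqNgt ltn_predL (ltnW M_gt1).
move=> /ltW h; apply: (@le_trans _ _ (8 * M.-1%:R ^+ 3)); last by rewrite ler_wpM2l.
rewrite -!natrX -natrM ler_nat; case: (M) M_gt1 => // -[//|m] _ /=.
by rewrite -[8%N]/(2 ^ 3)%N -expnMn leq_exp2r //; lia.
Qed.

(** The representative of [2 pi t / N] between [- pi] and [pi], where the quadratic upper bound on
    [cos] is available. *)
Definition angle (N t : nat) : RR :=
  (pi *+ 2 / N%:R) *+ t - (if (t.*2 <= N)%N then 0 else pi *+ 2).

Lemma cis_angle N t : cis (angle N t) = cis (pi *+ 2 / N%:R) ^+ t.
Proof.
rewrite /angle cisD cisMn cisN; case: ifP => _; rewrite ?cis0 ?cis2pi ?conjc1 ?mulr1 //.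
Qed.

Lemma angle_le_pi N t : (t < N)%N -> `|angle N t| <= pi.
Proof.
move=> ltN; have N_gt0 : 0 < N%:R :> RR by rewrite ltr0n (leq_ltn_trans _ ltN).
have piN : 0 < pi / N%:R by rewrite divr_gt0 ?pi_gt0.
have eq2 : pi *+ 2 / N%:R = 2 * (pi / N%:R) by rewrite -mulr_natl; ring.
have piE : pi = N%:R * (pi / N%:R) by rewrite mulrC divfK // gt_eqF.
have pi2 : pi *+ 2 = 2 * N%:R * (pi / N%:R) by rewrite -mulrA -piE mulr_natl.
rewrite /angle eq2 pi2 -mulr_natl.
suff : `|t%:R * (2 * (pi / N%:R)) - (if (t.*2 <= N)%N then 0 else 2 * N%:R * (pi / N%:R))| <=
    N%:R * (pi / N%:R) by rewrite -piE.
move: (pi / N%:R) piN => u u_gt0 {piE pi2 eq2}.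
case: ifP => [le2|/negbT]; last rewrite -ltnNge => lt2.
  rewrite subr0 ger0_norm ?mulr_ge0 ?(ltW u_gt0) // mulrA.
  by rewrite ler_wpM2r ?(ltW u_gt0) // -natrM ler_nat muln2.
have -> : t%:R * (2 * u) - 2 * N%:R * u = (t.*2%:R - 2 * N%:R) * u.
  by rewrite -muln2 natrM; ring.
rewrite normrM (gtr0_norm u_gt0) ler_wpM2r ?(ltW u_gt0) // distrC ger0_norm.
  by rewrite lerBlDl -natrM -natrD ler_nat; lia.
by rewrite subr_ge0 -natrM ler_nat; lia.
Qed.

Lemma sqn_norm (u : RR[i]) : (sqn u)%:C%C = `|u| ^+ 2.
Proof. exact: add_Re2_Im2. Qed.

Lemma cis_norm x : `|cis x| = 1.
Proof.
have : `|cis x| ^+ 2 = 1 by rewrite -sqn_norm /sqn /= cos2D_sin2.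
by move/eqP; rewrite sqrp_eq1 // => /eqP.
Qed.

(* The points of the window split into G translates of q consecutive powers of z ^+ G. *)
Lemma window_sum (q G Q : nat) (z : RR[i]) (x : 'I_q -> RR) :
  (0 < q <= Q)%N -> (0 < G)%N -> `|z| = 1 -> z ^+ (G * Q) = 1 ->
  (forall d, (0 < d < G * Q)%N -> z ^+ d != 1) ->
  G%:R * \sum_j x j ^+ 2 <= (q ^ 2 * 4 ^ q * Q ^ (2 * q))%:R *
    \sum_(t < q * G) sqn (\sum_j (x j)%:C%C * (z ^+ t) ^+ j).
Proof.
move=> /andP[q_gt0 leqQ] G_gt0 z1 zN z_prim.
pose s t := sqn (\sum_j (x j)%:C%C * (z ^+ t) ^+ j).
have -> : \sum_(t < q * G) s t = \sum_(g < G) \sum_(l < q) s (l * G + g)%N.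
  rewrite -[LHS](big_mkord xpredT) big_nat_mul exchange_big /=.
  rewrite big_mkord; apply: eq_bigr => l _.
  rewrite -[X in index_iota X _]add0n big_addn mulSn addnK big_mkord.
  by apply: eq_bigr => g _; rewrite addnC.
have -> : G%:R * \sum_j x j ^+ 2 = \sum_(g < G) (\sum_j x j ^+ 2).
  by rewrite sumr_const card_ord mulr_natl.
rewrite mulr_sumr; apply: ler_sum => g _.
have w1 : `|z ^+ G| = 1 by rewrite normrX z1 expr1n.
have wQ : (z ^+ G) ^+ Q = 1 by rewrite -exprM.
have w_prim d : (0 < d < q)%N -> (z ^+ G) ^+ d != 1.
  move=> /andP[d_gt0 ltdq]; rewrite -exprM z_prim // muln_gt0 G_gt0 d_gt0 ltn_pmul2l //.
  exact: leq_trans ltdq leqQ.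
have := window_bound (fun j => (x j)%:C%C * z ^+ (g * j)) w1 wQ w_prim (leq_trans q_gt0 leqQ).
rewrite -lecR; set cst := (_ * _ * _)%N.
have -> : \sum_i `|(x i)%:C%C * z ^+ (g * i)| ^+ 2 = (\sum_j x j ^+ 2)%:C%C.
  rewrite rmorph_sum; apply: eq_bigr => j _.
  by rewrite normrM normrX z1 expr1n mulr1 -sqn_norm /sqn /= expr0n addr0.
move/le_trans; apply; rewrite [leRHS]rmorphM [X in _ <= X * _]rmorph_nat.
apply: ler_wpM2l => //.
rewrite rmorph_sum; apply: ler_sum => l _; rewrite -sqn_norm le_eqVlt; apply/orP; left; apply/eqP;
  congr (sqn _)%:C%C.
apply: eq_bigr => j _; rewrite -mulrA; congr (_ * _).
by rewrite -!exprM -exprD; congr (_ ^+ _); ring.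
Qed.

(** Since [(1 - y) (1 + y) <= 1], it is enough that [(1 + y)^n] exceeds the given multiple of a
    power of [M]. The bound on [M^3] gives [n y >= M / (72 C)], so [expr_growth] with exponent [j]
    yields a constant times [M^j]. As [j] exceeds [8 q + 4], a spare power of [M] absorbs the
    constants. *)
Lemma tail_small (R : realFieldType) (v : R) (n M C q A : nat) :
  let j := (8 * q + 6)%N in
  (0 < C)%N -> (0 < M)%N -> 0 < v <= 1 -> (j <= n)%N ->
  M%:R ^+ 3 <= 8 * (n%:R * v * C%:R) ->
  (A * (144 * j * C) ^ j <= M)%N ->
  (1 - v / M%:R ^+ 2 / 9) ^+ n * (A * M ^ (8 * q + 4))%:R <= 1.
Proof.
move=> j C_gt0 M_gt0 /andP[v_gt0 v_le1] lejn MC leAM.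
have MR : 0 < M%:R :> R by rewrite ltr0n.
have CR : 0 < C%:R :> R by rewrite ltr0n.
set y := v / M%:R ^+ 2 / 9.
have y_ge0 : 0 <= y by rewrite /y !divr_ge0 ?exprn_ge0 // ltW.
have y_le1 : y <= 1.
  have : v / M%:R ^+ 2 <= 1.
    rewrite ler_pdivrMr ?exprn_gt0 // mul1r (le_trans v_le1) // exprn_ege1 // ler1n //.
  rewrite /y; lra.
have jn : (0 < j <= n)%N by rewrite lejn /j addn_gt0 orbT.
have jR : 0 < j%:R :> R by rewrite ltr0n; case/andP: jn.
have grow := expr_growth y_ge0 jn.
have : (A * M ^ (8 * q + 4))%:R <= (1 + y) ^+ n.
  apply: le_trans grow.
  have h : M%:R / (144 * j * C)%:R <= n%:R * y / (2 * j)%:R.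
    rewrite ler_pdivlMr ?ltr0n ?muln_gt0 ?(andP jn).1 //.
    have -> : M%:R / (144 * j * C)%:R * (2 * j)%:R = M%:R ^+ 3 / M%:R ^+ 2 / (72 * C%:R) :> R.
      by rewrite !natrM; field; rewrite !gt_eqF.
    rewrite ler_pdivrMr ?mulr_gt0 //.
    have -> : n%:R * y * (72 * C%:R) = 8 * (n%:R * v * C%:R) / M%:R ^+ 2.
      by rewrite /y; field; rewrite gt_eqF.
    by rewrite ler_pM2r ?invr_gt0 ?exprn_gt0.
  have h0 : 0 <= M%:R / (144 * j * C)%:R :> R by rewrite divr_ge0.
  apply: le_trans (_ : (M%:R / (144 * j * C)%:R) ^+ j <= _); last first.
    by rewrite lerXn2r ?nnegrE // (le_trans h0).
  rewrite expr_div_n ler_pdivlMr ?exprn_gt0 ?ltr0n ?muln_gt0 ?(andP jn).1 //.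
  rewrite -!natrX -natrM ler_nat mulnAC (leq_trans (leq_mul leAM (leqnn _))) //.
  by rewrite -expnS leq_pexp2l // /j; lia.
move=> h; apply: (@le_trans _ _ ((1 - y) ^+ n * (1 + y) ^+ n)).
  by rewrite ler_wpM2l // exprn_ge0 // subr_ge0.
rewrite -exprMn exprn_ile1 //; first by rewrite mulr_ge0 ?subr_ge0 // addr_ge0.
have := sqr_ge0 y; nra.
Qed.

Lemma det_toeplitz_scale (q c : nat) (F : {poly RR}) (rho a : RR) : 0 < rho -> 0 < a ->
  0 < \det (\matrix_(i < q, j < q) (rho ^+ (c + i) / a * toeplitz q c F i j / rho ^+ j)) ->
  0 < \det (toeplitz q c F).
Proof.
move=> rho_gt0 a_gt0.
rewrite (det_scale (fun i : 'I_q => rho ^+ (c + i) / a) (fun j : 'I_q => rho ^- j)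
  (fun i j : 'I_q => toeplitz q c F i j)).
rewrite pmulr_rgt0; first by congr (0 < \det _); apply/matrixP => i j; rewrite mxE.
rewrite mulr_gt0 // prodr_gt0 // => i _; first by rewrite divr_gt0 // exprn_gt0.
by rewrite invr_gt0 exprn_gt0.
Qed.

Lemma angle_small (q M G t : nat) : (0 < q)%N -> (0 < M)%N -> (t < q * G)%N ->
  `|angle (G * (8 * q * M ^ 2)) t| <= M%:R ^- 2.
Proof.
move=> q_gt0 M_gt0 ltt; set N := (G * _)%N.
have M2 : (0 < M ^ 2)%N by rewrite expn_gt0 M_gt0.
have le2 : (t.*2 <= N)%N by rewrite /N; nia.
have N_gt0 : 0 < N%:R :> RR by rewrite ltr0n; nia.
rewrite /angle le2 subr0 -mulr_natl.
have pi_ge0 := ltW pi_gt0; have := pi_le4; move: pi pi_ge0 => p p_ge0 p_le4.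
rewrite ger0_norm; last by rewrite mulr_ge0 // divr_ge0 ?mulrn_wge0 // ltW.
rewrite mulrA ler_pdivrMr // -[M%:R ^- 2]mul1r mulrAC ler_pdivlMr ?exprn_gt0 ?ltr0n // mul1r.
have : t%:R * M%:R ^+ 2 * 8 <= N%:R :> RR.
  by rewrite -natrX -!natrM ler_nat /N; nia.
have : 0 <= t%:R * M%:R ^+ 2 :> RR by rewrite mulr_ge0 ?exprn_ge0.
rewrite -mulr_natr; nra.
Qed.

(** The circle has three zones. On the first [q * G] points the phase has real part at least 1/4; at
    the other angles up to [1 / M] its real part is nonnegative; beyond that its modulus is at most
    [1 / E]. The window controls the norm of [x] with a loss polynomial in [M], so an [E] polynomial
    in [M] is large enough. *)
Lemma toeplitz_bulk (q B k : nat) : (0 < q)%N ->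
  exists S : RR, forall (K : seq nat) (n c : nat) (rho : RR),
    (size K <= B * n)%N -> {in K, forall j, (j <= k)%N} -> (n <= count_mem 1%N K)%N ->
    0 < rho -> \sum_(j <- K) j%:R * bern rho j = c%:R ->
    S <= n%:R * (rho / (1 + rho) ^+ 2) ->
    0 < \det (toeplitz q c (\prod_(j <- K) (1 + 'X^j) : {poly RR})).
Proof.
move=> q_gt0.
have [C C_gt0 leC] : exists2 C : nat, (0 < C)%N & (B * k ^ 3 <= C)%N.
  by exists (B * k ^ 3).+1.
pose j := (8 * q + 6)%N.
(* The constant left in [E ^ 2], for the [E] chosen later, once the powers of [M] are split off. *)
have [A AE] : exists A, A = ((8 * q ^ 3 * 4 ^ q * (8 * q) ^ (2 * q + 1)) ^ 2)%N by eexists.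
have [M0 [M0_gt1 M0_ge M0_gek]] :
    exists M0, [/\ (1 < M0)%N, (A * (144 * j * C) ^ j <= M0)%N & (k <= M0)%N].
  exists (A * (144 * j * C) ^ j + k + 2)%N.
  by split; [rewrite addn2 | rewrite -addnA leq_addr | rewrite addnAC leq_addl].
(* The cube makes [M] as large as the tail estimate and [k |x| <= 1] require; the summand [j] forces
   [j <= n], because [v <= 1]. *)
exists (M0%:R ^+ 3 + j%:R) => K n c rho sizeK leKk leK rho_gt0 sumE leS.
set v := rho / (1 + rho) ^+ 2 in leS.
have /andP[v_gt0 v_le] : 0 < v <= 1 / 4 by exact: varQ_le.
have lejn : (j <= n)%N.
  rewrite -(ler_nat RR) (@le_trans _ _ (n%:R * v)) //; last by rewrite ler_piMr //; lra.
  by apply: le_trans leS; rewrite lerDr exprn_ge0.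
have nv_ge0 : 0 <= n%:R * v by rewrite mulr_ge0 // ltW.
have leM0 : M0%:R ^+ 3 <= n%:R * v * C%:R.
  apply: (@le_trans _ _ (n%:R * v)); last by rewrite ler_peMr // ler1n.
  by apply: le_trans leS; rewrite lerDl.
have [M [leM0M leM leM8]] := nat_cube M0_gt1 leM0.
have M_gt0 : (0 < M)%N by rewrite (leq_trans _ leM0M) // ltnW.
have leAM := leq_trans M0_ge leM0M.
have lekM := leq_trans M0_gek leM0M.
have v01 : 0 < v <= 1 by rewrite v_gt0; lra.
have tail := tail_small C_gt0 M_gt0 v01 lejn leM8 leAM.
pose F : {poly RR} := \prod_(j <- K) (1 + 'X^j).
have Frho : 0 < F.[rho].
  by rewrite horner_prod prodr_gt0 // => i _; rewrite !hornerE addr_gt0 ?exprn_gt0.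
(* The window of [q * G] points spans angles up to [2 pi q G / N = pi / (4 M^2)], at most [M^-2].
   The size of [G] ensures that [N] exceeds all degrees involved. *)
pose Q := (8 * q * M ^ 2)%N; pose G := (size F + c + q)%N; pose N := (G * Q)%N.
have M2_gt0 : (0 < M ^ 2)%N by rewrite expn_gt0 M_gt0.
have leqQ : (0 < q <= Q)%N by rewrite q_gt0 /Q (leq_trans (leq_pmull q (isT :
  (0 < 8)%N))) // leq_pmulr.
have G_gt0 : (0 < G)%N by rewrite /G; lia.
have Q_gt0 : (0 < Q)%N by case/andP: leqQ; exact: leq_trans.
have leGN : (G <= N)%N by rewrite /N leq_pmulr.
have N_gt0 : (0 < N)%N by rewrite (leq_trans G_gt0).
pose z := cis (pi *+ 2 / N%:R).
have z1 : `|z| = 1 by exact: cis_norm.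
have zN : z ^+ N = 1.
  by rewrite /z -cisMn -[_ *+ N]mulr_natr divfK ?cis2pi // pnatr_eq0 -lt0n.
have z_prim d : (0 < d < N)%N -> z ^+ d != 1.
  case/andP=> d_gt0 ltdN; rewrite -cisMn; apply: cis_eq1.
  have p2 : 0 < pi *+ 2 by rewrite pmulrn_lgt0 // pi_gt0.
  rewrite -[_ *+ d]mulr_natl mulr_gt0 ?divr_gt0 ?ltr0n //= mulrA ltr_pdivrMr ?ltr0n //.
  by rewrite mulrC ltr_pM2l // ltr_nat.
have zz : z * z^*%C = 1 by rewrite -normCK z1 expr1n.
apply: (@det_toeplitz_scale _ _ _ rho F.[rho]) => //.
apply: det_gt0_of_posdef => x x_neq0.
pose w (t : 'I_N) := wphase K rho (angle N t).
have wP (t : 'I_N) : (map_poly (real_complex RR) F).[rho%:C%C * z ^+ t] * (z^*%C ^+ t) ^+ c =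
      F.[rho]%:C%C * w t.
  have -> : z^*%C ^+ t = (cis (angle N t))^*%C by rewrite cis_angle; exact/esym/rmorphXn.
  by rewrite -cis_angle wphaseE.
rewrite -(pmulrn_lgt0 _ N_gt0).
have rho0 : rho != 0 by rewrite gt_eqF.
have F0 : F.[rho] != 0 by rewrite gt_eqF.
have sz1 : (size F + q <= N)%N by apply: leq_trans leGN; rewrite /G leq_add2r leq_addr.
have sz2 : (c + q <= N)%N by apply: leq_trans leGN; rewrite /G leq_add2r leq_addl.
rewrite (toeplitz_form x rho0 F0 zz zN z_prim sz1 sz2 wP).
pose s t := sqn (\sum_(i < q) (x 0 i)%:C%C * (z ^+ t) ^+ i).
pose X := \sum_i x 0 i ^+ 2.
have X_gt0 : 0 < X.
  have /rV0Pn[i xi] := x_neq0; rewrite /X (bigD1 i) //= ltr_wpDr ?sumr_ge0 // => [l _|].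
    by rewrite sqr_ge0.
  by rewrite lt_def sqr_ge0 sqrf_eq0 xi.
have s_le t : s t <= q%:R * X.
  apply: (@le_trans _ _ ((\sum_i `|x 0 i|) ^+ 2)); last first.
    apply: le_trans (sqr_sum_le _) _ => [i|]; first by rewrite num_real.
    by rewrite ler_wpM2l // ler_sum // => i _; rewrite real_normK ?num_real.
  rewrite -lecR sqn_norm rmorphXn lerXn2r ?nnegrE //.
    by rewrite ler0c sumr_ge0.
  rewrite rmorph_sum (le_trans (ler_norm_sum _ _ _)) // ler_sum // => i _.
  rewrite normrM !normrX z1 !expr1n mulr1 normc_def /= expr0n addr0 sqrtr_sqr.
  exact: lexx.
(* With [Cw] the constant of [window_sum], [E = 8 Cw q Q]. The errors then add up to at most
   [G X / (8 Cw)], against at least [G X / (4 Cw)] from the window. *)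
pose E := (8 * q ^ 3 * 4 ^ q * Q ^ (2 * q + 1))%N.
have EE : (E ^ 2 = A * M ^ (8 * q + 4))%N.
  rewrite /E AE /Q [((_ * M ^ 2) ^ _)%N]expnMn mulnA expnMn -!expnM.
  suff -> : (2 * ((2 * q + 1) * 2) = 8 * q + 4)%N by []. by ring.
have E_gt0 : 0 < E%:R :> RR.
  by rewrite ltr0n /E !muln_gt0 !expn_gt0 q_gt0 Q_gt0.
have MR : 0 < M%:R :> RR by rewrite ltr0n.
have M1 : M%:R^-1 <= 1 :> RR by rewrite invf_le1 // ler1n.
have w_ge (t : 'I_N) : (t < q * G)%N%:R / 4 - E%:R^-1 <= Re (w t).
  pose y := angle N t.
  have tv : n%:R * v * (B * k ^ 3)%:R <= M%:R ^+ 3.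
    by apply: le_trans leM; rewrite ler_wpM2l // ler_nat.
  have tv_ge0 : 0 <= n%:R * v * (B * k ^ 3)%:R by rewrite mulr_ge0.
  have [y_le|y_gt] := leP `|y| (M%:R^-1).
    have kx : k%:R * `|y| <= 1.
      apply: (@le_trans _ _ (M%:R * M%:R^-1)); last by rewrite mulfV ?gt_eqF.
      by rewrite ler_pM // ler_nat.
    have tx : n%:R * v * (B * k ^ 3)%:R * `|y| ^+ 3 <= 1.
      apply: (@le_trans _ _ (M%:R ^+ 3 * M%:R^-1 ^+ 3)).
        by rewrite ler_pM ?exprn_ge0 // lerXn2r ?nnegrE // invr_ge0 ltW.
      by rewrite -exprMn mulfV ?gt_eqF // expr1n.
    have [Re_ge0 Re_win] := wphase_main rho_gt0 sizeK leKk kx tx.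
    case: ltnP => [ltt|_]; last first.
      by rewrite mul0r sub0r (le_trans _ Re_ge0) // oppr_le0 invr_ge0 ltW.
    apply: (@le_trans _ _ (1 / 4)); first by rewrite lerBlDr lerDl invr_ge0 ltW.
    apply: Re_win; have y2 := angle_small q_gt0 M_gt0 ltt; rewrite -/Q -/N -/y in y2.
    apply: (@le_trans _ _ (M%:R ^+ 3 * (M%:R ^- 2) ^+ 2)).
      rewrite ler_pM ?sqr_ge0 // -[leLHS]real_normK ?num_real // lerXn2r ?nnegrE //.
      by rewrite invr_ge0 exprn_ge0.
    have -> : M%:R ^+ 3 * (M%:R ^- 2) ^+ 2 = M%:R^-1 :> RR by field; rewrite gt_eqF.
    exact: M1.
  have -> : (t < q * G)%N = false.
    apply/negbTE/negP => ltt; have y2 := angle_small q_gt0 M_gt0 ltt.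
    rewrite -/Q -/N -/y in y2; move: (lt_le_trans y_gt y2); rewrite ltNge => /negP; apply.
    by rewrite exprSr invfM expr1 ler_piMl // invr_ge0 ltW.
  rewrite mul0r sub0r lerNl.
  have y16 : y ^+ 2 <= 16.
    have y4 := le_trans (angle_le_pi (ltn_ord t)) pi_le4; rewrite -/y in y4.
    rewrite -[leLHS]real_normK ?num_real // (_ : 16 = 4 ^+ 2); last by ring.
    by rewrite lerXn2r ?nnegrE.
  have My : M%:R ^- 2 <= y ^+ 2.
    by rewrite -[leRHS]real_normK ?num_real // -exprVn lerXn2r ?nnegrE ?invr_ge0 // ltW.
  have My_ge0 : 0 <= M%:R ^- 2 :> RR by rewrite invr_ge0 exprn_ge0.
  have sq : Re (w t) ^+ 2 <= E%:R^-1 ^+ 2.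
    apply: (@le_trans _ _ (sqn (w t))); first by rewrite /sqn lerDl sqr_ge0.
    apply: le_trans (wphase_tail rho_gt0 leK (angle_le_pi (ltn_ord t))) _; rewrite -/v -/y.
    have -> : E%:R^-1 ^+ 2 = (A * M ^ (8 * q + 4))%:R^-1 :> RR by rewrite -EE natrX exprVn.
    rewrite -[leRHS]mul1r ler_pdivlMr ?ltr0n -?EE ?expn_gt0 -?(ltr0n RR) ?E_gt0 //.
    rewrite EE; apply: le_trans tail; rewrite ler_wpM2r // lerXn2r ?nnegrE //.
    - have h : v * y ^+ 2 <= 1 / 4 * 16 by rewrite ler_pM ?sqr_ge0 ?(ltW v_gt0).
      by rewrite subr_ge0; lra.
    - have h : v * M%:R ^- 2 <= 1 / 4 * 16 by rewrite ler_pM ?(ltW v_gt0) // (le_trans My).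
      by rewrite subr_ge0; lra.
    by rewrite lerD2l lerN2 ler_pM2r ?invr_gt0 // ler_pM2l.
  apply: le_trans (ler_norm _) _; rewrite normrN.
  by rewrite -(@ler_pXn2r _ 2) ?nnegrE ?invr_ge0 ?(ltW E_gt0) // real_normK ?num_real.
have := window_sum (fun i => x 0 i) leqQ G_gt0 z1 zN z_prim.
rewrite -/X; set Cw := (_ * _ * _)%N => win.
have Cw_gt0 : 0 < Cw%:R :> RR by rewrite ltr0n /Cw !muln_gt0 !expn_gt0 q_gt0 Q_gt0.
apply: (@lt_le_trans _ _ (\sum_(t < N) ((t < q * G)%N%:R / 4 - E%:R^-1) * s t)); last first.
  by apply: ler_sum => t _; rewrite ler_wpM2r ?sqn_ge0.
have -> : \sum_(t < N) ((t < q * G)%N%:R / 4 - E%:R^-1) * s t =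
    (\sum_(t < q * G) s t) / 4 - E%:R^-1 * \sum_(t < N) s t.
  have leqGN : (q * G <= N)%N by rewrite /N mulnC leq_mul2l (andP leqQ).2 orbT.
  rewrite (big_ord_widen N s leqGN) [X in X / 4]big_mkcond /= mulr_suml mulr_sumr -sumrB.
  by apply: eq_bigr => t _; case: (_ < _)%N => /=; ring.
have sumN : \sum_(t < N) s t <= N%:R * (q%:R * X).
  by rewrite mulr_natl -[X in _ *+ X]card_ord -sumr_const ler_sum.
have EC : E%:R = 8 * Cw%:R * q%:R * Q%:R :> RR.
  by rewrite /E /Cw -!natrM; congr _%:R; rewrite expnD expn1; ring.
have GX : 0 < G%:R * X by rewrite mulr_gt0 // ltr0n.
have h1 : G%:R * X / Cw%:R <= \sum_(t < q * G) s t by rewrite ler_pdivrMr // [leRHS]mulrC.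
have h2 : E%:R^-1 * \sum_(t < N) s t <= G%:R * X / Cw%:R / 8.
  rewrite mulrC ler_pdivrMr // (le_trans sumN) // EC /N natrM le_eqVlt; apply/orP; left.
  by apply/eqP; field; rewrite gt_eqF.
have h3 : 0 < G%:R * X / Cw%:R by rewrite divr_gt0.
lra.
Qed.

(** * Toeplitz minors near the ends *)

Lemma poly_eventually_gt0 (R : archiRealFieldType) (p : {poly R}) (d : nat) :
  (size p <= d.+1)%N -> 0 < p`_d ->
  exists n0 : nat, forall n : nat, (n0 <= n)%N -> 0 < p.[n%:R].
Proof.
move=> sp pd.
have lcE : lead_coef p = p`_d.
  suff -> : d = (size p).-1 by [].
  have : (d < size p)%N by rewrite ltnNge; apply/negP => h; rewrite nth_default ?ltxx in pd.
  by case: (size p) sp => // s1; rewrite !ltnS => h1 h2; apply/eqP; rewrite eqn_leq h2 h1.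
have lc_gt0 : 0 < lead_coef p by rewrite lcE.
have [x xP] := poly_pinfty_gt_lc lc_gt0.
exists (Num.bound `|x|) => n len; apply: lt_le_trans lc_gt0 (xP _ _).
apply: le_trans (ler_norm x) _; apply: le_trans (ltW (archi_boundP (normr_ge0 x))) _.
by rewrite ler_nat.
Qed.

Lemma coef_prod_le (R : comNzRingType) (I : Type) (s : seq I) (F : I -> {poly R}) (d : I -> nat) :
  (forall i, (size (F i) <= (d i).+1)%N) ->
  (size (\prod_(i <- s) F i)%R <= (\sum_(i <- s) d i).+1)%N /\
  (\prod_(i <- s) F i)`_(\sum_(i <- s) d i)%N = \prod_(i <- s) (F i)`_(d i).
Proof.
move=> sF; elim: s => [|i s [IHs IHc]]; first by rewrite !big_nil size_poly1 coef1.
rewrite !big_cons; set P := \prod_(_ <- s) _ in IHs IHc *;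
  set D := (\sum_(_ <- s) _)%N in IHs IHc *.
split.
  rewrite (leq_trans (size_polyMleq _ _)) //; have := sF i; lia.
rewrite -IHc coefM (bigD1 (inord (d i))) //= inordK ?ltnS ?leq_addr // addKn.
rewrite big1 ?addr0 // => j; rewrite -val_eqE /= inordK ?ltnS ?leq_addr // => neqj.
have [ltj|lej] := ltnP (d i) j.
  by rewrite nth_default ?mul0r // (leq_trans (sF i)).
by rewrite [P`_ _]nth_default ?mulr0 // (leq_trans IHs) //; have := ltn_ord j; lia.
Qed.

(** Every product in the expansion takes one entry from each row, so all have the same degree bound
    and the top coefficients form a determinant again. *)
Lemma coef_det_le (R : comNzRingType) (q : nat) (A : 'M[{poly R}]_q) (d : 'I_q -> nat) :
  (forall i j, (size (A i j) <= (d i).+1)%N) ->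
  (size (\det A) <= (\sum_i d i).+1)%N /\
  (\det A)`_(\sum_i d i)%N = \det (\matrix_(i, j) (A i j)`_(d i)).
Proof.
move=> sA; split.
  apply: (leq_trans (size_sum _ _ _)); apply/bigmax_leqP => s _.
  case: (odd_perm s); rewrite /= ?expr1 ?expr0 ?mulN1r ?mul1r ?size_polyN;
  by have [] := coef_prod_le (index_enum _) (fun i => sA i (s i)).
rewrite /determinant coef_sum; apply: eq_bigr => s _.
have [_] := coef_prod_le (index_enum _) (fun i => sA i (s i)).
under [X in _ = _ * X]eq_bigr do rewrite mxE.
by move=> <-; case: (odd_perm s); rewrite /= ?expr1 ?expr0 ?mulN1r ?mul1r ?coefN.
Qed.

(** Differences of consecutive rows lower the falling factorials:
    [(x+1)^_(j+1) - x^_(j+1) = (j+1) x^_j]. So the determinant of order [r.+1] is [r!] times the one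
    of order [r]. *)
Lemma det_ffact_gt0 (R : realFieldType) (r c : nat) :
  0 < \det (\matrix_(i < r, j < r) ((c + i) ^_ j)%:R : 'M[R]_r).
Proof.
elim: r => [|r IHr]; first by rewrite det_mx00.
rewrite det_sub_rows => [|i]; last by rewrite mxE ffactn0.
have -> : \matrix_(i < r, j < r) ((\matrix_(i0 < r.+1, j0 < r.+1) ((c + i0) ^_ j0)%:R :
  'M[R]_r.+1) (lift ord0 i) (lift ord0 j) -
   (\matrix_(i0 < r.+1, j0 < r.+1) ((c + i0) ^_ j0)%:R :
     'M[R]_r.+1) (widen_ord (leqnSn r) i) (lift ord0 j)) =
   (\matrix_(j < r, i < r) (j.+1%:R * ((c + i) ^_ j)%:R))^T.
  apply/matrixP => i j; rewrite !mxE /= /bump leq0n add1n addnS.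
  have ffactD x y : (x.+1 ^_ y.+1 = x ^_ y.+1 + y.+1 * x ^_ y)%N.
    rewrite ffactSS ffactnSr [RHS]addnC mulnC [(y.+1 * _)%N]mulnC -mulnDr;
      have [leyx|ltxy] := leqP y x.
      by congr (_ * _)%N; lia.
    by rewrite ffact_small.
  by rewrite ffactD natrD addrC addKr natrM.
rewrite det_tr (det_mulr_rows (fun j : 'I_r => j.+1%:R) (fun j i : 'I_r => ((c + i) ^_ j)%:R)).
rewrite mulr_gt0 ?prodr_gt0 // -det_tr; move: IHr.
by congr (0 < \det _); apply/matrixP => i j; rewrite !mxE.
Qed.

Definition binp (R : fieldType) (j : nat) : {poly R} :=
  j`!%:R^-1 *: \prod_(i < j) ('X - i%:R%:P).

Lemma size_binp (R : fieldType) (j : nat) : (size (binp R j) <= j.+1)%N.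
Proof.
by rewrite /binp (leq_trans (size_scale_leq _ _)) // -big_enum size_prod_XsubC size_enum_ord.
Qed.

Lemma coef_binp (R : fieldType) (j : nat) : (binp R j)`_j = j`!%:R^-1.
Proof.
rewrite /binp coefZ -big_enum.
have /monicP := monic_prod_XsubC (enum 'I_j) xpredT (fun i : 'I_j => i%:R : R).
by rewrite lead_coefE size_prod_XsubC size_enum_ord /= => ->; rewrite mulr1.
Qed.

Lemma horner_binp (R : numFieldType) (n j : nat) : (binp R j).[n%:R] = 'C(n, j)%:R.
Proof.
rewrite /binp hornerZ horner_prod.
have -> : \prod_(i < j) ('X - i%:R%:P).[n%:R] = (n ^_ j)%:R :> R.
  elim: j => [|j IHj]; first by rewrite big_ord0 ffactn0.
  rewrite big_ord_recr /= IHj ffactnSr natrM !hornerE.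
  by have [lejn|ltnj] := leqP j n; [rewrite natrB | rewrite ffact_small ?mul0r].
by rewrite -bin_ffact natrM mulrCA mulVf ?mulr1 // pnatr_eq0 -lt0n fact_gt0.
Qed.

(** The range of summation does not depend on [n], which enters only through binomial coefficients;
    hence the coefficient is a polynomial in [n]. *)
Lemma coef_linear_pow (R : comNzRingType) (u g : {poly R}) (n l : nat) :
  (u * (1 + 'X * g) ^+ n)`_l = \sum_(j < l.+1) 'C(n, j)%:R * (u * g ^+ j)`_(l - j).
Proof.
pose t j : R := 'C(n, j)%:R * (u * ('X * g) ^+ j)`_l.
have -> : (u * (1 + 'X * g) ^+ n)`_l = \sum_(j < n.+1) t j.
  rewrite exprDn mulr_sumr coef_sum; apply: eq_bigr => j _.
  by rewrite expr1n mul1r mulrnAr coefMn /t mulr_natl.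
have tE (j : nat) : t j = if (j <= l)%N then 'C(n, j)%:R * (u * g ^+ j)`_(l - j) else 0.
  rewrite /t exprMn mulrCA coefXnM; case: ltnP => _ //; exact: mulr0.
transitivity (\sum_(j < l.+1) t j); last by apply: eq_bigr => j _; rewrite tE -ltnS ltn_ord.
transitivity (\sum_(j < (n + l).+1) t j).
  rewrite (big_ord_widen _ t (_ : (n.+1 <= (n + l).+1)%N)) ?ltnS ?leq_addr // big_mkcond.
  by apply: eq_bigr => j _; case: ltnP => // ltnj; rewrite /t bin_small ?mul0r.
rewrite [RHS](big_ord_widen _ t (_ : (l.+1 <= (n + l).+1)%N)) ?ltnS ?leq_addl // [RHS]big_mkcond.
by apply: eq_bigr => j _; case: ltnP => // ltlj; rewrite tE leqNgt ltlj.
Qed.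

(* Up to the factor [f`_0 ^+ n], the coefficient of degree [l] of [u * f ^+ n] is a polynomial in
   [n] of degree [l] with leading coefficient [u`_0 * (f`_1 / f`_0) ^+ l / l`!]. *)
Lemma toeplitz_edge (R : archiRealFieldType) (f u : {poly R}) (r c : nat) :
  0 < f`_0 -> 0 < f`_1 -> 0 < u`_0 ->
  exists n0 : nat, forall n : nat, (n0 <= n)%N -> 0 < \det (toeplitz r c (u * f ^+ n)).
Proof.
move=> f0 f1 u0.
pose g : {poly R} := \poly_(i < size f) (f`_i.+1 / f`_0).
have fE : f = f`_0 *: (1 + 'X * g).
  apply/polyP => -[|i]; rewrite coefZ coefD coef1 coefXM /= ?addr0 ?mulr1 // add0r coef_poly.
  case: ltnP => [_|le]; first by rewrite mulrC divfK ?gt_eqF.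
  by rewrite mulr0 nth_default // (leq_trans le).
have g0 : 0 < g`_0.
  rewrite coef_poly; case: ltnP => [_|le]; first by rewrite divr_gt0.
  by rewrite nth_default ?ltxx // in f0.
pose P l := \sum_(j < l.+1) (u * g ^+ j)`_(l - j) *: binp R j.
have sP l : (size (P l) <= l.+1)%N.
  apply: (leq_trans (size_sum _ _ _)); apply/bigmax_leqP => j _.
  by rewrite (leq_trans (size_scale_leq _ _)) // (leq_trans (size_binp _ _)).
have cP l : (P l)`_l = u`_0 * g`_0 ^+ l / l`!%:R.
  rewrite /P coef_sum (bigD1 ord_max) //= big1 ?addr0 => [|j]; last first.
    rewrite -val_eqE /= => neqj; rewrite coefZ [_`_l]nth_default ?mulr0 //.
    by rewrite (leq_trans (size_binp _ _)) // ltn_neqAle neqj -ltnS ltn_ord.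
  by rewrite coefZ coef_binp subnn -!horner_coef0 hornerM horner_exp.
have coefE n l : (u * f ^+ n)`_l = f`_0 ^+ n * (P l).[n%:R].
  rewrite {1}fE exprZn -scalerAr coefZ coef_linear_pow /P horner_sum; congr (_ * _).
  by apply: eq_bigr => j _; rewrite hornerZ horner_binp mulrC.
(* Multiplying column [j] by [n^j] gives all entries of row [i] the degree bound [c + i]. The top
   coefficients are then a row factor times a column factor times [(c + i) ^_ j], which vanishes
   exactly where the entry is cut off. *)
pose B : 'M[{poly R}]_r := \matrix_(i, j) (if (j <= c + i)%N then 'X^j * P (c + i - j)%N else 0).
have sB (i j : 'I_r) : (size (B i j) <= (c + i).+1)%N.
  rewrite mxE; case: (leqP j (c + i)) => [lej|_]; last by rewrite size_poly0.
  rewrite (leq_trans (size_polyMleq _ _)) // size_polyXn addSn /=.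
  by rewrite (leq_trans (leq_add (leqnn _) (sP _))) // addnS subnKC.
have [sdet cdet] := coef_det_le sB.
have top_gt0 : 0 < (\det B)`_(\sum_(i < r) (c + i)).
  rewrite cdet.
  have -> : \matrix_(i < r, j < r) (B i j)`_(c + i) =
      \matrix_(i < r, j < r) (u`_0 * g`_0 ^+ (c + i) / (c + i)`!%:R * ((c + i) ^_ j)%:R * g`_0 ^-
        j).
    apply/matrixP => i j; rewrite !mxE; case: leqP => [lej|ltj]; last first.
      by rewrite coef0 ffact_small ?mulr0 ?mul0r.
    rewrite coefXnM ltnNge lej /= cP -(ffact_fact lej) natrM.
    have -> : g`_0 ^+ (c + i) = g`_0 ^+ (c + i - j) * g`_0 ^+ j by rewrite -exprD subnK.
    have a0 : ((c + i) ^_ j)%:R != 0 :> R by rewrite pnatr_eq0 -lt0n ffact_gt0.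
    have b0 : ((c + i - j)`!)%:R != 0 :> R by rewrite pnatr_eq0 -lt0n fact_gt0.
    have d0 : g`_0 ^+ j != 0 by rewrite expf_neq0 // gt_eqF.
    move: (g`_0 ^+ j) d0 (g`_0 ^+ _) (_ ^_ _)%:R a0 (_`!)%:R b0 (u`_0) => x x0 y v v0 w w0 z.
    by field; rewrite x0 v0 w0.
  rewrite (det_scale (fun i : 'I_r => u`_0 * g`_0 ^+ (c + i) / (c + i)`!%:R)
      (fun j : 'I_r => g`_0 ^- j) (fun i j : 'I_r => ((c + i) ^_ j)%:R)).
  rewrite !mulr_gt0 ?det_ffact_gt0 ?prodr_gt0 // => i _.
    by rewrite divr_gt0 ?mulr_gt0 ?exprn_gt0 // ltr0n fact_gt0.
  by rewrite invr_gt0 exprn_gt0.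
have [n0 n0P] := poly_eventually_gt0 sdet top_gt0.
exists n0.+1 => n ltn; have n_gt0 : 0 < n%:R :> R by rewrite ltr0n (leq_trans _ ltn).
have -> : toeplitz r c (u * f ^+ n) =
    \matrix_(i < r, j < r) (f`_0 ^+ n * (B i j).[n%:R] * n%:R ^- j).
  apply/matrixP => i j; rewrite !mxE coefXnM; case: (leqP j (c + i)) => [lej|ltj].
    have nj : n%:R ^+ j != 0 :> R by rewrite expf_neq0 // gt_eqF.
    rewrite hornerM hornerXn coefE -[RHS]mulrA; congr (_ * _).
    by rewrite mulrAC mulfV ?mul1r.
  by rewrite horner0 mulr0 mul0r.
rewrite (det_scale (fun _ : 'I_r => f`_0 ^+ n) (fun j : 'I_r => n%:R ^- j)
  (fun i j : 'I_r => (B i j).[n%:R])).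
rewrite !mulr_gt0 ?prodr_gt0 // => [i _|i _|].
- by rewrite exprn_gt0.
- by rewrite invr_gt0 exprn_gt0.
have := n0P n (ltnW ltn); rewrite -horner_evalE -det_map_mx.
by congr (0 < \det _); apply/matrixP => i j; rewrite !mxE.
Qed.

(** * Palindromes, saddle points and uniformity in the position *)

Definition cprod (R : nzRingType) (K : seq nat) : {poly R} := \prod_(j <- K) (1 + 'X^j).

Lemma coef_mul1DXn (R : nzRingType) (p : {poly R}) (j l : nat) :
  ((1 + 'X^j) * p)`_l = p`_l + (if (l < j)%N then 0 else p`_(l - j)).
Proof. by rewrite mulrDl mul1r coefD coefXnM. Qed.

Lemma size_cprod (R : nzRingType) (K : seq nat) : (size (cprod R K) <= (sumn K).+1)%N.
Proof.
elim: K => [|j K IHK]; first by rewrite /cprod big_nil size_poly1.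
apply/leq_sizeP => l lel; rewrite /cprod big_cons coef_mul1DXn -/(cprod R K) /=.
have c0 l' : (sumn K < l')%N -> (cprod R K)`_l' = 0 by move=> ?;
  rewrite nth_default // (leq_trans IHK).
rewrite c0 ?add0r; last by rewrite (leq_trans _ lel) // ltnS leq_addl.
by case: ltnP => // lejl; rewrite c0 //= -(ltn_add2l j) subnKC.
Qed.

Lemma cprod_palindrome (R : nzRingType) (K : seq nat) (l : nat) : (l <= sumn K)%N ->
  (cprod R K)`_(sumn K - l) = (cprod R K)`_l.
Proof.
elim: K l => [|j K IHK] l; first by rewrite /cprod big_nil /= leqn0 => /eqP->.
have c0 l' : (sumn K < l')%N -> (cprod R K)`_l' = 0.
  by move=> ?; rewrite nth_default // (leq_trans (size_cprod _ _)).
move=> lel; rewrite /cprod big_cons !coef_mul1DXn -/(cprod R K) /= in lel *.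
rewrite addrC; congr (_ + _).
  have [lelK|ltKl] := leqP l (sumn K).
    rewrite ltnNge (_ : (j <= _)%N) /=; last lia.
    by rewrite -[RHS]IHK //; congr (_`_ _); lia.
  by rewrite (_ : (_ < j)%N) ?c0 //; lia.
case: ltnP => [ltlj|lejl]; first by rewrite c0 //; lia.
by rewrite -[RHS]IHK; [congr (_`_ _); lia | lia].
Qed.

(** Reversing the coefficients transposes the matrix and exchanges the two ends. *)
Lemma toeplitz_palindrome (R : comNzRingType) (K : seq nat) (r c : nat) : (c <= sumn K)%N ->
  \det (toeplitz r c (cprod R K)) = \det (toeplitz r (sumn K - c) (cprod R K)).
Proof.
move=> lec; rewrite -[RHS]det_tr; congr (\det _); apply/matrixP => i j; rewrite !mxE !coefXnM.
have c0 l' : (sumn K < l')%N -> (cprod R K)`_l' = 0.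
  by move=> ?; rewrite nth_default // (leq_trans (size_cprod _ _)).
case: ltnP => [lt1|le1]; case: ltnP => [lt2|le2] //.
- by rewrite c0 //; lia.
- by rewrite c0 //; lia.
have [le3|lt3] := leqP (c + i - j) (sumn K); last by lia.
by rewrite -[LHS]cprod_palindrome //; congr (_`_ _); lia.
Qed.

Lemma cprod_gt0 (K : seq nat) (x : RR) : 0 <= x -> 0 < (cprod RR K).[x].
Proof.
by move=> x0; rewrite horner_prod prodr_gt0 // => i _; rewrite !hornerE ltr_wpDr ?exprn_ge0.
Qed.

(** The logarithmic derivative [x F' / F] is the mean of the distribution with weights [F_l x^l],
    here a sum of Bernoulli means. *)
Lemma deriv_cprod (K : seq nat) (x : RR) : 0 < x ->
  x * (cprod RR K)^`().[x] = (\sum_(j <- K) j%:R * bern x j) * (cprod RR K).[x].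
Proof.
move=> x0; elim: K => [|j K IHK]; first by rewrite /cprod !big_nil derivC horner0 mulr0 mul0r.
rewrite /cprod !big_cons -/(cprod RR K) derivM hornerD !hornerM mulrDr mulrDl.
have xj : 0 < x ^+ j by rewrite exprn_gt0.
have h : x * (1 + 'X^j : {poly RR})^`().[x] = j%:R * bern x j * (1 + 'X^j).[x].
  have bE : bern x j * (1 + x ^+ j) = x ^+ j by rewrite divfK // gt_eqF // addr_gt0.
  rewrite derivD derivC add0r derivXn hornerMn hornerD hornerC !hornerXn -mulrA bE.
  by rewrite mulrnAr mulr_natl; case: (j) => [|j'] //=; rewrite exprS.
by rewrite mulrA h [x * (_ * _)]mulrCA IHK; ring.
Qed.

(** The coefficients of [x F' - c F] are [(l - c) F_l]: it is negative at 0 and has a positive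
    leading coefficient, hence a positive root. *)
Lemma saddle (K : seq nat) (c : nat) : (0 < c < sumn K)%N ->
  exists2 rho : RR, 0 < rho & \sum_(j <- K) j%:R * bern rho j = c%:R.
Proof.
case/andP=> c_gt0 ltc; set L := sumn K in ltc.
pose p : {poly RR} := 'X * (cprod RR K)^`() - c%:R *: cprod RR K.
have coefp l : p`_l = (l%:R - c%:R) * (cprod RR K)`_l.
  rewrite coefB coefZ coefXM coef_deriv mulrBl; congr (_ - _).
  by case: l => [|l] /=; rewrite ?mul0r ?mulr_natl.
have cL : 0 < (cprod RR K)`_L.
  by rewrite -[L]subn0 cprod_palindrome // -horner_coef0 cprod_gt0.
have p0 : p.[0] < 0.
  by rewrite horner_coef0 coefp sub0r mulNr oppr_lt0 mulr_gt0 ?ltr0n // -horner_coef0 cprod_gt0.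
have pL : 0 < p`_L by rewrite coefp mulr_gt0 // subr_gt0 ltr_nat.
have sp : (size p <= L.+1)%N.
  apply/leq_sizeP => l ltl; rewrite coefp [_`_l]nth_default ?mulr0 //.
  exact: leq_trans (size_cprod _ _) ltl.
have [n0 /(_ n0 (leqnn _)) pn] := poly_eventually_gt0 sp pL.
have [|x /andP[x_gt0 _] /rootP px] := @poly_ivtoo _ p 0 n0%:R (ler0n _ _).
  by rewrite nmulr_rlt0.
exists x => //; apply: (@mulIf _ (cprod RR K).[x]); first by rewrite gt_eqF ?cprod_gt0 // ltW.
rewrite -deriv_cprod //; move/eqP: px.
by rewrite !hornerE subr_eq0 => /eqP.
Qed.

(** Presents [(1 + X)^a] times an [n]-th power as one [cprod], to which the saddle point and the
    palindrome apply. *)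
Definition copies (ks : seq nat) (n a : nat) : seq nat := nseq a 1%N ++ flatten (nseq n ks).

Lemma cprod_copies (R : comNzRingType) ks n a :
  cprod R (copies ks n a) = (1 + 'X) ^+ a * cprod R ks ^+ n.
Proof.
rewrite /cprod big_cat; congr (_ * _).
  by rewrite big_nseq expr1 -Monoid.iteropE.
elim: n => [|n IHn]; first by rewrite big_nil.
by rewrite /= big_cat IHn exprS.
Qed.

Lemma size_copies ks n a : size (copies ks n a) = (a + n * size ks)%N.
Proof.
rewrite size_cat size_nseq; congr addn.
by elim: n => [|n IHn] //=; rewrite size_cat IHn mulSn.
Qed.

Lemma sumn_copies ks n a : sumn (copies ks n a) = (a + n * sumn ks)%N.
Proof.
rewrite sumn_cat sumn_nseq mul1n; congr addn.
by elim: n => [|n IHn] //=; rewrite sumn_cat IHn mulSn.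
Qed.

Lemma count1_copies ks n a : 1%N \in ks -> (n <= count_mem 1%N (copies ks n a))%N.
Proof.
move=> ks1; rewrite count_cat (leq_trans _ (leq_addl _ _)) //.
elim: n => [|n IHn] //=; rewrite count_cat -add1n leq_add //.
by rewrite -has_count has_pred1.
Qed.

Lemma mem_copies ks n a j : 1%N \in ks -> j \in copies ks n a -> j \in ks.
Proof.
move=> ks1; rewrite mem_cat => /orP[/nseqP[-> _] //|/flattenP[s /nseqP[-> _]]] //.
Qed.

(** For [rho <= 1] the factors with [j > 0] have probabilities at most [rho <= 4 rho / (1 + rho)^2],
    so the mean [c] is at most [B n k rho], hence at most [4 B k S]. For [rho > 1] the complementary
    probabilities are at most [1 / rho], and the same bound holds from the other end. *)
Lemma saddle_near_end (K : seq nat) (B k n c D : nat) (rho S : RR) :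
  (size K <= B * n)%N -> {in K, forall j, (j <= k)%N} -> (c <= sumn K)%N ->
  0 < rho -> \sum_(j <- K) j%:R * bern rho j = c%:R ->
  n%:R * (rho / (1 + rho) ^+ 2) < S -> (4 * B * k)%:R * S <= D%:R ->
  (c <= D)%N \/ (sumn K - c <= D)%N.
Proof.
move=> sizeK leKk lec rho_gt0 sumE ltS leD.
have bound (u : RR) (F : nat -> RR) : 0 < u -> (u / 4 <= rho / (1 + rho) ^+ 2) ->
    (forall j, (0 < j)%N -> F j <= u) -> \sum_(j <- K) j%:R * F j <= D%:R.
  move=> u_gt0 uv Fu.
  apply: (@le_trans _ _ (\sum_(j <- K) k%:R * u)).
    rewrite big_seq [leRHS]big_seq ler_sum // => j /leKk lejk.
    have [->|j_gt0] := posnP j; first by rewrite mul0r mulr_ge0 // ltW.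
    apply: (@le_trans _ _ (j%:R * u)); first by rewrite ler_wpM2l // Fu.
    by rewrite ler_wpM2r ?ler_nat // ltW.
  rewrite big_const_seq count_predT iter_addr_0 -[leLHS]mulr_natl.
  apply: (@le_trans _ _ ((B * n)%:R * (k%:R * u))).
    by rewrite ler_wpM2r ?ler_nat // mulr_ge0 // ltW.
  apply: le_trans leD.
  have -> : (B * n)%:R * (k%:R * u) = (4 * B * k)%:R * (n%:R * (u / 4)).
    by rewrite !natrM; field.
  by rewrite ler_wpM2l // (le_trans _ (ltW ltS)) // ler_wpM2l.
have rho1 : 0 < 1 + rho by rewrite addr_gt0.
have [le1|lt1] := leP rho 1.
  left; rewrite -(ler_nat RR) -sumE; apply: (bound rho) => //.
    rewrite ler_wpM2l ?(ltW rho_gt0) // lef_pV2 ?posrE ?exprn_gt0 //.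
    by rewrite (_ : 4 = 2 ^+ 2); [rewrite lerXn2r ?nnegrE ?(ltW rho1) //; lra | ring].
  move=> [//|j] _; rewrite /bern ler_pdivrMr ?addr_gt0 ?exprn_gt0 // exprS.
  have rho_ge0 := ltW rho_gt0; rewrite mulrDr mulr1; apply: (@le_trans _ _ rho).
    by rewrite ler_piMr ?exprn_ile1.
  by rewrite lerDl !mulr_ge0 ?exprn_ge0.
right; rewrite -(ler_nat RR) natrB // -sumE.
have -> : (sumn K)%:R - \sum_(j <- K) j%:R * bern rho j = \sum_(j <- K) j%:R * (1 - bern rho j).
  rewrite sumnE natr_sum -sumrB; apply: eq_bigr => j _; ring.
apply: (bound (rho^-1)); first by rewrite invr_gt0.
  rewrite ler_pdivlMr ?exprn_gt0 //.
  have rho_ge0 := ltW rho_gt0.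
  apply: (@le_trans _ _ (rho^-1 / 4 * (2 * rho) ^+ 2)).
    by rewrite ler_wpM2l ?mulr_ge0 ?invr_ge0 // lerXn2r ?nnegrE ?mulr_ge0 ?(ltW rho1) //; lra.
  by rewrite le_eqVlt; apply/orP; left; apply/eqP; field; rewrite gt_eqF.
move=> [//|j] _; have rj : 0 < rho ^+ j.+1 by rewrite exprn_gt0.
have -> : 1 - bern rho j.+1 = (1 + rho ^+ j.+1)^-1 by rewrite /bern; field;
  rewrite gt_eqF // addr_gt0.
rewrite lef_pV2 ?posrE ?addr_gt0 // exprS.
apply: (@le_trans _ _ (rho * rho ^+ j)); last by rewrite lerDr.
by rewrite ler_peMr ?(ltW rho_gt0) // exprn_ege1 // ltW.
Qed.

Lemma eventually_le (P : nat -> nat -> Prop) (D : nat) :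
  (forall c, exists n0, forall n, (n0 <= n)%N -> P c n) ->
  exists n0, forall c n, (c <= D)%N -> (n0 <= n)%N -> P c n.
Proof.
move=> evP; elim: D => [|D [n0 n0P]].
  by have [n0 n0P] := evP 0%N; exists n0 => c n; rewrite leqn0 => /eqP->; apply: n0P.
have [n1 n1P] := evP D.+1; exists (maxn n0 n1) => c n lec; rewrite geq_max => /andP[le0 le1].
by move: lec; rewrite leq_eqVlt => /predU1P[->|]; [apply: n1P | rewrite ltnS => /n0P; apply].
Qed.

Lemma coef_cprod_ge0 (K : seq nat) (l : nat) : 0 <= (cprod RR K)`_l.
Proof.
elim: K l => [|j K IHK] l; first by rewrite /cprod big_nil coef1 ler0n.
by rewrite /cprod big_cons coef_mul1DXn addr_ge0 ?IHK //; case: ifP => // _; rewrite IHK.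
Qed.

Lemma coef1_cprod_gt0 (K : seq nat) : 1%N \in K -> 0 < (cprod RR K)`_1.
Proof.
move=> K1; rewrite /cprod (perm_big _ (perm_to_rem K1)) big_cons coef_mul1DXn /=.
by rewrite ltr_wpDl ?coef_cprod_ge0 // -horner_coef0 cprod_gt0.
Qed.

Lemma toeplitz_gt0 (ks : seq nat) (m : nat) : 1%N \in ks ->
  exists n0 : nat, forall r c n : nat, (r <= m)%N -> (n0 <= n)%N ->
    (c <= (m - r) + n * sumn ks)%N ->
    0 < \det (toeplitz r c ((1 + 'X) ^+ (m - r) * cprod RR ks ^+ n)).
Proof.
move=> ks1.
suff /(@eventually_le _ m)[n0 n0P] : forall r, exists n0 : nat, forall n : nat, (n0 <= n)%N ->
  forall c,
    (c <= (m - r) + n * sumn ks)%N ->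
    0 < \det (toeplitz r c ((1 + 'X) ^+ (m - r) * cprod RR ks ^+ n)).
  by exists n0 => r c n lerm len lec; apply: n0P.
case=> [|r]; first by exists 0%N => n _ c _; rewrite det_mx00.
set a := (m - _)%N; pose B := (a + size ks)%N; pose k := \max_(j <- ks) j.
have [S SP] := @toeplitz_bulk r.+1 B k isT.
(* Since [D] does not depend on [n], finitely many edge positions remain and their thresholds have a
   maximum. *)
have [D DP] : exists D : nat, (4 * B * k)%:R * S <= D%:R.
  exists (Num.bound `|(4 * B * k)%:R * S|).
  by apply: le_trans (ler_norm _) _; rewrite ltW // archi_boundP.
have edge c : exists n0 : nat, forall n : nat, (n0 <= n)%N ->
    0 < \det (toeplitz r.+1 c ((1 + 'X) ^+ a * cprod RR ks ^+ n)).
  apply: toeplitz_edge.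
  - by rewrite -horner_coef0 cprod_gt0.
  - exact: coef1_cprod_gt0.
  - by rewrite -horner_coef0 horner_exp !hornerE expr1n.
have [n1 n1P] := eventually_le D edge.
(* The successor makes [n] positive, as [a <= a * n] requires in the bound on the number of
   factors. *)
exists n1.+1 => n ltn c lec; have len := ltnW ltn.
have [leDc|ltDc] := leqP c D; first exact: n1P.
have cE := cprod_copies RR ks n a.
have [leDc'|ltDc'] := leqP (sumn (copies ks n a) - c) D.
  rewrite -cE toeplitz_palindrome ?sumn_copies // -sumn_copies cE.
  exact: n1P.
have [|rho rho_gt0 sumE] := @saddle (copies ks n a) c.
  rewrite (leq_ltn_trans _ ltDc) //= -subn_gt0 (leq_ltn_trans _ ltDc') //.
have sK : (size (copies ks n a) <= B * n)%N.
  by rewrite size_copies /B mulnDl mulnC leq_add2r leq_pmulr // (leq_trans _ ltn).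
have lek : {in copies ks n a, forall j, (j <= k)%N}.
  by move=> j /(mem_copies ks1) jks; rewrite /k leq_bigmax_seq.
rewrite -cE; apply: (SP (copies ks n a) n c rho) => //; first exact: count1_copies.
rewrite leNgt; apply/negP => ltS.
have [] := saddle_near_end sK lek _ rho_gt0 sumE ltS DP; rewrite ?sumn_copies //.
- by rewrite leqNgt ltDc.
- by rewrite -sumn_copies leqNgt ltDc'.
Qed.

(** * Schur coefficients *)

Definition antisymmetric_mpoly (m : nat) (g : {mpoly int[m]}) : Prop :=
  forall s : 'S_m, msym s g = (-1) ^+ s *: g.

Definition shifted_mnm (m : nat) (l : bounded_partition m) : 'X_{1..m} :=
  [multinom shifted l j | j < m].

Lemma antisymmetric_alternant (m : nat) (a : 'I_m -> nat) : antisymmetric_mpoly (alternant a).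
Proof.
move=> s; rewrite /alternant -det_map_mx.
have -> : map_mx (msym s) (\matrix_(i, j) ('X_i ^+ a j : {mpoly int[m]})) =
    row_perm s (\matrix_(i, j) 'X_i ^+ a j).
  by apply/matrixP => i j; rewrite !mxE rmorphXn /= /msym mmapX mmap1U.
by rewrite row_permE det_mulmx det_perm -mul_mpolyC rmorphXn rmorphN1.
Qed.

Lemma antisymmetric_symM (m : nat) (p g : {mpoly int[m]}) :
  p \is symmetric -> antisymmetric_mpoly g -> antisymmetric_mpoly (p * g).
Proof. by move=> /issymP psym gsym s; rewrite msymM psym gsym scalerAr. Qed.

Lemma coef_alternant (m : nat) (a : 'I_m -> nat) (u : 'X_{1..m}) :
  (alternant a)@_u = \sum_(s : 'S_m) (-1) ^+ s * [forall i, a (s i) == u i]%:R.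
Proof.
rewrite /alternant /determinant raddf_sum; apply: eq_bigr => s _ /=.
rewrite -[(-1) ^+ s]/((-1) ^+ s) (_ : (-1) ^+ s = ((-1) ^+ s : int)%:MP); last first.
  by rewrite rmorphXn rmorphN1.
rewrite mul_mpolyC mcoeffZ; congr (_ * _).
have -> : \prod_i (\matrix_(i, j) ('X_i ^+ a j : {mpoly int[m]})) i (s i) =
    'X_[[multinom a (s i) | i < m]].
  by rewrite mpolyXE_id; apply: eq_bigr => i _; rewrite !mxE mnmE.
rewrite mcoeffX; congr (nat_of_bool _)%:R; apply/eqP/forallP => [<- i|h].
  by rewrite mnmE.
by apply/mnmP => i; rewrite mnmE; apply/eqP.
Qed.

Lemma shifted_decr (m : nat) (l : bounded_partition m) (i j : 'I_m) :
  (i < j)%N -> (shifted l j < shifted l i)%N.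
Proof.
move=> ltij; rewrite /shifted /staircase -addnS leq_add //; last by have := ltn_ord j; lia.
have := valP l; rewrite /= => sl.
have gt : transitive geq by move=> x y z /= h1 h2; exact: leq_trans h2 h1.
rewrite !(tnth_nth 0%N).
by apply: (sorted_leq_nth gt leqnn 0%N sl); rewrite ?inE ?size_tuple // ltnW.
Qed.

Lemma shifted_inj (m : nat) : injective (@shifted_mnm m).
Proof.
move=> l l' /mnmP e; apply: val_inj; apply: eq_from_tnth => i.
by have := e i; rewrite !mnmE => /addIn.
Qed.

Lemma decr_perm_id (m : nat) (a b : 'I_m -> nat) (s : 'S_m) :
  (forall i j : 'I_m, (i < j)%N -> (a j < a i)%N) -> (forall i j : 'I_m, (i < j)%N ->
    (b j < b i)%N) ->
  (forall i, a (s i) = b i) -> s = 1%g.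
Proof.
move=> da db e.
have mono (i j : 'I_m) : (i < j)%N -> (s i < s j)%N.
  move=> ltij; have := db _ _ ltij; rewrite -!e.
  have [//|/da h|/val_inj->] := ltngtP (s i) (s j); last by rewrite ltnn.
  by rewrite ltnNge ltnW.
have srt : sorted (fun i j : 'I_m => (i < j)%N) (enum 'I_m).
  by have := iota_ltn_sorted 0 m; rewrite -val_enum_ord sorted_map.
have eq_enum : [seq s i | i <- enum 'I_m] = enum 'I_m.
  apply: (@irr_sorted_eq _ (fun i j : 'I_m => (i < j)%N)) => [x y z|x|||i].
  - exact: ltn_trans.
  - exact: ltnn.
  - exact: (homo_sorted mono).
  - exact: srt.
  rewrite mem_enum; apply/mapP; exists ((s^-1)%g i); first by rewrite mem_enum.
  by rewrite permKV.
apply/permP => i; rewrite perm1.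
have := congr1 (fun t => nth i t i) eq_enum.
by rewrite (nth_map i) ?size_enum_ord // !nth_ord_enum.
Qed.

Lemma coef_alternant_shifted (m : nat) (l l' : bounded_partition m) :
  (alternant (shifted l))@_(shifted_mnm l') = (l == l')%:R.
Proof.
rewrite coef_alternant (bigD1 1%g) //= odd_perm1 mul1r big1 ?addr0 => [|s neqs].
  congr (nat_of_bool _)%:R; apply/forallP/eqP => [h|-> i]; last by rewrite perm1 mnmE.
  by apply: shifted_inj; apply/mnmP => i; have /eqP := h i; rewrite perm1 !mnmE.
case: forallP => [h|]; last by rewrite mulr0.
case/eqP: neqs; apply: (decr_perm_id (@shifted_decr m l) (@shifted_decr m l')) => i.
by have /eqP := h i; rewrite mnmE.
Qed.

(** A transposition kills each coefficient with two equal exponents. Sorting brings any other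
    exponent, up to sign, to a strictly decreasing one, which is [l + delta] for a partition [l]. *)
Lemma antisymmetric_eq0 (m : nat) (g : {mpoly int[m]}) : antisymmetric_mpoly g ->
  (forall l, g@_(shifted_mnm l) = 0) -> g = 0.
Proof.
move=> gsym g0; apply/mpolyP => u; rewrite mcoeff0.
have coefs (s : 'S_m) : g@_([multinom u (s i) | i < m]) = (-1) ^+ s * g@_u.
  by rewrite -mcoeff_sym gsym mcoeffZ.
have [/injectiveP u_inj|] := boolP (injectiveb u); last first.
  case/injectivePn => i [j neqij eqij].
  have := coefs (tperm i j); rewrite odd_tperm neqij expr1 mulN1r.
  have -> : [multinom u (tperm i j i0) | i0 < m] = u.
    by apply/mnmP => x; rewrite mnmE; case: tpermP => // ->.
  by move/eqP; rewrite -addr_eq0 -mulr2n mulrn_eq0 /= => /eqP.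
have [|s sE] := @tuple_permP _ _ (sort geq u) (multinom_val u) _; first by rewrite perm_sort.
have sort_s (i : 'I_m) : nth 0%N (sort geq u) i = u (s i).
  by rewrite sE -tnth_nth tnth_mktuple.
have geq_total : total geq by move=> x y; exact: leq_total.
have geq_trans : transitive geq by move=> x y z /= h1 h2; exact: leq_trans h2 h1.
have us_decr (i j : 'I_m) : (i < j)%N -> (u (s j) < u (s i))%N.
  move=> ltij; rewrite ltn_neqAle (inj_eq u_inj) (inj_eq perm_inj) eq_sym neq_ltn ltij /=.
  rewrite -!sort_s; apply: (sorted_leq_nth geq_trans leqnn 0%N (sort_sorted geq_total u));
  by rewrite ?inE ?size_sort ?size_tuple // ltnW.
(* Strictly decreasing naturals dominate the staircase, so subtracting it loses nothing. *)
have us_ge (i : 'I_m) : (m - i.+1 <= u (s i))%N.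
  elim: {i}(m - i.+1)%N {-2}i (erefl (m - i.+1)%N) => [|d IHd] i di; first by rewrite di.
  have lti : (i.+1 < m)%N by lia.
  have := us_decr i (Ordinal lti) (ltnSn i); have := IHd (Ordinal lti); rewrite /= di; lia.
pose t := [tuple (u (s i) - (m - i.+1))%N | i < m].
have t_sorted : sorted geq t.
  apply/(sortedP 0%N) => i; rewrite size_tuple => lti.
  have lti' := ltnW lti.
  have tE (k : 'I_m) : nth 0%N t k = (u (s k) - (m - k.+1))%N by rewrite -tnth_nth tnth_mktuple.
  have := tE (Ordinal lti'); have := tE (Ordinal lti); rewrite /= => -> ->.
  by have := us_decr (Ordinal lti') (Ordinal lti) (ltnSn i); lia.
pose l : bounded_partition m := exist _ t t_sorted.
have := g0 l.
have -> : shifted_mnm l = [multinom u (s i) | i < m].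
  by apply/mnmP => i; rewrite !mnmE /shifted /staircase /= tnth_mktuple subnK.
by rewrite coefs => /eqP; rewrite mulf_eq0 signr_eq0 /= => /eqP.
Qed.

Lemma schur_alternant (m : nat) (l : bounded_partition m) :
  schur l * alternant (@staircase m) = alternant (shifted l).
Proof. by apply/esym/eqP; rewrite -schurE. Qed.

Lemma alternant_expansion (m : nat) (g : {mpoly int[m]}) : antisymmetric_mpoly g ->
  exists2 r : seq (bounded_partition m),
    uniq r /\ (forall l, l \notin r -> g@_(shifted_mnm l) = 0) &
    g = \sum_(l <- r) g@_(shifted_mnm l) *: alternant (shifted l).
Proof.
move=> gsym.
(* Truncated subtraction may send other exponents to spurious partitions. They are harmless, since
   each [l] in [r] enters with its true coefficient. *)
pose f (u : 'X_{1..m}) : option (bounded_partition m) :=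
  insub [tuple (u i - staircase i)%N | i < m].
have fK l : f (shifted_mnm l) = Some l.
  rewrite /f; suff -> : [tuple (shifted_mnm l i - staircase i)%N | i < m] = val l by rewrite valK.
  by apply: eq_from_tnth => i; rewrite tnth_mktuple mnmE addnK.
pose r := undup (pmap f (msupp g)).
have r0 l : l \notin r -> g@_(shifted_mnm l) = 0.
  move=> lr; apply/eqP; rewrite mcoeff_eq0; apply: contra lr => ls.
  by rewrite mem_undup mem_pmap; apply/mapP; exists (shifted_mnm l).
exists r; first by split; rewrite ?undup_uniq.
apply/eqP; rewrite -subr_eq0; apply/eqP/antisymmetric_eq0 => [s|l].
  rewrite msymB gsym scalerBr; congr (_ - _).
  rewrite scaler_sumr (raddf_sum (msym s)); apply: eq_bigr => l _ /=.
  by rewrite msymZ antisymmetric_alternant !scalerA mulrC.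
rewrite mcoeffB raddf_sum /=.
have [lr|lr] := boolP (l \in r).
  rewrite (big_rem l) //= mcoeffZ coef_alternant_shifted eqxx mulr1 big_seq big1 ?addr0 ?subrr //
    => l'.
  by rewrite mem_rem_uniq ?undup_uniq // inE => /andP[/negPf neq _];
    rewrite mcoeffZ coef_alternant_shifted neq mulr0.
rewrite r0 // big_seq big1 ?subrr // => l' l'r; rewrite mcoeffZ coef_alternant_shifted.
by case: eqP lr => [<-|]; rewrite ?l'r ?mulr0.
Qed.

(** Multiplication by the alternant of [delta] turns Schur polynomials into alternants, each
    detected by its exponent [l + delta]. *)
Lemma symmetric_expansion (m : nat) (p : {mpoly int[m]}) : p \is symmetric ->
  schur_expansion p (fun l => (p * alternant (@staircase m))@_(shifted_mnm l)).
Proof.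
move=> psym; have gsym := antisymmetric_symM psym (antisymmetric_alternant (@staircase m)).
have [r r_uniq gE] := alternant_expansion gsym; exists r => //.
apply: (mulIf (alternant_staircase_neq0 m)); rewrite {1}gE mulr_suml; apply: eq_bigr => l _.
by rewrite -scalerAl schur_alternant.
Qed.

Lemma horner_mpolyX (m : nat) (R : comNzRingType) (f : {poly R}) (i : 'I_m) (N : nat) :
  (size f <= N)%N ->
  (map_poly (@mpolyC m R) f).['X_i] = \sum_(e < N) f`_e *: 'X_i ^+ e.
Proof.
move=> sf; rewrite (@horner_coef_wide _ N); last by rewrite (leq_trans (size_poly _ _)).
by apply: eq_bigr => e _; rewrite coef_map mul_mpolyC.
Qed.

Lemma coef_prod_at_vars (m : nat) (R : comNzRingType) (f : 'I_m -> {poly R}) (u : 'X_{1..m}) :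
  (\prod_i (map_poly (@mpolyC m R) (f i)).['X_i])@_u = \prod_i (f i)`_(u i).
Proof.
pose N := (\max_i (size (f i)) + \max_i (u i).+1)%N.
have sf i : (size (f i) <= N)%N.
  exact: leq_trans (leq_bigmax (F := fun i => size (f i)) i) (leq_addr _ _).
have su i : (u i < N)%N.
  exact: leq_trans (leq_bigmax (F := fun i => (u i).+1) i) (leq_addl _ _).
rewrite (eq_bigr _ (fun i _ => horner_mpolyX i (sf i))) bigA_distr_bigA raddf_sum /=.
have termE (t : {ffun 'I_m -> 'I_N}) : (\prod_i ((f i)`_(t i) *: ('X_i : {mpoly R[m]}) ^+ t i))@_u =
    (\prod_i (f i)`_(t i)) * ([multinom val (t i) | i < m] == u)%:R.
  rewrite scaler_prod mcoeffZ -mcoeffX mpolyXE_id; congr (_ * _@_u).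
  by apply: eq_bigr => i _; rewrite mnmE.
rewrite (eq_bigr _ (fun t _ => termE t)) (bigD1 [ffun i => Ordinal (su i)]) //=.
rewrite [X in _ + X]big1 ?addr0 => [|t neqt].
  have -> : [multinom val ([ffun i => Ordinal (su i)] i) | i < m] = u.
    by apply/mnmP => i; rewrite mnmE ffunE.
  by rewrite eqxx mulr1; apply: eq_bigr => i _; rewrite ffunE.
case: eqP => [tu|]; last by rewrite mulr0.
by case/eqP: neqt; apply/ffunP => i; apply: val_inj; rewrite ffunE /= -tu mnmE.
Qed.

Lemma coef_prod_alternant (m : nat) (f : {poly int}) (u : 'X_{1..m}) (a : 'I_m -> nat) :
  ((\prod_(i < m) (map_poly (@mpolyC m int) f).['X_i]) * alternant a)@_u =
  \det (\matrix_(i < m, j < m) ('X^(a j) * f)`_(u i)).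
Proof.
rewrite /alternant /determinant mulr_sumr raddf_sum; apply: eq_bigr => s _ /=.
rewrite mulrCA (_ : (-1) ^+ s = ((-1) ^+ s : int)%:MP); last by rewrite rmorphXn rmorphN1.
rewrite mul_mpolyC mcoeffZ; congr (_ * _).
rewrite -big_split /=.
have -> : \prod_i ((map_poly (@mpolyC m int) f).['X_i] * (\matrix_(i, j) ('X_i ^+ a j :
  {mpoly int[m]})) i (s i)) =
    \prod_i (map_poly (@mpolyC m int) ('X^(a (s i)) * f)).['X_i].
  apply: eq_bigr => i _; rewrite rmorphM /= map_polyXn hornerM hornerXn mxE; exact: mulrC.
by rewrite (coef_prod_at_vars (fun i => 'X^(a (s i)) * f)); apply: eq_bigr => i _; rewrite mxE.
Qed.

Lemma symmetric_prod_at_vars (m : nat) (R : comNzRingType) (f : {poly R}) :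
  \prod_(i < m) (map_poly (@mpolyC m R) f).['X_i] \is symmetric.
Proof.
apply/issymP => s; rewrite rmorph_prod [RHS](reindex_inj (@perm_inj _ s)); apply: eq_bigr => i _ /=.
rewrite !(@horner_mpolyX _ _ _ _ (size f)) // raddf_sum; apply: eq_bigr => e _ /=.
by rewrite msymZ rmorphXn /= /msym mmapX mmap1U.
Qed.

Lemma prod_at_vars_powE (m : nat) (q : {poly int}) (n : nat) :
  prod_at_vars_pow m q n = \prod_(i < m) (map_poly (@mpolyC m int) (q ^+ n)).['X_i].
Proof. by apply: eq_bigr => i _; rewrite rmorphXn horner_exp. Qed.

(** The polynomials [X^j (1 + X)^(q-1-j)] have lowest term [X^j] and degree [q - 1], so they are a
    unitriangular change of the basis of monomials. The rows are arbitrary because the change serves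
    both the full minor and the consecutive ones. *)
Lemma det_change_columns (R : comNzRingType) (q : nat) (F : {poly R}) (l : nat -> nat) :
  \det (\matrix_(i < q, j < q) ('X^j * ((1 + 'X) ^+ (q.-1 - j) * F))`_(l i)) =
  \det (\matrix_(i < q, j < q) ('X^j * F)`_(l i)).
Proof.
pose U : 'M[R]_q := \matrix_(t, j) ('X^j * (1 + 'X) ^+ (q.-1 - j))`_t.
have coef0_1DX e : ((1 + 'X : {poly R}) ^+ e)`_0 = 1.
  by rewrite -horner_coef0 horner_exp !hornerE expr1n.
have detU : \det U = 1.
  rewrite det_trig.
    by rewrite big1 // => j _; rewrite mxE coefXnM ltnn subnn coef0_1DX.
  by apply/is_trig_mxP => t j lttj; rewrite mxE coefXnM lttj.
rewrite -[RHS]mulr1 -detU -det_mulmx; congr (\det _); apply/matrixP => i j; rewrite !mxE.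
rewrite mulrA; set p := 'X^j * _.
have sz : (size p <= q)%N.
  rewrite (leq_trans (size_polyMleq _ _)) // size_polyXn addSn /=.
  have := size_poly_exp_leq (1 + 'X : {poly R}) (q.-1 - j).
  have -> : size (1 + 'X : {poly R}) = 2%N by rewrite addrC size_XaddC.
  by rewrite mul1n; move: (size _) (ltn_ord j) => z; lia.
have pE : p = \sum_(t < q) p`_t *: 'X^t.
  rewrite -poly_def; apply/polyP => t; rewrite coef_poly; case: ltnP => // leqt.
  by rewrite nth_default // (leq_trans sz).
rewrite {1}pE mulr_suml coef_sum; apply: eq_bigr => t _.
by rewrite !mxE -/p -scalerAl coefZ mulrC.
Qed.

Lemma minors_cprod_ge0 (ks : seq nat) (m : nat) : 1%N \in ks ->
  exists n0 : nat, forall (n : nat) (l : nat -> nat), (n0 <= n)%N ->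
    (forall i j, (i < j < m)%N -> (l i < l j)%N) ->
    0 <= \det (\matrix_(i < m, j < m) ('X^j * cprod RR ks ^+ n)`_(l i)).
Proof.
move=> ks1; have [n0 n0P] := toeplitz_gt0 m ks1; exists n0 => n l len l_incr.
pose N := (m + n * sumn ks)%N; pose F := cprod RR ks ^+ n.
have sF : (size F <= (n * sumn ks).+1)%N.
  by have := size_cprod RR (copies ks n 0); rewrite cprod_copies expr0 mul1r sumn_copies.
(* Rows from [N] on vanish, since [N] exceeds the degree of every column; this is why the minors are
   only nonnegative. *)
have [/forallP l_lt|] := boolP [forall i : 'I_m, l i < N]%N; last first.
  rewrite negb_forall => /existsP[x]; rewrite -leqNgt => leNl.
  rewrite (expand_det_row _ x) big1 // => j _; rewrite mxE coefXnM; case: ifP => _;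
    rewrite ?mul0r //.
  rewrite nth_default ?mul0r // (leq_trans sF) // -/F.
  by have := ltn_ord j; rewrite /N in leNl; lia.
rewrite -(det_change_columns m F l); apply/ltW.
pose a (j x : nat) : RR := ('X^j * ((1 + 'X) ^+ (m.-1 - j) * F))`_x.
apply: (@minors_gt0 _ m N a) => //; last first.
  by move=> i ltim; apply: (l_lt (Ordinal ltim)).
move=> q x leqm lexN.
(* As [(m-1-j) = (q-1-j) + (m-q)], the first [q] modified columns for [F] are those of order [q] for
   [(1 + X)^(m-q) F]. *)
have := n0P q x n leqm len; rewrite (_ : (x <= _)%N); last by rewrite /N in lexN; lia.
move=> /(_ isT); rewrite /toeplitz -(det_change_columns q ((1 + 'X) ^+ (m - q) * F) (fun i =>
  (x + i)%N)).
set A := \matrix_(_, _) _; set B := \matrix_(_, _) _; suff -> : A = B by [].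
apply/matrixP => i j; rewrite !mxE /a [(1 + 'X) ^+ (q.-1 - j) * (_ * _)]mulrA -exprD.
congr ('X^_ * ((1 + 'X) ^+ _ * _))`__.
by have := ltn_ord j; lia.
Qed.

Lemma schur_nonneg_prod (ks : seq nat) (m : nat) : 1%N \in ks ->
  exists n0 : nat, forall n : nat, (n0 <= n)%N ->
    schur_nonneg (prod_at_vars_pow m (cprod int ks) n).
Proof.
move=> ks1; have [n0 n0P] := minors_cprod_ge0 m ks1; exists n0 => n len.
rewrite prod_at_vars_powE.
eexists; first exact: symmetric_expansion (symmetric_prod_at_vars m (cprod int ks ^+ n)).
move=> l /=; rewrite coef_prod_alternant.
pose u i := if insub i is Some i' then shifted l (rev_ord i') else 0%N : nat.
have uE (i : 'I_m) : u i = shifted l (rev_ord i) by rewrite /u valK.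
have := n0P n u len; set D := \det _ => D_ge0.
have {D_ge0} : 0 <= D.
  apply: D_ge0 => i j /andP[ltij ltjm].
  rewrite (uE (Ordinal (ltn_trans ltij ltjm))) (uE (Ordinal ltjm)); apply: shifted_decr => /=; lia.
(* Fekete's rows increase while [shifted] decreases; reversing rows and columns together leaves the
   determinant unchanged. *)
pose s := perm (@rev_ord_inj m).
set A := \matrix_(_, _) _; rewrite -(ler0z RR).
suff -> : (\det A)%:~R = D by [].
have -> : \det A = \det (row_perm s (col_perm s A)).
  rewrite row_permE col_permE !det_mulmx !det_perm ?odd_permV mulrCA.
  by rewrite -expr2 sqrr_sign mulr1.
rewrite -det_map_mx; congr (\det _); apply/matrixP => i j; rewrite !mxE !permE mnmE uE.
rewrite -(coef_map (intr : int -> RR)) rmorphM !rmorphXn /= map_polyX /staircase /=.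
congr (('X^_ * (_ ^+ n))`_ _); first by have := ltn_ord j; lia.
by rewrite /cprod rmorph_prod; apply: eq_bigr => e _; rewrite rmorphD rmorph1 /= map_polyXn.
Qed.

(** * Frobenius' formula *)

(** The series [1 / (1 - y X)] cut off at degree [N], so that generating functions stay
    polynomials. *)
Definition geom (R : nzRingType) (N : nat) (y : R) : {poly R} := \poly_(e < N) y ^+ e.

(* The complete homogeneous symmetric polynomial of degree n; junk for n >= N. *)
Definition hsym (R : comNzRingType) (m N : nat) (y : 'I_m -> R) (n : nat) : R :=
  (\prod_i geom N (y i))`_n.

Lemma geomE (R : comNzRingType) (N : nat) (y : R) :
  (1 - y%:P * 'X) * geom N y = 1 - 'X^N * (y ^+ N)%:P.
Proof.
have -> : geom N y = \sum_(e < N) (y%:P * 'X) ^+ e.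
  by rewrite /geom poly_def; apply: eq_bigr => e _; rewrite exprMn -rmorphXn mul_polyC.
by rewrite -[LHS]opprK -mulNr opprB -subrX1 opprB exprMn -rmorphXn mulrC.
Qed.

Lemma prod_1subXn (R : comNzRingType) (I : finType) (P : pred I) (N : nat) (c : I -> {poly R}) :
  exists s, \prod_(i | P i) (1 - 'X^N * c i) = 1 + 'X^N * s.
Proof.
elim/big_rec: _ => [|i _ _ [s ->]]; first by exists 0; rewrite mulr0 addr0.
exists (s - c i * (1 + 'X^N * s)); ring.
Qed.

Lemma hsym_dual (R : comNzRingType) (m N : nat) (y : 'I_m -> R) (k : 'I_m) (a : nat) : (a < N)%N ->
  ((\prod_(i | i != k) (1 - (y i)%:P * 'X)) * \prod_i geom N (y i))`_a = y k ^+ a.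
Proof.
move=> ltaN; rewrite [X in _ * X](bigD1 k) //= mulrCA -big_split /=.
have [s sE] := prod_1subXn (fun i => i != k) N (fun i => (y i ^+ N)%:P).
rewrite (eq_bigr _ (fun i _ => geomE N (y i))) sE mulrDr mulr1 mulrCA coefD coefXnM ltaN addr0.
by rewrite coef_poly ltaN.
Qed.

Lemma size_prod_1subX (R : comNzRingType) (m : nat) (y : 'I_m -> R) (k : 'I_m) :
  (size (\prod_(i | i != k) (1 - (y i)%:P * 'X))%R <= m)%N.
Proof.
have sz (i : 'I_m) : (size (1 - (y i)%:P * 'X)%R <= 2)%N.
  rewrite (leq_trans (size_polyD _ _)) // size_polyN size_poly1 geq_max /=.
  by rewrite mul_polyC (leq_trans (size_scale_leq _ _)) // size_polyX.
have : (size (\prod_(i | i != k) (1 - (y i)%:P * 'X))%R <= #|[pred i | i != k]|.+1)%N.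
  rewrite -sum1_card; elim/big_rec2: _ => [|i n p _ IH]; first by rewrite size_poly1.
  rewrite (leq_trans (size_polyMleq _ _)) //; have := sz i; move: (size _) => t; lia.
by rewrite (cardC1 k) card_ord prednK // (leq_ltn_trans _ (ltn_ord k)).
Qed.

Definition hsym_sub (R : comNzRingType) (m N : nat) (y : 'I_m -> R) (n a : nat) : R :=
  if (a <= n)%N then hsym N y (n - a) else 0.

(** The matrix of powers is [E] times a matrix of complete symmetric polynomials, with [E]
    independent of the exponents. For the exponents [delta] the second factor is unitriangular,
    which identifies [\det E]. *)
Lemma jacobi_trudi (R : comNzRingType) (m N : nat) (y : 'I_m -> R) (l : 'I_m -> nat) :
  (m <= N)%N -> (forall i, l i < N)%N ->
  \det (\matrix_(i, j) y i ^+ l j) =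
  \det (\matrix_(i, j) y i ^+ staircase j) *
  \det (\matrix_(i < m, j < m) hsym_sub N y (l j) (staircase i)).
Proof.
move=> lemN.
pose E : 'M[R]_m := \matrix_(k, j) (\prod_(i | i != k) (1 - (y i)%:P * 'X))`_(staircase j).
have VE (l' : 'I_m -> nat) : (forall i, l' i < N)%N -> \matrix_(i, j) y i ^+ l' j =
    E *m \matrix_(i, j) hsym_sub N y (l' j) (staircase i).
  move=> ltl; apply/matrixP => k j; rewrite !mxE -(hsym_dual y k (ltl j)).
  set p := \prod_(i | _) _; set H := \prod_i _.
  have pE : p = \sum_(t < m) p`_t *: 'X^t.
    rewrite -poly_def; apply/polyP => t; rewrite coef_poly; case: ltnP => // lemt.
    by rewrite nth_default // (leq_trans (size_prod_1subX y k)).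
  rewrite {1}pE mulr_suml coef_sum (reindex_inj rev_ord_inj); apply: eq_bigr => t _.
  rewrite !mxE -/p -scalerAl coefZ coefXnM /staircase /hsym_sub /hsym -/H /= ltnNge.
  by case: leqP.
have stairN i : (@staircase m i < N)%N by rewrite /staircase; have := ltn_ord i; lia.
have detH : \det (\matrix_(i < m, j < m) hsym_sub N y (staircase j) (staircase i)) = 1.
  rewrite det_trig.
    rewrite big1 // => i _; rewrite mxE /hsym_sub leqnn subnn /hsym -horner_coef0 horner_prod.
    rewrite big1 // => j _; rewrite horner_coef0 coef_poly expr0.
    by rewrite (leq_ltn_trans _ (stairN i)).
  apply/is_trig_mxP => i j ltij; rewrite mxE /hsym_sub /staircase.
  by rewrite (_ : (_ <= _)%N = false) //; have := ltn_ord j; lia.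
by move=> ltl; rewrite (VE l ltl) (VE _ stairN) !det_mulmx detH mulr1.
Qed.

(** * Words, permutation characters and power sums *)

Definition fcomp_perm (T : Type) (d : nat) (f : {ffun 'I_d -> T}) (s : 'S_d) : {ffun 'I_d -> T} :=
  [ffun i => f (s i)].

Definition fcontent (T : eqType) (d : nat) (f : {ffun 'I_d -> T}) (x : T) : nat :=
  #|[pred i | f i == x]|.

(* The power sum of the cycle type of s. *)
Definition psum_perm (R : comNzRingType) (m d : nat) (y : 'I_m -> R) (s : 'S_d) : R :=
  \sum_(f : {ffun 'I_d -> 'I_m} | fcomp_perm f s == f) \prod_i y (f i).

(** The permutation character on the words of content [a]: the trivial character induced from a
    Young subgroup if the [a i] sum to [d], and 0 otherwise. *)
Definition content_char (m d : nat) (a : 'I_m -> nat) (s : 'S_d) : nat :=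
  #|[pred f : {ffun 'I_d -> 'I_m} | (fcomp_perm f s == f) && [forall i, fcontent f i == a i]]|.

Lemma fcomp_permM (T : Type) (d : nat) (f : {ffun 'I_d -> T}) (s t : 'S_d) :
  fcomp_perm f (s * t)%g = fcomp_perm (fcomp_perm f t) s.
Proof. by apply/ffunP => i; rewrite !ffunE permM. Qed.

Lemma fcomp_perm1 (T : Type) (d : nat) (f : {ffun 'I_d -> T}) : fcomp_perm f 1%g = f.
Proof. by apply/ffunP => i; rewrite ffunE perm1. Qed.

Lemma fcontent_perm (T : eqType) (d : nat) (f : {ffun 'I_d -> T}) (s : 'S_d) :
  fcontent (fcomp_perm f s) =1 fcontent f.
Proof.
move=> x; rewrite /fcontent -[RHS](card_imset _ (@perm_inj _ s^-1%g)).
apply: eq_card => i; rewrite !inE ffunE; apply/idP/imsetP => [fi|[j]].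
  by exists (s i); rewrite ?inE ?permK.
by rewrite inE => fj ->; rewrite permKV.
Qed.

Lemma fcontent_count (T : eqType) (d : nat) (f : {ffun 'I_d -> T}) (x : T) :
  fcontent f x = count_mem x [seq f i | i <- enum 'I_d].
Proof.
by rewrite /fcontent count_map -sum1_count big_enum_cond sum1_card; apply: eq_card.
Qed.

Lemma fcontent_transitive (T : eqType) (d : nat) (f g : {ffun 'I_d -> T}) :
  fcontent f =1 fcontent g -> exists s : 'S_d, g = fcomp_perm f s.
Proof.
move=> e.
pose tf := [tuple f i | i < d]; pose tg := [tuple g i | i < d].
have : perm_eq tg tf.
  apply/allP => x _ /=; rewrite -!fcontent_count; exact/eqP/esym/e.
case/tuple_permP => s sE; exists s; apply/ffunP => i; rewrite ffunE.
have -> : f (s i) = tnth [tuple tnth tf (s j) | j < d] i by rewrite !tnth_mktuple.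
have -> : g i = tnth tg i by rewrite tnth_mktuple.
by congr (tnth _ i); apply: val_inj.
Qed.

Lemma fcontent_exists (T : finType) (d : nat) (a : T -> nat) : (\sum_x a x = d)%N ->
  exists f : {ffun 'I_d -> T}, fcontent f =1 a.
Proof.
move=> sum_a; pose s := flatten [seq nseq (a x) x | x <- enum T].
have size_s : size s == d.
  by rewrite size_flatten /shape -map_comp sumnE big_map big_enum -sum_a;
    apply/eqP/eq_bigr => x _; rewrite /= size_nseq.
exists [ffun i => tnth (Tuple size_s) i] => x; rewrite fcontent_count.
have -> : [seq [ffun i => tnth (Tuple size_s) i] i | i <- enum 'I_d] = s.
  transitivity [seq tnth (Tuple size_s) i | i <- enum 'I_d]; last exact: map_tnth_enum.
  by apply: eq_map => i; rewrite ffunE.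
rewrite /s count_flatten -map_comp sumnE big_map big_enum (bigD1 x) //= count_nseq /= eqxx mul1n.
by rewrite big1 ?addn0 // => z /negPf neq; rewrite count_nseq /= neq.
Qed.

(* Orbit-stabilizer. *)
Lemma sum_stab_content (T : finType) (d : nat) (a : T -> nat) : (\sum_x a x = d)%N ->
  (\sum_(f : {ffun 'I_d -> T} | [forall x, fcontent f x == a x])
     #|[pred s : 'S_d | fcomp_perm f s == f]| = d`!)%N.
Proof.
move=> /fcontent_exists [f0 f0a].
rewrite -[RHS]card_Sn -[RHS]sum1_card.
rewrite [RHS](partition_big (fun s : 'S_d => fcomp_perm f0 s)
  (fun f : {ffun 'I_d -> T} => [forall x, fcontent f x == a x])) /=; last first.
  by move=> s _; apply/forallP => x; rewrite fcontent_perm f0a.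
apply: eq_bigr => f /forallP fa.
have [s0 fE] : exists s0, f = fcomp_perm f0 s0.
  by apply: fcontent_transitive => x; rewrite f0a; exact/esym/eqP/fa.
rewrite sum1_card -[LHS](card_imset _ (@mulIg _ s0)).
apply: eq_card => s; rewrite [RHS](_ : _ = (fcomp_perm f0 s == f)) //; apply/imsetP/eqP => [[t]|ts].
  by rewrite inE => /eqP ft ->; rewrite fcomp_permM -fE ft.
exists (s * s0^-1)%g; last by rewrite mulgKV.
by rewrite inE {1}fE -fcomp_permM mulgKV ts.
Qed.

Lemma hsymE (R : comNzRingType) (m N : nat) (y : 'I_m -> R) (n : nat) :
  hsym N y n = \sum_(r : {ffun 'I_m -> 'I_N} | (\sum_j r j == n)%N) \prod_j y j ^+ r j.
Proof.
have gE i : geom N (y i) = \sum_(e < N) y i ^+ e *: 'X^e by rewrite /geom poly_def.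
rewrite /hsym (eq_bigr _ (fun i _ => gE i)) bigA_distr_bigA coef_sum [RHS]big_mkcond.
apply: eq_bigr => r _; rewrite scaler_prod coefZ.
have -> : \prod_i ('X^(r i) : {poly R}) = 'X^(\sum_i r i)%N.
  by elim/big_rec2: _ => [|i e p _ ->]; rewrite ?expr0 // exprD.
by rewrite coefXn eq_sym; case: eqP => _; rewrite ?mulr1 ?mulr0.
Qed.

Lemma prod_fcontent (R : comNzRingType) (T : finType) (d : nat) (y : T -> R) (f : {ffun 'I_d ->
  T}) :
  \prod_i y (f i) = \prod_x y x ^+ fcontent f x.
Proof.
rewrite (partition_big f xpredT) //=; apply: eq_bigr => x _.
rewrite (eq_bigr (fun=> y x)) => [|i /eqP->//].
by rewrite prodr_const; congr (_ ^+ _); apply: eq_card.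
Qed.

Lemma fcontent_le (T : eqType) (d : nat) (f : {ffun 'I_d -> T}) (x : T) : (fcontent f x <= d)%N.
Proof. by rewrite -[X in (_ <= X)%N](card_ord d) max_card. Qed.

Definition ffst (m d : nat) (F : {ffun 'I_d -> 'I_m * 'I_m}) : {ffun 'I_d -> 'I_m} := [ffun i =>
  (F i).1].
Definition fsnd (m d : nat) (F : {ffun 'I_d -> 'I_m * 'I_m}) : {ffun 'I_d -> 'I_m} := [ffun i =>
  (F i).2].

Lemma ffstE (m d : nat) (F : {ffun 'I_d -> 'I_m * 'I_m}) i : ffst F i = (F i).1.
Proof. by rewrite ffunE. Qed.

Lemma fsndE (m d : nat) (F : {ffun 'I_d -> 'I_m * 'I_m}) i : fsnd F i = (F i).2.
Proof. by rewrite ffunE. Qed.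

Lemma fcontent_ffst (m d : nat) (F : {ffun 'I_d -> 'I_m * 'I_m}) (i : 'I_m) :
  fcontent (ffst F) i = (\sum_j fcontent F (i, j))%N.
Proof.
rewrite /fcontent -sum1_card (partition_big (fun k => (F k).2) xpredT) //=.
apply: eq_bigr => j _; rewrite sum1_card; apply: eq_card => k.
rewrite inE [LHS](_ : _ = (ffst F k == i) && ((F k).2 == j)) // ffstE.
by case: (F k) => u v; rewrite xpair_eqE.
Qed.

(** Two words fixed by [s] form one word of pairs fixed by [s]. Its content is a matrix with row
    sums [a]; by orbit-stabilizer each matrix counts [d!] times, and the monomials of these matrices
    expand the product of the complete symmetric polynomials. *)
Lemma sum_content_char (R : comNzRingType) (m d N : nat) (y : 'I_m -> R) (a : 'I_m -> nat) :
  (d < N)%N -> (\sum_i a i = d)%N ->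
  \sum_(s : 'S_d) (content_char a s)%:R * psum_perm y s = d`!%:R * \prod_i hsym N y (a i).
Proof.
move=> ltdN sum_a.
pose w (F : {ffun 'I_d -> 'I_m * 'I_m}) := \prod_i y (F i).2.
pose P (F : {ffun 'I_d -> 'I_m * 'I_m}) := [forall i, fcontent (ffst F) i == a i].
have step1 (s : 'S_d) : (content_char a s)%:R * psum_perm y s =
    \sum_(F | P F && (fcomp_perm F s == F)) w F.
  rewrite /content_char /psum_perm -sum1_card natr_sum mulr_suml.
  under eq_bigr do rewrite mul1r.
  rewrite pair_big /= (reindex (fun F : {ffun 'I_d -> 'I_m * 'I_m} => (ffst F, fsnd F))) /=;
    last first.
    exists (fun p : {ffun 'I_d -> 'I_m} * {ffun 'I_d -> 'I_m} => [ffun i => (p.1 i, p.2 i)]) =>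
      [F|[f g]] _.
      by apply/ffunP => i; rewrite ffunE ffstE fsndE -surjective_pairing.
    by congr pair; apply/ffunP => i; rewrite (ffstE, fsndE) ffunE.
  apply: eq_big => [F|F _]; last by apply: eq_bigr => i _; rewrite fsndE.
  rewrite inE -andbA andbC -andbA; congr (_ && _); apply/andP/eqP => [[/eqP e2 /eqP e1]|e].
    apply/ffunP => i; rewrite ffunE [F i]surjective_pairing [F (s i)]surjective_pairing.
    by move/ffunP/(_ i): e1; move/ffunP/(_ i): e2; rewrite !ffunE => -> ->.
  by split; apply/eqP/ffunP => i; rewrite ffunE !(ffstE, fsndE) -[in RHS]e ffunE.
rewrite (eq_bigr _ (fun s _ => step1 s)) (exchange_big_dep P) /= => [|s F _ /andP[]//].
have step2 F : P F -> \sum_(s : 'S_d | P F && (fcomp_perm F s == F)) w F =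
    #|[pred s : 'S_d | fcomp_perm F s == F]|%:R * w F.
  by move=> PF; rewrite PF /= sumr_const mulr_natl.
rewrite (eq_bigr _ step2).
pose c (F : {ffun 'I_d -> 'I_m * 'I_m}) : {ffun 'I_m -> {ffun 'I_m -> 'I_N}} :=
  [ffun i => [ffun j => Ordinal (leq_ltn_trans (fcontent_le F (i, j)) ltdN)]].
have cE F i j : c F i j = fcontent F (i, j) :> nat by rewrite !ffunE.
pose Q (A : {ffun 'I_m -> {ffun 'I_m -> 'I_N}}) := [forall i, \sum_j A i j == a i]%N.
rewrite (partition_big c Q) /=; last first.
  move=> F /forallP PF; apply/forallP => i; rewrite -(eqP (PF i)) fcontent_ffst.
  by apply/eqP/eq_bigr => j _; rewrite cE.
rewrite (eq_bigr _ (fun i _ => hsymE N y (a i))) bigA_distr_big_dep /= mulr_sumr.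
apply: eq_big => [A|A /forallP QA].
  by apply/forallP/familyP => h i; apply: h.
have PQ F : P F && (c F == A) = [forall x, fcontent F x == A x.1 x.2].
  apply/andP/forallP => [[_ /eqP cA] [i j]|FA]; first by rewrite -cA cE.
  split; last by apply/eqP/ffunP => i; apply/ffunP => j; apply: val_inj; rewrite /= cE;
    apply/eqP: (FA (i, j)).
  apply/forallP => i; rewrite fcontent_ffst -(eqP (QA i)); apply/eqP/eq_bigr => j _.
  exact/eqP/(FA (i, j)).
rewrite (eq_bigl _ _ PQ).
have wE F : [forall x, fcontent F x == A x.1 x.2] -> w F = \prod_i \prod_j y j ^+ A i j.
  move=> /forallP FA; rewrite /w (prod_fcontent (fun x : 'I_m * 'I_m => y x.2)) pair_big /=.
  by apply: eq_bigr => x _; rewrite (eqP (FA x)).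
rewrite (eq_bigr (fun F => #|[pred s : 'S_d | fcomp_perm F s == F]|%:R * \prod_i \prod_j y j ^+ A i
  j)).
  rewrite -mulr_suml -natr_sum sum_stab_content // -(pair_bigA _ (fun i j => A i j : nat)) -sum_a.
  by apply: eq_bigr => i _; apply/eqP.
by move=> F /wE ->.
Qed.

(** Excludes the terms of the Jacobi-Trudi expansion with a negative index, which truncated
    subtraction would turn into index 0. *)
Definition valid_shift (m : nat) (l : 'I_m -> nat) (t : 'S_m) : bool :=
  [forall i, staircase (t i) <= l i]%N.

(* The Frobenius formula: the coefficient of x^l in a_delta p_s. *)
Definition frobenius_char (m d : nat) (l : 'I_m -> nat) (s : 'S_d) : int :=
  \sum_(t : 'S_m | valid_shift l t) (-1) ^+ t *
    (content_char (fun i => l i - staircase (t i))%N s)%:R.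

Definition part_size (m : nat) (l : bounded_partition m) : nat := (\sum_i tnth (val l) i)%N.

Lemma sum_shift (m : nat) (l : bounded_partition m) (t : 'S_m) : valid_shift (shifted l) t ->
  (\sum_i (shifted l i - staircase (t i)) = part_size l)%N.
Proof.
move=> /forallP tl; apply: (@addIn (\sum_i staircase (t i))); rewrite -big_split /=.
rewrite (eq_bigr _ (fun i _ => subnK (tl i))) /shifted big_split /=; congr addn.
by rewrite [LHS](reindex_inj (@perm_inj _ t)).
Qed.

Lemma sum_frobenius_char (m : nat) (l : bounded_partition m) :
  \sum_(s : 'S_(part_size l)) (frobenius_char (shifted l) s)%:MP * psum_perm (fun i => 'X_i :
    {mpoly int[m]}) s =
  (part_size l)`!%:R * schur l.
Proof.
set d := part_size l; pose N := (d + m).+1; pose y i : {mpoly int[m]} := 'X_i.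
have lN i : (shifted l i < N)%N.
  rewrite /shifted /N ltnS leq_add //; first by rewrite /d /part_size (bigD1 i) //= leq_addr.
  by rewrite /staircase leq_subr.
have ltdN : (d < N)%N by rewrite /N ltnS leq_addr.
have lemN : (m <= N)%N by rewrite /N leqW ?leq_addl.
have jt := jacobi_trudi y lemN lN.
have -> : schur l = \det (\matrix_(i < m, j < m) hsym_sub N y (shifted l j) (staircase i)).
  by apply/eqP; rewrite schurE mulrC -jt.
rewrite -det_tr /determinant mulr_sumr.
transitivity (\sum_(t : 'S_m | valid_shift (shifted l) t) (-1) ^+ t *
    (d`!%:R * \prod_i hsym N y (shifted l i - staircase (t i)))).
  rewrite (eq_bigr (fun s : 'S_d => \sum_(t : 'S_m | valid_shift (shifted l) t) (-1) ^+ t *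
      ((content_char (fun i => shifted l i - staircase (t i))%N s)%:R * psum_perm y s))).
    rewrite exchange_big; apply: eq_bigr => t tl; rewrite -mulr_sumr.
    by rewrite (sum_content_char y ltdN (sum_shift tl)).
  move=> s _; rewrite /frobenius_char rmorph_sum mulr_suml; apply: eq_bigr => t _.
  by rewrite rmorphM rmorphXn rmorphN1 rmorph_nat mulrA.
rewrite big_mkcond; apply: eq_bigr => t _; rewrite mulrCA.
case: ifP => [/forallP tl|/negbT].
  by congr (_ * (_ * _)); apply: eq_bigr => i _; rewrite !mxE /hsym_sub tl.
rewrite negb_forall => /existsP[i /negPf ti].
by rewrite (bigD1 i) //= !mxE /hsym_sub ti mul0r !mulr0.
Qed.

Lemma psum_permE (m d : nat) (s : 'S_d) : psum_perm (fun i => 'X_i : {mpoly int[m]}) s =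
  \sum_(f : {ffun 'I_d -> 'I_m} | fcomp_perm f s == f) 'X_[[multinom fcontent f i | i < m]].
Proof.
apply: eq_bigr => f _; rewrite (prod_fcontent (fun i => 'X_i : {mpoly int[m]}) f) mpolyXE_id.
by apply: eq_bigr => i _; rewrite mnmE.
Qed.

Lemma alternantE (m : nat) (a : 'I_m -> nat) :
  alternant a = \sum_(t : 'S_m) (-1) ^+ t * 'X_[[multinom a (t i) | i < m]].
Proof.
apply: eq_bigr => t _; congr (_ * _); rewrite mpolyXE_id.
by apply: eq_bigr => i _; rewrite mxE mnmE.
Qed.

Lemma frobenius_charE (m d : nat) (l : bounded_partition m) (s : 'S_d) :
  frobenius_char (shifted l) s =
  (psum_perm (fun i => 'X_i : {mpoly int[m]}) s * alternant (@staircase m))@_(shifted_mnm l).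
Proof.
rewrite alternantE mulr_sumr raddf_sum /frobenius_char big_mkcond; apply: eq_bigr => t _ /=.
rewrite mulrCA (_ : (-1) ^+ t = ((-1) ^+ t : int)%:MP); last by rewrite rmorphXn rmorphN1.
rewrite mul_mpolyC mcoeffZ psum_permE mulr_suml raddf_sum /=.
have cE (f : {ffun 'I_d -> 'I_m}) : ('X_[[multinom fcontent f i | i < m]] *
    'X_[[multinom staircase (t i) | i < m]] : {mpoly int[m]})@_(shifted_mnm l) =
    (valid_shift (shifted l) t && [forall i, fcontent f i == shifted l i - staircase (t i)]%N)%:R.
  rewrite -mpolyXD mcoeffX; congr (nat_of_bool _)%:R.
  apply/eqP/andP => [/mnmP e|[/forallP tl /forallP fe]].
    have {}e i : (fcontent f i + staircase (t i) = shifted l i)%N by have := e i;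
      rewrite mnmDE !mnmE.
    by split; apply/forallP => i; rewrite -e ?leq_addl // addnK.
  by apply/mnmP => i; rewrite mnmDE !mnmE (eqP (fe i)) subnK.
rewrite (eq_bigr _ (fun f _ => cE f)); case: ifP => _; last by rewrite big1 ?mulr0.
congr (_ * _); rewrite -natr_sum /= /content_char -sum1_card; congr _%:R.
by rewrite [RHS]big_mkcond [LHS]big_mkcond /=; apply: eq_bigr => f _; rewrite inE;
  case: (_ == _) => //=; case: ifP.
Qed.

(** In the identity [\sum_s f(s) p_s a_delta = d! a_(l+delta)], the coefficient of [x^(l+delta)] in
    [p_s a_delta] is [f(s)] again, so comparing these coefficients gives the norm. *)
Lemma frobenius_norm (m : nat) (l : bounded_partition m) :
  \sum_(s : 'S_(part_size l)) frobenius_char (shifted l) s ^+ 2 = (part_size l)`!%:R.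
Proof.
have := congr1 (fun p => (p * alternant (@staircase m))@_(shifted_mnm l)) (sum_frobenius_char l).
rewrite mulr_suml raddf_sum /= -mulrA schur_alternant [X in _ = X@_ _]mulr_natl mcoeffMn.
rewrite coef_alternant_shifted eqxx => <-; apply: eq_bigr => s _.
by rewrite -mulrA mul_mpolyC mcoeffZ -frobenius_charE expr2.
Qed.

Lemma permutation_character (gT : finGroupType) (G : {group gT}) (T : finType)
    (act : T -> gT -> T) : (forall x, act x 1%g = x) ->
  (forall x s t, act x (s * t)%g = act (act x s) t) ->
  exists2 phi : 'CF(G), phi \is a character &
    {in G, forall s, phi s = #|[pred x | act x s == x]|%:R}.
Proof.
move=> act1 actM.
pose r s : 'M[algC]_#|T| := \matrix_(i, j) (act (enum_val i) s == enum_val j)%:R.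
have rP : mx_repr G r.
  split=> [|s t _ _]; first by apply/matrixP => i j; rewrite !mxE act1 (inj_eq enum_val_inj).
  apply/matrixP => i j; rewrite !mxE (bigD1 (enum_rank (act (enum_val i) s))) //= !mxE.
  rewrite enum_rankK eqxx mul1r actM big1 ?addr0 // => k neqk; rewrite !mxE.
  case: eqP => [e|]; last by rewrite mul0r.
  by case/eqP: neqk; rewrite e enum_valK.
exists (cfRepr (MxRepresentation rP)); first exact: cfRepr_char.
move=> s Gs; rewrite cfunE Gs mulr1n /mxtrace -[in RHS]sum1_card natr_sum.
rewrite [RHS]big_mkcond /= (reindex (@enum_val T T)) /=; last first.
  by exists enum_rank => x _; rewrite ?enum_valK ?enum_rankK.
by apply: eq_bigr => i _; rewrite mxE inE; case: ifP.
Qed.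

Lemma content_character (m d : nat) (a : 'I_m -> nat) :
  exists2 phi : 'CF([set: 'S_d]), phi \is a character &
    forall s, phi s = (content_char a s)%:R.
Proof.
pose P (f : {ffun 'I_d -> 'I_m}) := [forall i, fcontent f i == a i].
have actP (f : {f | P f}) (s : 'S_d) : P (fcomp_perm (val f) s^-1%g).
  by apply/forallP => i; rewrite fcontent_perm; have /forallP := valP f; exact.
pose act f s : {f | P f} := Sub (fcomp_perm (val f) s^-1%g) (actP f s).
have [f|f s t|phi phi_char phiE] := @permutation_character _ [set: 'S_d] _ act.
- by apply: val_inj; rewrite SubK invg1 fcomp_perm1.
- by apply: val_inj; rewrite !SubK invMg fcomp_permM.
exists phi => // s; rewrite phiE ?inE //; congr _%:R.
rewrite /content_char -(card_imset _ (@val_inj _ _ {f | P f})).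
apply: eq_card => f; rewrite [RHS]inE; apply/imsetP/andP => [[g]|[/eqP fs Pf]].
  rewrite inE => /eqP/(congr1 val); rewrite SubK => gs ->; split; last exact: (valP g).
  by rewrite -{1}gs -fcomp_permM mulgV fcomp_perm1.
exists (Sub f Pf : {f | P f}); last by rewrite SubK.
rewrite inE; apply/eqP/val_inj; rewrite !SubK.
by rewrite -{1}fs -fcomp_permM mulVg fcomp_perm1.
Qed.

(** For natural [y], this makes [p_s(y)] a nonnegative integral combination of permutation
    characters in [s]. *)
Lemma psum_perm_content (R : comNzRingType) (m d : nat) (y : 'I_m -> R) (s : 'S_d) :
  psum_perm y s = \sum_(a : {ffun 'I_m -> 'I_d.+1}) (content_char (fun i =>
    a i) s)%:R * \prod_i y i ^+ a i.
Proof.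
pose c (f : {ffun 'I_d -> 'I_m}) : {ffun 'I_m -> 'I_d.+1} :=
  [ffun i => Ordinal (fcontent_le f i : fcontent f i < d.+1)%N].
rewrite /psum_perm (partition_big c xpredT) //=; apply: eq_bigr => a _.
have cE f : (c f == a) = [forall i, fcontent f i == a i].
  apply/eqP/forallP => [<- i|h]; first by rewrite ffunE.
  by apply/ffunP => i; apply: val_inj; rewrite ffunE; exact/eqP/h.
rewrite /content_char -sum1_card natr_sum mulr_suml; apply: eq_big => [f|f /andP[_ /eqP cf]].
  by rewrite inE cE.
rewrite mul1r prod_fcontent; apply: eq_bigr => i _.
by rewrite -cf ffunE.
Qed.

(** At [y i = 2^(delta i)] an alternant is a Vandermonde determinant in the [2^(a j)], whose sign
    depends only on the order of the exponents. Hence the Schur polynomial is positive at a point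
    with natural coordinates. *)
Lemma alternant_eval_mul_gt0 (m : nat) (l : bounded_partition m) :
  0 < (alternant (shifted l)).@[fun i => 2 ^+ staircase i] *
      (alternant (@staircase m)).@[fun i => 2 ^+ staircase i].
Proof.
pose y (i : 'I_m) : int := 2 ^+ staircase i; rewrite -/y.
have evE (a : 'I_m -> nat) : (alternant a).@[y] = (-1) ^+ perm (@rev_ord_inj m) *
    \prod_(i < m) \prod_(j < m | (i < j)%N) (2 ^+ a j - 2 ^+ a i).
  have -> : (alternant a).@[y] = \det (row_perm (perm (@rev_ord_inj m)) (Vandermonde m (\row_j 2 ^+
    a j))).
    rewrite /alternant -det_map_mx; congr (\det _); apply/matrixP => i j.
    by rewrite !mxE permE rmorphXn /= mevalXU /y -!exprM mulnC.
  rewrite row_permE det_mulmx det_perm det_Vandermonde; congr (_ * _).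
  by apply: eq_bigr => i _; apply: eq_bigr => j _; rewrite !mxE.
rewrite !evE mulrACA -expr2 sqrr_sign mul1r -big_split /=.
apply: prodr_gt0 => i _; rewrite -big_split /=; apply: prodr_gt0 => j ltij.
rewrite nmulr_rgt0 subr_lt0 ltr_eXn2l // ?shifted_decr //.
by rewrite /staircase; have := ltn_ord j; lia.
Qed.

Lemma frobenius_irr (m : nat) (l : bounded_partition m) :
  exists i : Iirr [set: 'S_(part_size l)],
    forall s, 'chi_i s = (frobenius_char (shifted l) s)%:~R.
Proof.
set d := part_size l; pose G := [set: 'S_d]%G.
have piP (a : 'I_m -> nat) : exists2 phi : 'CF(G), phi \is a character & forall s, phi s =
  (content_char a s)%:R.
  exact: content_character.
have [phi phiV phiE] : exists2 phi : 'CF(G), phi \in 'Z[irr G]%g & forall s, phi s =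
  (frobenius_char (shifted l) s)%:~R.
  have [pi pi_char piE] := fin_all_exists2 (fun t : 'S_m => piP (fun i =>
    shifted l i - staircase (t i))%N).
  exists (\sum_(t : 'S_m | valid_shift (shifted l) t) (-1) ^+ t *: pi t) => [|s].
    by apply: rpred_sum => t _; rewrite rpredZsign char_vchar.
  rewrite sum_cfunE rmorph_sum; apply: eq_bigr => t _ /=.
  by rewrite cfunE piE rmorphM rmorphXn rmorphN1 /= rmorph_nat.
have cardG : #|G| = d`! by rewrite cardsT card_Sn.
have phi1 : '[phi] = 1.
  rewrite cfdotE cardG.
  have -> : \sum_(s in G) phi s * (phi s)^* = (d`!%:R : algC).
    rewrite -[RHS](rmorph_nat (intr : int -> algC)) -frobenius_norm rmorph_sum /=.
    rewrite (eq_bigl xpredT) => [|s]; last by rewrite inE.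
    by apply: eq_bigr => s _; rewrite phiE rmorphXn /= (CrealP _) // ?expr2 // realz.
  by rewrite mulVf // pnatr_eq0 -lt0n fact_gt0.
have [b [i phi_i]] := vchar_norm1P phiV phi1.
pose y (i : 'I_m) : nat := (2 ^ staircase i)%N.
have [psi psi_char psiE] : exists2 psi : 'CF(G), psi \is a character &
    forall s, psi s = (psum_perm (fun i => (y i)%:R : int) s)%:~R.
  have piP' (a : {ffun 'I_m -> 'I_d.+1}) := piP (fun i => a i).
  have [pi pi_char piE] := fin_all_exists2 piP'.
  exists (\sum_(a : {ffun 'I_m -> 'I_d.+1}) (\prod_i y i ^ a i)%:R *: pi a) => [|s].
    by apply: rpred_sum => a _; rewrite scaler_nat rpredMn.
  rewrite sum_cfunE psum_perm_content rmorph_sum; apply: eq_bigr => a _ /=.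
  rewrite cfunE piE rmorphM /= rmorph_nat mulrC natr_prod rmorph_prod; congr (_ * _).
  by apply: eq_bigr => j _; rewrite natrX rmorphXn /= rmorph_nat.
(* By Frobenius' formula this inner product is the value of the Schur polynomial at [y]; it rules
   out the sign -1. *)
have pos : 0 < '[phi, psi].
  have := congr1 (meval (fun i => (y i)%:R)) (sum_frobenius_char l).
  rewrite raddf_sum mevalM -/d => ev.
  have schur_gt0 : 0 < (schur l).@[fun i => (y i)%:R].
    have /= := alternant_eval_mul_gt0 l; rewrite -schur_alternant mevalM -mulrA -expr2.
    have -> : (schur l).@[fun i => (y i)%:R] = (schur l).@[fun i => 2 ^+ staircase i].
      by apply: meval_eq => j; rewrite natrX.
    set a := (alternant _).@[_] => h; have a2 : 0 < a ^+ 2.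
      by rewrite lt_def sqrf_eq0 sqr_ge0 andbT; apply: contraTN h => /eqP ->;
        rewrite expr0n mulr0 ltxx.
    by rewrite -(pmulr_lgt0 _ a2).
  rewrite cfdotE cardG.
  have -> : \sum_(s in G) phi s * (psi s)^* = (d`!%:R * (schur l).@[fun i => (y i)%:R])%:~R :> algC.
    have -> : d`!%:R * (schur l).@[fun i => (y i)%:R] = (d`!%:R : {mpoly int[m]}).@[fun i =>
      (y i)%:R] * (schur l).@[fun i => (y i)%:R].
      by rewrite rmorph_nat.
    rewrite -ev rmorph_sum (eq_bigl xpredT) => [|s]; last by rewrite inE.
    apply: eq_bigr => s _ /=; rewrite phiE psiE (CrealP _) ?realz // mevalM mevalC rmorphM /=.
    congr (_ * _%:~R); rewrite /psum_perm raddf_sum; apply: eq_bigr => f _ /=.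
    by rewrite rmorph_prod; apply: eq_bigr => j _; rewrite /= mevalXU.
  have d0 : d`!%:R != 0 :> algC by rewrite pnatr_eq0 -lt0n fact_gt0.
  by rewrite rmorphM /= rmorph_nat mulrA mulVf // mul1r ltr0z.
exists i => s; rewrite -phiE phi_i; case: b phi_i => [|_]; last by rewrite expr0 scale1r.
rewrite expr1 scaleN1r => phi_i; move: pos; rewrite phi_i cfdotNl oppr_gt0 => /lt_geF.
by rewrite natr_ge0 // Cnat_cfdot_char ?irr_char.
Qed.

(** * Representations of the unitary group *)

(* The entries of rG are rational polynomials in one algebraic number z; replace
   z by a root in C of its minimal polynomial. *)
Lemma algC_repr_transfer (C : numClosedFieldType) (gT : finGroupType) (G : {group gT}) (n : nat)
    (rG : mx_representation algC G n) :
  exists M : gT -> 'M[C]_n,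
    [/\ M 1%g = 1%:M, {in G &, forall s t, M (s * t)%g = M s *m M t}
      & forall s (c : int), \tr (rG s) = c%:~R -> \tr (M s) = c%:~R].
Proof.
pose entry (x : gT * 'I_n * 'I_n) := rG x.1.1 x.1.2 x.2.
have [z _ [ps psE]] := algC_PET [seq entry x | x <- enum {: gT * 'I_n * 'I_n}].
pose ev := map_poly (ratr : rat -> algC).
have [r [_ mon_r] dv_r] := minCpolyP z.
have r_size : size r != 1%N.
  by rewrite -dvdp1 -dv_r rmorph1 root1.
have /closed_rootP[w rw] : size (map_poly ratr r : {poly C}) != 1%N by rewrite size_map_poly.
(* A rational relation valid at [z] is divisible by the minimal polynomial, hence valid at [w]. *)
have transfer (p q : {poly rat}) : (ev p).[z] = (ev q).[z] ->
    (map_poly ratr p : {poly C}).[w] = (map_poly ratr q).[w].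
  move=> pq; have : r %| p - q by rewrite -dv_r rmorphB /root hornerD hornerN pq subrr.
  case/dvdpP => h hE; apply/eqP; rewrite -subr_eq0 -hornerN -hornerD -rmorphB hE /=.
  by rewrite rmorphM hornerM (rootP rw) mulr0.
have /fin_all_exists[P PE] (x : gT * 'I_n * 'I_n) : exists p : {poly rat}, (ev p).[z] = entry x.
  have : entry x \in [seq entry x | x <- enum {: gT * 'I_n * 'I_n}] by rewrite map_f ?mem_enum.
  by rewrite psE => /mapP[p _ ->]; exists p.
pose Q (p : {poly rat}) : C := (map_poly ratr p).[w].
exists (fun s => \matrix_(i, j) Q (P (s, i, j))); split.
- apply/matrixP => i j; rewrite !mxE /Q (transfer _ (i == j)%:R%:P).
  by rewrite map_polyC hornerC /= ratr_nat.
  by rewrite PE /entry /= repr_mx1 mxE /ev map_polyC hornerC /= ratr_nat.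
- move=> s t Gs Gt; apply/matrixP => i j; rewrite !mxE /Q.
  rewrite (transfer _ (\sum_k P (s, i, k) * P (t, k, j))).
    by rewrite rmorph_sum horner_sum; apply: eq_bigr => k _; rewrite !mxE rmorphM hornerM.
  rewrite PE /entry /= repr_mxM // mxE /ev rmorph_sum horner_sum; apply: eq_bigr => k _.
  by rewrite rmorphM hornerM -!/(ev _) !PE.
move=> s c tr_s.
have := transfer (\sum_i P (s, i, i)) c%:~R%:P.
rewrite /ev !map_polyC !hornerC /= !ratr_int => <-.
  by rewrite rmorph_sum horner_sum; apply: eq_bigr => i _; rewrite mxE.
by rewrite -tr_s /ev rmorph_sum horner_sum; apply: eq_bigr => i _; rewrite -/(ev _) PE.
Qed.

(** * Tensor powers and their symmetrizer *)

Definition fun_mx (R : nzRingType) (X : finType) (g : X -> X -> R) : 'M[R]_#|X| :=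
  \matrix_(i, j) g (enum_val i) (enum_val j).

Lemma sum_enum_val (R : nzRingType) (X : finType) (F : X -> R) :
  \sum_(i < #|X|) F (enum_val i) = \sum_x F x.
Proof.
rewrite [RHS](reindex (@enum_val X X)) //=.
by exists enum_rank => x _; rewrite ?enum_valK ?enum_rankK.
Qed.

Lemma fun_mxM (R : nzRingType) (X : finType) (g h : X -> X -> R) :
  fun_mx g *m fun_mx h = fun_mx (fun x y => \sum_z g x z * h z y).
Proof.
apply/matrixP => i j; rewrite !mxE -[RHS]sum_enum_val.
by apply: eq_bigr => k _; rewrite !mxE.
Qed.

Lemma fun_mx_trace (R : nzRingType) (X : finType) (g : X -> X -> R) :
  \tr (fun_mx g) = \sum_x g x x.
Proof. by rewrite /mxtrace -[RHS]sum_enum_val; apply: eq_bigr => i _; rewrite mxE. Qed.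

Lemma eq_fun_mx (R : nzRingType) (X : finType) (g h : X -> X -> R) :
  g =2 h -> fun_mx g = fun_mx h.
Proof. by move=> gh; apply/matrixP => i j; rewrite !mxE. Qed.

Lemma fun_mx1 (R : nzRingType) (X : finType) :
  fun_mx (fun x y : X => (x == y)%:R) = 1%:M :> 'M[R]_#|X|.
Proof. by apply/matrixP => i j; rewrite !mxE (inj_eq enum_val_inj). Qed.

Lemma sum_pair_delta (R : comNzRingType) (I : finType) (F : I -> R) (i : I) :
  \sum_j (i == j)%:R * F j = F i.
Proof.
rewrite (bigD1 i) //= eqxx mul1r big1 ?addr0 // => j.
by rewrite eq_sym => /negPf->; rewrite mul0r.
Qed.

Definition tensor_index (n d m : nat) : finType := ('I_n * {ffun 'I_d -> 'I_m})%type.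

(** The action of [u] on [M (x) V^(x)d], trivial on [M]; words index the basis of the tensor
    power. *)
Definition tensor_pow (R : comNzRingType) (n d m : nat) (u : 'M[R]_m) :
  'M[R]_#|tensor_index n d m| :=
  fun_mx (fun x y : tensor_index n d m => (x.1 == y.1)%:R * \prod_i u (x.2 i) (y.2 i)).

(** The map [M s] tensored with a permutation of places. The inverse compensates for the reversal of
    order in [fcomp_permM]. *)
Definition tensor_perm (R : comNzRingType) (n d m : nat) (M : 'S_d -> 'M[R]_n) (s : 'S_d) :
    'M[R]_#|tensor_index n d m| :=
  fun_mx (fun x y : tensor_index n d m => M s x.1 y.1 * (fcomp_perm x.2 s^-1%g == y.2)%:R).

Lemma tensor_pow1 (R : comNzRingType) (n d m : nat) : tensor_pow n d (1%:M : 'M[R]_m) = 1%:M.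
Proof.
rewrite -fun_mx1; apply: eq_fun_mx => -[a f] [b g] /=; rewrite xpair_eqE -mulnb natrM;
  congr (_ * _).
case: eqP => [->|/eqP fg]; first by rewrite big1 // => i _; rewrite mxE eqxx.
have [i fgi] : exists i, f i != g i.
  by apply/existsP; apply: contraR fg; rewrite negb_exists => /forallP h; apply/eqP/ffunP => i;
    apply/eqP; have := h i; rewrite negbK.
by rewrite (bigD1 i) //= mxE (negPf fgi) mul0r.
Qed.

Lemma tensor_powM (R : comNzRingType) (n d m : nat) (u v : 'M[R]_m) :
  tensor_pow n d (u *m v) = tensor_pow n d u *m tensor_pow n d v.
Proof.
rewrite fun_mxM; apply: eq_fun_mx => -[a f] [b g] /=.
rewrite -(pair_bigA _ (fun (c : 'I_n) (h : {ffun 'I_d -> 'I_m}) =>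
  (a == c)%:R * (\prod_i u (f i) (h i)) * ((c == b)%:R * \prod_i v (h i) (g i)))) /=.
under [RHS]eq_bigr do under eq_bigr do rewrite -mulrA.
under [RHS]eq_bigr do rewrite -mulr_sumr.
rewrite sum_pair_delta; under [RHS]eq_bigr do rewrite mulrCA -big_split /=.
rewrite -mulr_sumr; congr (_ * _).
by under eq_bigr do rewrite mxE; rewrite bigA_distr_bigA.
Qed.

Lemma tensor_permM (R : comNzRingType) (n d m : nat) (M : 'S_d -> 'M[R]_n) :
  (forall s t, M (s * t)%g = M s *m M t) ->
  forall s t, tensor_perm m M (s * t)%g = tensor_perm m M s *m tensor_perm m M t.
Proof.
move=> MM s t; rewrite fun_mxM; apply: eq_fun_mx => -[a f] [b g] /=.
rewrite -(pair_bigA _ (fun (c : 'I_n) (h : {ffun 'I_d -> 'I_m}) =>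
  M s a c * (fcomp_perm f s^-1%g == h)%:R * (M t c b * (fcomp_perm h t^-1%g == g)%:R))) /=.
rewrite MM mxE mulr_suml; apply: eq_bigr => c _.
under eq_bigr do rewrite mulrACA mulrC -mulrA.
rewrite sum_pair_delta mulrC invMg fcomp_permM //.
Qed.

Lemma tensor_pow_permC (R : comNzRingType) (n d m : nat) (M : 'S_d -> 'M[R]_n) (u : 'M[R]_m) (s :
  'S_d) :
  tensor_pow n d u *m tensor_perm m M s = tensor_perm m M s *m tensor_pow n d u.
Proof.
rewrite !fun_mxM; apply: eq_fun_mx => -[a f] [b g] /=.
rewrite -(pair_bigA _ (fun (c : 'I_n) (h : {ffun 'I_d -> 'I_m}) =>
  (a == c)%:R * (\prod_i u (f i) (h i)) * (M s c b * (fcomp_perm h s^-1%g == g)%:R))) /=.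
rewrite -(pair_bigA _ (fun (c : 'I_n) (h : {ffun 'I_d -> 'I_m}) =>
  M s a c * (fcomp_perm f s^-1%g == h)%:R * ((c == b)%:R * \prod_i u (h i) (g i)))) /=.
under eq_bigr do under eq_bigr do rewrite -mulrA.
under eq_bigr do rewrite -mulr_sumr.
rewrite sum_pair_delta [RHS]exchange_big /=.
under [RHS]eq_bigr do under eq_bigr do rewrite mulrACA [M s a _ * _]mulrC eq_sym -mulrA.
under [RHS]eq_bigr do rewrite sum_pair_delta.
under [RHS]eq_bigr do rewrite mulrCA.
rewrite sum_pair_delta.
have gE (h : {ffun 'I_d -> 'I_m}) : (fcomp_perm h s^-1%g == g) = (fcomp_perm g s == h).
  by apply/eqP/eqP => <-; rewrite -fcomp_permM ?mulgV ?mulVg fcomp_perm1.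
under eq_bigr do rewrite gE mulrCA mulrA mulrC.
rewrite sum_pair_delta; congr (_ * _).
rewrite (reindex_inj (@perm_inj _ s^-1%g)) /=.
by apply: eq_bigr => i _; rewrite !ffunE permKV.
Qed.

(** The rank factorization of a projector then represents operators commuting with it on its image,
    multiplicatively. *)
Lemma idempotent_factor (F : fieldType) (n : nat) (A : 'M[F]_n) : A *m A = A ->
  row_base A *m col_base A = 1%:M.
Proof.
move=> AA; apply: (row_full_inj (col_base_full A)); apply: (row_free_inj (row_base_free A)).
by rewrite /= mulmx1 mulmxA mulmx_base -mulmxA mulmx_base.
Qed.

Definition symmetrizer (C : numFieldType) (n d m : nat) (M : 'S_d -> 'M[C]_n) :
    'M[C]_#|tensor_index n d m| :=
  d`!%:R^-1 *: \sum_s tensor_perm m M s.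

Lemma symmetrizer_idempotent (C : numFieldType) (n d m : nat) (M : 'S_d -> 'M[C]_n) :
  (forall s t, M (s * t)%g = M s *m M t) -> symmetrizer m M *m symmetrizer m M = symmetrizer m M.
Proof.
move=> MM.
have permS s : tensor_perm m M s *m (\sum_t tensor_perm m M t) = \sum_t tensor_perm m M t.
  rewrite mulmx_sumr [RHS](reindex_inj (mulgI s)); apply: eq_bigr => t _.
  by rewrite tensor_permM.
rewrite /symmetrizer -scalemxAl -scalemxAr mulmx_suml (eq_bigr _ (fun s _ => permS s)).
rewrite sumr_const card_Sn -scaler_nat !scalerA -mulrA mulVf ?mulr1 //.
by rewrite pnatr_eq0 -lt0n fact_gt0.
Qed.

Definition symmetrized_pow (C : numFieldType) (n d m : nat) (M : 'S_d -> 'M[C]_n) (u : 'M[C]_m) :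
    'M[C]_(\rank (symmetrizer m M)) :=
  row_base (symmetrizer m M) *m tensor_pow n d u *m col_base (symmetrizer m M).

Section SymmetrizedPow.
Variables (C : numFieldType) (n d m : nat) (M : 'S_d -> 'M[C]_n).
Hypothesis MM : forall s t, M (s * t)%g = M s *m M t.

Lemma symmetrized_pow1 : symmetrized_pow M (1%:M : 'M[C]_m) = 1%:M.
Proof. by rewrite /symmetrized_pow tensor_pow1 mulmx1 idempotent_factor // symmetrizer_idempotent.
  Qed.

Lemma symmetrizerC (u : 'M[C]_m) :
  tensor_pow n d u *m symmetrizer m M = symmetrizer m M *m tensor_pow n d u.
Proof.
rewrite /symmetrizer -scalemxAl -scalemxAr mulmx_suml mulmx_sumr; congr (_ *: _).
by apply: eq_bigr => s _; rewrite tensor_pow_permC.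
Qed.

Lemma symmetrized_powM (u v : 'M[C]_m) :
  symmetrized_pow M (u *m v) = symmetrized_pow M u *m symmetrized_pow M v.
Proof.
have PP := symmetrizer_idempotent m MM.
rewrite /symmetrized_pow; set P := symmetrizer m M; set K := row_base P; set L := col_base P.
have KL : K *m L = 1%:M by apply: idempotent_factor.
have PL : P *m L = L by rewrite -[RHS]mulmx1 -KL mulmxA mulmx_base.
set U := tensor_pow n d u; set V := tensor_pow n d v.
have -> : K *m U *m L *m (K *m V *m L) = K *m (U *m ((L *m K) *m V) *m L) by rewrite !mulmxA.
by rewrite mulmx_base -symmetrizerC -!mulmxA PL tensor_powM -!mulmxA.
Qed.

Lemma symmetrized_pow_trace (u : 'M[C]_m) : \tr (symmetrized_pow M u) =
  d`!%:R^-1 * \sum_s \tr (M s) * \sum_(f : {ffun 'I_d -> 'I_m}) \prod_i u (f (s^-1%g i)) (f i).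
Proof.
rewrite /symmetrized_pow mxtrace_mulC mulmxA mulmx_base /symmetrizer.
rewrite -scalemxAl mxtraceZ mulmx_suml raddf_sum; congr (_ * _); apply: eq_bigr => s _ /=.
rewrite fun_mxM fun_mx_trace /mxtrace mulr_suml.
rewrite -(pair_bigA _ (fun (a : 'I_n) (f : {ffun 'I_d -> 'I_m}) =>
  \sum_z M s a z.1 * (fcomp_perm f s^-1%g == z.2)%:R * ((z.1 == a)%:R * \prod_i u (z.2 i) (f i))))
    /=.
apply: eq_bigr => a _; rewrite mulr_sumr; apply: eq_bigr => f _.
rewrite -(pair_bigA _ (fun (c : 'I_n) (h : {ffun 'I_d -> 'I_m}) =>
  M s a c * (fcomp_perm f s^-1%g == h)%:R * ((c == a)%:R * \prod_i u (h i) (f i)))) /=.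
under eq_bigr do under eq_bigr do rewrite mulrACA mulrC -mulrA.
under eq_bigr do rewrite sum_pair_delta mulrA mulrC eq_sym.
by rewrite sum_pair_delta mulrC; congr (_ * _); apply: eq_bigr => i _; rewrite ffunE.
Qed.

(** For a diagonal matrix only words constant on the cycles of [s] contribute, and these make up the
    power sum. *)
Lemma symmetrized_pow_trace_diag (x : 'I_m -> C) :
  \tr (symmetrized_pow M (diag_mx (\row_i x i))) = d`!%:R^-1 * \sum_s \tr (M s) * psum_perm x s.
Proof.
rewrite symmetrized_pow_trace; congr (_ * _); apply: eq_bigr => s _; congr (_ * _).
rewrite /psum_perm [RHS]big_mkcond; apply: eq_bigr => f _.
case: eqP => [fs|fs].
  apply: eq_bigr => i _; have := congr1 (fun g : {ffun 'I_d -> 'I_m} => g (s^-1%g i)) fs.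
  by rewrite ffunE permKV => <-; rewrite !mxE eqxx.
have [i fi] : exists i, f (s i) != f i.
  apply/existsP; apply: contra_notT fs; rewrite negb_exists => /forallP h.
  by apply/ffunP => i; rewrite ffunE; apply/eqP; have := h i; rewrite negbK.
by rewrite (bigD1 (s i)) //= !mxE permK eq_sym (negPf fi) mulr0n mul0r.
Qed.

Lemma symmetrized_pow_trace_sim (P u v : 'M[C]_m) : P \in unitmx -> u = invmx P *m v *m P ->
  \tr (symmetrized_pow M u) = \tr (symmetrized_pow M v).
Proof.
move=> Pu ->; rewrite !symmetrized_powM mxtrace_mulC mulmxA -symmetrized_powM.
by rewrite mulmxV // symmetrized_pow1 mul1mx.
Qed.

Lemma symmetrized_pow_polynomial : exists Q : 'I_(\rank (symmetrizer m M)) ->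
  'I_(\rank (symmetrizer m M)) ->
    {mpoly C[m * m]}, forall (u : 'M[C]_m) a b,
  symmetrized_pow M u a b = (Q a b).@[fun k => mxvec u 0 k].
Proof.
pose q (x y : tensor_index n d m) : {mpoly C[m * m]} :=
  (x.1 == y.1)%:R * \prod_i 'X_(mxvec_index (x.2 i) (y.2 i)).
exists (fun a b => \sum_j (\sum_i (row_base (symmetrizer m M) a i)%:MP * q (enum_val i) (enum_val
  j)) *
  (col_base (symmetrizer m M) j b)%:MP) => u a b.
rewrite mxE raddf_sum; apply: eq_bigr => j _; rewrite /= mevalM mevalC mxE raddf_sum; congr (_ * _).
apply: eq_bigr => i _; rewrite /= mevalM mevalC; congr (_ * _).
rewrite mevalM rmorph_nat rmorph_prod mxE; congr (_ * _); apply: eq_bigr => k _.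
by rewrite /= mevalXU mxvecE.
Qed.
End SymmetrizedPow.

(** * Sums of characters and evaluation at eigenvalues *)

Lemma is_polynomial_character0 (R : realType) (m : nat) :
  is_polynomial_character R (0 : {mpoly int[m]}).
Proof.
exists 0%N, (fun=> 0); split=> [||u x _ _].
- by split=> [|u v _ _]; rewrite ?mulmx0 //; apply/matrixP => -[].
- by exists (fun _ _ => 0) => u _ [].
by rewrite mxtrace0 raddf0 meval0.
Qed.

Lemma is_polynomial_characterD (R : realType) (m : nat) (p q : {mpoly int[m]}) :
  is_polynomial_character R p -> is_polynomial_character R q ->
  is_polynomial_character R (p + q).
Proof.
move=> [d1 [r1 [[r1_1 r1M] [P1 P1E] r1_tr]]] [d2 [r2 [[r2_1 r2M] [P2 P2E] r2_tr]]].
exists (d1 + d2)%N, (fun u => block_mx (r1 u) 0 0 (r2 u)); split=> [||u x uu ux].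
- split=> [|u v uu uv]; first by rewrite r1_1 r2_1 -scalar_mx_block.
  by rewrite mulmx_block !mulmx0 !mul0mx !addr0 add0r r1M // r2M.
- exists (fun a b => match split a, split b with
    | inl a, inl b => P1 a b | inr a, inr b => P2 a b | _, _ => 0 end).
  move=> u uu a b; rewrite !mxE; case: splitP => a' _; rewrite !mxE; case: splitP => b' _;
  by rewrite ?mxE ?meval0 ?P1E ?P2E.
by rewrite mxtrace_block (r1_tr u x) // (r2_tr u x) // raddfD mevalD.
Qed.

Lemma is_polynomial_character_sum (R : realType) (m : nat) (I : Type) (r : seq I)
    (c : I -> int) (F : I -> {mpoly int[m]}) :
  (forall i, 0 <= c i) -> (forall i, is_polynomial_character R (F i)) ->
  is_polynomial_character R (\sum_(i <- r) c i *: F i).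
Proof.
move=> c_ge0 Fchar; elim: r => [|i r IHr].
  by rewrite big_nil; apply: is_polynomial_character0.
rewrite big_cons; refine (is_polynomial_characterD _ IHr).
have -> : c i = `|c i|%N%:R by rewrite natz gez0_abs.
rewrite scaler_nat; move: `|c i|%N => n.
elim: n => [|n IHn]; first exact: is_polynomial_character0.
by rewrite mulrS; refine (is_polynomial_characterD (Fchar i) IHn).
Qed.

Lemma psum_perm_sym (R : comNzRingType) (m d : nat) (t : 'S_m) (y : 'I_m -> R) (s : 'S_d) :
  psum_perm (fun i => y (t i)) s = psum_perm y s.
Proof.
rewrite /psum_perm (reindex (fun f : {ffun 'I_d -> 'I_m} => [ffun i => t^-1%g (f i)])) /=;
  last first.
  exists (fun f : {ffun 'I_d -> 'I_m} => [ffun i => t (f i)]) => f _; apply/ffunP => i;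
  by rewrite !ffunE ?permK ?permKV.
apply: eq_big => [f|f _]; last by apply: eq_bigr => i _; rewrite ffunE permKV.
apply/eqP/eqP => /ffunP fs; apply/ffunP => i; have := fs i; rewrite !ffunE; last by move->.
exact: perm_inj.
Qed.

Lemma prod_XsubC_perm (C : fieldType) (m : nat) (x y : 'I_m -> C) :
  \prod_(i < m) ('X - (x i)%:P) = \prod_(i < m) ('X - (y i)%:P) ->
  exists t : 'S_m, x =1 fun i => y (t i).
Proof.
pose tx := [tuple x i | i < m]; pose ty := [tuple y i | i < m].
have prodE (z : 'I_m -> C) : \prod_(i < m) ('X - (z i)%:P) =
  \prod_(c <- [tuple z i | i < m]) ('X - c%:P).
  by rewrite big_tuple; apply: eq_bigr => i _; rewrite tnth_mktuple.
rewrite !prodE => /prod_XsubC_eq/tuple_permP[t tE]; exists t => i.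
have -> : x i = tnth tx i by rewrite tnth_mktuple.
have -> : y (t i) = tnth [tuple tnth ty (t j) | j < m] i by rewrite !tnth_mktuple.
by congr (tnth _ i); apply: val_inj.
Qed.

Lemma char_poly_conj (C : fieldType) (m : nat) (P A : 'M[C]_m) : P \in unitmx ->
  char_poly (invmx P *m A *m P) = char_poly A.
Proof.
move=> Pu; rewrite /char_poly /char_poly_mx.
have PP : map_mx polyC (invmx P) *m map_mx polyC P = 1%:M by rewrite -map_mxM mulVmx // map_mx1.
have -> : 'X%:M - map_mx polyC (invmx P *m A *m P) =
    map_mx polyC (invmx P) *m ('X%:M - map_mx polyC A) *m map_mx polyC P.
  by rewrite mulmxBr mulmxBl !map_mxM scalar_mxC; congr (_ - _); rewrite -mulmxA PP mulmx1.
by rewrite !det_mulmx mulrAC -det_mulmx PP det1 mul1r.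
Qed.

(** The spectral theorem may list the eigenvalues in another order than [x]; [t] records the
    difference. *)
Lemma unitary_diagonalizable (C : numClosedFieldType) (m : nat) (u : 'M[C]_m) (x : 'I_m -> C) :
  u \is unitarymx -> char_poly u = \prod_(i < m) ('X - (x i)%:P) ->
  exists P (t : 'S_m), P \in unitmx /\ u = invmx P *m diag_mx (\row_i x (t i)) *m P.
Proof.
move=> uu ux; have /orthomx_spectralP uE : u \is normalmx.
  apply/normalmxP; rewrite (unitarymxP uu).
  by move: uu; rewrite -trmxC_unitary => /unitarymxP; rewrite trmxCK.
have Pu := spectral_unit u.
move: (spectralmx u) (spectral_diag u) Pu uE => P D Pu uE.
have /prod_XsubC_perm[t tE] : \prod_(i < m) ('X - (D 0 i)%:P) = \prod_(i < m) ('X - (x i)%:P).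
  rewrite -ux uE.
  rewrite char_poly_conj // char_poly_trig ?diag_mx_is_trig //; apply: eq_bigr => i _.
  by rewrite !mxE eqxx.
exists P, t; split=> //; rewrite {1}uE; congr (_ *m diag_mx _ *m _).
by apply/rowP => i; rewrite mxE tE.
Qed.

Lemma schur_eval (C : numClosedFieldType) (m : nat) (l : bounded_partition m) (x : 'I_m -> C) :
  \sum_(s : 'S_(part_size l)) (frobenius_char (shifted l) s)%:~R * psum_perm x s =
  (part_size l)`!%:R * (map_mpoly intr (schur l)).@[x].
Proof.
have := congr1 (fun p => (map_mpoly intr p : {mpoly C[m]}).@[x]) (sum_frobenius_char l).
rewrite /= rmorphM /= mevalM !rmorph_nat => <-; rewrite [map_mpoly _ _]rmorph_sum raddf_sum;
  apply: eq_bigr => s _ /=.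
rewrite rmorphM /= mevalM map_mpolyC mevalC; congr (_ * _).
rewrite /psum_perm [map_mpoly _ _]rmorph_sum raddf_sum; apply: eq_bigr => f _ /=;
  rewrite !rmorph_prod.
by apply: eq_bigr => i _; rewrite /= map_mpolyX mevalXU.
Qed.

Lemma is_polynomial_character_schur (R : realType) (m : nat) (l : bounded_partition m) :
  is_polynomial_character R (schur l).
Proof.
have [i chiE] := frobenius_irr l; set d := part_size l in i chiE.
have [M [M1 MM trM]] := algC_repr_transfer R[i] 'Chi_i.
have MMT s t : M (s * t)%g = M s *m M t by rewrite MM ?inE.
have [Q QE] := symmetrized_pow_polynomial m M.
exists (\rank (symmetrizer m M)), (symmetrized_pow M); split.
- by split=> [|u v _ _]; [apply: symmetrized_pow1 | apply: symmetrized_powM].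
- by exists Q => u _ a b; apply: QE.
move=> u x uu ux; have [P [t [Pu uE]]] := unitary_diagonalizable uu ux.
rewrite (symmetrized_pow_trace_sim MMT Pu uE) symmetrized_pow_trace_diag.
have d0 : d`!%:R != 0 :> R[i] by rewrite pnatr_eq0 -lt0n fact_gt0.
apply: (mulfI d0); rewrite mulVKf // -schur_eval; apply: eq_bigr => s _.
(* Power sums ignore the order of the eigenvalues, and the character values are integers, so they
   survive the passage from [algC] to [R[i]]. *)
rewrite psum_perm_sym; congr (_ * _); apply: trM.
by rewrite -chiE -irrRepr cfunE inE.
Qed.

Theorem propositionC (s : nat) (k : 'I_s -> nat) (hk : exists j, k j = 1%N)
    (m : nat) (hm : (0 < m)%N) :
  exists n0 : nat, forall n : nat, (n0 <= n)%N ->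
    schur_nonneg (prod_at_vars_pow m (prod1DXn k) n) /\
    (forall R : realType, is_polynomial_character R (prod_at_vars_pow m (prod1DXn k) n)).
Proof.
pose ks := [seq k j | j <- enum 'I_s].
have ks1 : 1%N \in ks by have [j <-] := hk; rewrite map_f ?mem_enum.
have -> : prod1DXn k = cprod int ks by rewrite /cprod big_map big_enum.
have [n0 n0P] := schur_nonneg_prod m ks1; exists n0 => n /n0P nonneg; split=> // R.
have [c [r _ ->] c_ge0] := nonneg.
exact: (is_polynomial_character_sum r c_ge0 (@is_polynomial_character_schur R m)).
Qed.
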